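(* For every $\eta\in(0,1)$ there exists a constant $C(\eta)<\infty$, depending only on $\eta$, such that for every $N\ge 2$, every family of normalized symmetric meeting rates $(\nu_{i,j})$ on $N$ agents with spectral gap $\lambda>0$, every number of songs $\sigma\ge 1$, and every initial configuration $X_0$, the fixation time $T_{\mathrm{fix}}$ of the iPod process with interaction parameter $\eta$ satisfies $$\mathbb{E}\,T_{\mathrm{fix}}\le C(\eta)\,\ln(\sigma)\,\frac{N}{\lambda}.$$
   Context: iPod model. Let $I$ be a set of $N\ge 2$ agents with meeting rates $\nu_{i,j}=\nu_{j,i}\ge 0$ for $i\ne j$ (and $\nu_{i,i}=0$), normalized so that $\sum_j\nu_{i,j}=1$ for every $i$. Fix $\sigma\ge 1$ (number of songs) and $\eta\in(0,1)$. At each time $t\ge 0$ each agent $i$ has a probability vector $X_t(i)=(X_t^k(i))_{1\le k\le\sigma}$ on $\{1,\dots,\sigma\}$; the initial configuration $X_0$ is an arbitrary such collection. To each ordered pair $(i,j)$, $i\neq j$, is attached a Poisson process of rate $\nu_{i,j}$, all independent; its points are meeting times of $i$ and $j$. At a meeting time $t$ of $i$ and $j$, agents $i$ and $j$ independently choose (play) songs $\sigma_i\sim X_{t-}(i)$ and $\sigma_j\sim X_{t-}(j)$; then $X_t^{k}(i)=(1-\eta)X_{t-}^{k}(i)+\eta\,1_{\{k=\sigma_j\}}$ and $X_t^{k}(j)=(1-\eta)X_{t-}^{k}(j)+\eta\,1_{\{k=\sigma_i\}}$ for all $k$, and all other agents are unchanged. Paths are càdlàg. Fixation time: if exactly one song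 is played infinitely often, $T_{\mathrm{fix}}$ is the last time at which any other song is played ($T_{\mathrm{fix}}=0$ if no other song is ever played); if more than one song is played infinitely often, $T_{\mathrm{fix}}=\infty$. Spectral gap: for $f:I\to\mathbb{R}$ let $\varepsilon(f,f)=\sum_{i,j}\frac{\nu_{i,j}}{2N}(f(i)-f(j))^2$ (sum over ordered pairs) and let $\mathrm{Var}(f)$ be the variance of $f$ under the uniform measure on $I$; then $\lambda=\inf\{\varepsilon(f,f)/\mathrm{Var}(f): \mathrm{Var}(f)\ne 0\}$. *)

(* Defs.v *)
From HB Require Import structures.
From mathcomp Require Import all_boot all_order all_algebra.
From mathcomp Require Import all_classical all_reals all_analysis.

Set Implicit Arguments.
Unset Strict Implicit.
Unset Printing Implicit Defensive.

Import Order.TTheory GRing.Theory Num.Theory.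
Import numFieldNormedType.Exports.

Local Open Scope classical_set_scope.
Local Open Scope ring_scope.

Record meeting_rates (R : realType) (I : finType) (nu : I -> I -> R) : Prop := {
  rate_ge0 : forall i j, 0 <= nu i j;
  rate_sym : forall i j, nu i j = nu j i;
  rate_diag : forall i, nu i i = 0;
  rate_normalized : forall i, \sum_j nu i j = 1
}.

Definition dirichlet_form (R : realType) (I : finType) (nu : I -> I -> R)
    (f : I -> R) : R :=
  \sum_i \sum_j nu i j / (2 * #|I|%:R) * (f i - f j) ^+ 2.

Definition uniform_mean (R : realType) (I : finType) (f : I -> R) : R :=
  (\sum_i f i) / #|I|%:R.

Definition uniform_variance (R : realType) (I : finType) (f : I -> R) : R :=
  uniform_mean (fun i => (f i - uniform_mean f) ^+ 2).

Definition spectral_gap (R : realType) (I : finType) (nu : I -> I -> R) : R :=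
  inf [set dirichlet_form nu f / uniform_variance f
      | f in [set f : I -> R | uniform_variance f != 0]].

Definition probability_vector (R : realType) (sigma : nat) (x : 'I_sigma -> R)
    : Prop :=
  (forall k, 0 <= x k) /\ \sum_k x k = 1.

Record filtration (R : realType) (d : measure_display) (T : measurableType d)
    (F : R -> set (set T)) : Prop := {
  filtration_sigma_algebra : forall t : R, 0 <= t -> sigma_algebra setT (F t);
  filtration_measurable : forall t : R, 0 <= t -> F t `<=` measurable;
  filtration_nondecreasing : forall s t : R, 0 <= s -> s <= t -> F s `<=` F t
}.

(* [M i j t w] counts the points in [0, t] of the Poisson process attached to
   the ordered pair (i, j). In [clocks_poisson] the second argument of the
   library's [poisson_prob] is a dummy; [poisson_prob] is used because, unlike
   [poisson_pmf], it is correct at rate 0. The field [clocks_independent] says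
   that F s and the increments over ]s, t] of all the processes are mutually
   independent; with adaptedness this gives both the independence of the
   increments of each process and the independence of the processes. *)
Record poisson_clocks (R : realType) (I : finType) (nu : I -> I -> R)
    (d : measure_display) (T : measurableType d) (P : probability T R)
    (F : R -> set (set T)) (M : I -> I -> R -> T -> nat) : Prop := {
  clocks_start : forall i j w, i != j -> M i j 0 w = 0%N;
  clocks_nondecreasing : forall i j (s t : R) w, i != j -> 0 <= s -> s <= t ->
    (M i j s w <= M i j t w)%N;
  clocks_right_continuous : forall i j (t : R) w, i != j -> 0 <= t ->
    \forall s \near t^'+, M i j s w = M i j t w;
  clocks_adapted : forall i j (t : R) n, i != j -> 0 <= t ->
    F t [set w | M i j t w = n];
  clocks_poisson : forall i j (s t : R) (U : set nat), i != j ->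
    0 <= s -> s <= t ->
    P [set w | U (M i j t w - M i j s w)%N] =
    poisson_prob (nu i j * (t - s)) 0%N U;
  clocks_independent : forall (s t : R) (A : set T) (m : I -> I -> nat),
    0 <= s -> s <= t -> F s A ->
    P (A `&` [set w | forall i j, i != j ->
                (M i j t w - M i j s w)%N = m i j]) =
    (P A * \prod_(p : I * I | p.1 != p.2)
       P [set w | (M p.1 p.2 t w - M p.1 p.2 s w)%N = m p.1 p.2])%E
}.

(* The time of the n-th point (counted from 0) of the process (i, j), equal to
   +oo if there are at most n points. *)
Definition meeting_time (R : realType) (I : finType) (T : Type)
    (M : I -> I -> R -> T -> nat) (i j : I) (n : nat) (w : T) : \bar R :=
  ereal_inf [set t%:E | t in [set t : R | 0 <= t /\ (n < M i j t w)%N]].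

Definition left_limit (R : realType) (f : R -> R) (t : R) : R :=
  lim (f s @[s --> t^'-]).

(* [X t i k w] is the weight that agent i gives to song k at time t, and
   [song i j n w] is the pair (song played by i, song played by j) at the n-th
   meeting attached to (i, j).
   [ipod_song_law] is the conditional law of the songs played at a meeting time
   tau given the strict past of tau: the sets A `&` [s < tau], with A in F s,
   form a pi-system generating the sigma-algebra of that past (on tau > 0). *)
Record ipod_process (R : realType) (I : finType) (nu : I -> I -> R) (eta : R)
    (sigma : nat) (x0 : I -> 'I_sigma -> R)
    (d : measure_display) (T : measurableType d) (P : probability T R)
    (F : R -> set (set T)) (M : I -> I -> R -> T -> nat)
    (song : I -> I -> nat -> T -> 'I_sigma * 'I_sigma)
    (X : R -> I -> 'I_sigma -> T -> R) : Prop := {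
  ipod_filtration : filtration F;
  ipod_clocks : poisson_clocks nu P F M;
  ipod_state_adapted : forall (t : R) i k (B : set R), 0 <= t -> measurable B ->
    F t (X t i k @^-1` B);
  ipod_song_adapted : forall i j n (t : R) kl, i != j -> 0 <= t ->
    F t [set w | (meeting_time M i j n w <= t%:E)%E /\ song i j n w = kl];
  ipod_right_continuous : forall (t : R) i k w, 0 <= t ->
    X s i k w @[s --> t^'+] --> X t i k w;
  ipod_left_limits : forall (t : R) i k w, 0 < t ->
    cvg (X s i k w @[s --> t^'-]);
  ipod_initial : forall i k w, X 0 i k w = x0 i k;
  ipod_song_law : forall i j n (s : R) (A : set T) k l, i != j ->
    0 <= s -> F s A ->
    let B := A `&` [set w | (s%:E < meeting_time M i j n w < +oo)%E] in
    P (B `&` [set w | song i j n w = (k, l)]) =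
    (\int[P]_(w in B)
       (left_limit (fun t => X t i k w) (fine (meeting_time M i j n w)) *
        left_limit (fun t => X t j l w) (fine (meeting_time M i j n w)))%:E)%E;
  ipod_meeting : {ae P, forall w, forall i j n (t : R) k, i != j ->
    meeting_time M i j n w = t%:E ->
    X t i k w = (1 - eta) * left_limit (fun s => X s i k w) t
                + eta * (k == (song i j n w).2)%:R /\
    X t j k w = (1 - eta) * left_limit (fun s => X s j k w) t
                + eta * (k == (song i j n w).1)%:R};
  ipod_unchanged : {ae P, forall w, forall i (s t : R) k, 0 <= s -> s <= t ->
    (forall j, j != i -> M i j t w = M i j s w /\ M j i t w = M j i s w) ->
    X t i k w = X s i k w}
}.

Definition play_times (R : realType) (I : finType) (T : Type) (sigma : nat)
    (M : I -> I -> R -> T -> nat)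
    (song : I -> I -> nat -> T -> 'I_sigma * 'I_sigma)
    (w : T) (k : 'I_sigma) : set R :=
  [set t | exists i j n, [/\ i != j, meeting_time M i j n w = t%:E &
             (song i j n w).1 = k \/ (song i j n w).2 = k]].

(* The value is also +oo if no song is played infinitely often, which has
   probability 0 in the iPod model. *)
Definition fixation_time (R : realType) (I : finType) (T : Type) (sigma : nat)
    (M : I -> I -> R -> T -> nat)
    (song : I -> I -> nat -> T -> 'I_sigma * 'I_sigma) (w : T) : \bar R :=
  match [pick k | `[< forall l, infinite_set (play_times M song w l)
                                <-> l = k >]] with
  | Some k => ereal_sup [set t%:E | t in [set t : R |
      t = 0 \/ exists2 l, l != k & play_times M song w l t]]
  | None => +oo%E
  end.

(* Main.v *)
Require Import Defs.
From HB Require Import structures.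
From mathcomp Require Import all_boot all_order all_algebra.
From mathcomp Require Import all_classical all_reals all_analysis.
From mathcomp Require Import measurable_realfun.
From mathcomp Require Import ring lra.

Set Implicit Arguments.
Unset Strict Implicit.
Unset Printing Implicit Defensive.

Import Order.TTheory GRing.Theory Num.Theory.
Import numFieldNormedType.Exports.

Local Open Scope classical_set_scope.
Local Open Scope ring_scope.

(* Write N for the number of agents, S_k for the total weight of song k, Q_k for
   the sum of the squares of its weights and A_k = S_k - Q_k.

   The potential
     a (N ln (N + 2) - sum_k S_k ln (S_k + 2)) + b sum_k Q_k / (S_k + 2)
   is at most a (N ln sigma + 2) + b N.  The sum S_k is a martingale with
   quadratic variation rate 2 eta^2 A_k, so by convexity the entropy term
   decreases at rate at least a (eta^2 / 3) sum_k A_k / (S_k + 2), while the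
   Poincare inequality turns the decrease of the second term into spatial
   variance.  For suitable a and b, of order 1 / lambda, the potential decreases
   at rate at least sum_k S_k (1 - S_k / N) / (S_k + 2), since
   A_k + N Var_k = S_k (1 - S_k / N).  This rate dominates a multiple of psi,
   which is 1 if every song misses weight more than 1/2 and (N - S_k) / eta if
   song k misses at most 1/2.

   If song k misses weight Y = N - S_k, then the probability that another song
   is ever played again is at most Y / eta: as long as nothing but k is played, Y
   decreases at rate 2 eta Y, whereas other songs are played at rate at most
   2 Y.  Hence psi bounds the probability that fixation has not yet occurred,
   and integrating over time bounds the expectation of the fixation time.

   The time evolution is discretised: over an interval of length h all
   expectations are computed up to O(h^2), which sums to O(h) over a time grid. *)

(** * Drift of the potential *)

(** The entropy term makes the bound logarithmic in sigma, but it does not suffice: it stands still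
    when every agent is certain of one song, even if the agents disagree. The quadratic term
    decreases precisely through disagreement. The randomness of the plays may increase it, by an
    amount of order A_k / (S_k + 2), and a is chosen large enough compared with b to absorb this.
    The shift by 2 exceeds every jump of S_k, which is at most 2 eta in absolute value, so the
    relative jump stays in ]-1, 1] even for a song that has almost disappeared.

    The songs are drawn at random times, given a past that is described only through events of the
    filtration at deterministic times. Short intervals replace stopping times: before the only
    meeting in an interval, the state is the one at its left end, so the law of the songs can be
    read off there. The error constants depend on N and sigma, which is harmless because they only
    multiply squared steps. *)

(* Apply [ln v >= 1 - 1 / v] to [v = sqrt (1 + u)]. *)
Lemma xlnx_lower_bound (R : realType) (u : R) : -1 < u -> u <= 1 ->
  u + u ^+ 2 / 6 <= (1 + u) * ln (1 + u).
Proof.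
move=> u1 u2; have u0 : 0 < 1 + u by lra.
pose v := Num.sqrt (1 + u).
have v0 : 0 < v by rewrite sqrtr_gt0.
have v2 : v ^+ 2 = 1 + u by rewrite sqr_sqrtr// ltW.
have lnv : 1 - v^-1 <= ln v.
  have := @le_ln1Dx R (v^-1 - 1); rewrite addrCA subrr addr0 lnV ?posrE//.
  have : 0 < v^-1 by rewrite invr_gt0.
  move=> vi0 /(_ ltac:(lra)); lra.
rewrite -v2 lnXn//.
have -> : u = v ^+ 2 - 1 by lra.
have lnv' : v - 1 <= v * ln v.
  have := ler_wpM2l (ltW v0) lnv; rewrite mulrBr mulr1 divff ?gt_eqF//.
(* A rational upper bound of the square root of 2 for which [(v + 1) ^+ 2 <= 6] still holds. *)
have v1 : v <= 17/12 by nra.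
have h1 : v * (v - 1) <= v * (v * ln v) by rewrite ler_wpM2l// ltW.
have -> : v ^+ 2 * (ln v *+ 2) = 2 * (v * (v * ln v)) by rewrite mulr2n; ring.
have h2 : 0 <= (v - 1) ^+ 2 * (6 - (v + 1) ^+ 2).
  rewrite mulr_ge0 ?sqr_ge0//; nra.
nra.
Qed.

(** * Effect of one meeting on the weights of one song *)

Section potential.
Variables (R : realType) (eta : R) (I : finType).
Hypothesis heta : 0 < eta < 1.

(** The numbers [a] and [b] indicate whether [i], respectively [j], plays the song; each agent moves
    towards what the other plays. *)
Definition update1 (f : I -> R) (i j : I) (a b : R) : I -> R := fun t =>
  if t == i then (1 - eta) * f i + eta * b
  else if t == j then (1 - eta) * f j + eta * a else f t.

Definition total (f : I -> R) : R := \sum_i f i.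

Definition total_sq (f : I -> R) : R := \sum_i f i ^+ 2.

Definition xlog (s : R) : R := s * ln (s + 2).

Lemma sum_update1 (h : R -> R) (f : I -> R) i j a b : i != j ->
  \sum_t h (update1 f i j a b t) = \sum_t h (f t)
    + (h ((1 - eta) * f i + eta * b) - h (f i))
    + (h ((1 - eta) * f j + eta * a) - h (f j)).
Proof.
move=> ij.
rewrite (bigD1 i)//= (bigD1 j)//=; last by rewrite eq_sym.
rewrite [in RHS](bigD1 i)//= [in RHS](bigD1 j)//=; last by rewrite eq_sym.
rewrite /update1 eqxx eq_sym (negbTE ij) eqxx.
under eq_bigr => t /andP[/negbTE-> /negbTE->] do [].
ring.
Qed.

Lemma total_update1 f i j a b : i != j ->
  total (update1 f i j a b) = total f + eta * (a + b - f i - f j).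
Proof. by move=> ij; rewrite /total (sum_update1 id)//; ring. Qed.

Lemma total_sq_update1 f i j a b : i != j ->
  total_sq (update1 f i j a b) = total_sq f
    + (((1 - eta) * f i + eta * b) ^+ 2 - f i ^+ 2)
    + (((1 - eta) * f j + eta * a) ^+ 2 - f j ^+ 2).
Proof. by move=> ij; rewrite /total_sq (sum_update1 (fun y => y ^+ 2)). Qed.

(* The expectation of [h] at two independent Bernoulli variables of parameters
   [p] and [q]. *)
Definition bern2 (p q : R) (h : R -> R -> R) : R :=
  p * q * h 1 1 + p * (1 - q) * h 1 0 + (1 - p) * q * h 0 1
  + (1 - p) * (1 - q) * h 0 0.

Lemma le_bern2 (p q : R) (h1 h2 : R -> R -> R) : 0 <= p <= 1 -> 0 <= q <= 1 ->
  (forall a b, 0 <= a <= 1 -> 0 <= b <= 1 -> h1 a b <= h2 a b) ->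
  bern2 p q h1 <= bern2 p q h2.
Proof.
move=> /andP[p0 p1] /andP[q0 q1] h12; rewrite /bern2.
have h0 : 0 <= (0 : R) <= 1 by rewrite lexx ler01.
have h1' : 0 <= (1 : R) <= 1 by rewrite lexx ler01.
by rewrite !lerD// ler_wpM2l ?mulr_ge0 ?h12//; lra.
Qed.

(** The linear coefficient is the derivative of [xlog] at [s]. With [u = dl / (s + 2)] one has
    [s + dl = (s + 2) * (1 + u) - 2], so the claim follows from the lower bound for
    [(1 + u) * ln (1 + u)] and from [ln (1 + u) <= u]. *)
Lemma xlog_jump (s dl : R) : 0 <= s -> -2 < dl -> dl <= 2 ->
  xlog s + dl * (ln (s + 2) + s / (s + 2)) + dl ^+ 2 / (6 * (s + 2))
    <= xlog (s + dl).
Proof.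
move=> s0 d0 d1; have s2 : 0 < s + 2 by lra.
pose u := dl / (s + 2).
have u1 : -1 < u by rewrite /u ltr_pdivlMr//; lra.
have u2 : u <= 1 by rewrite /u ler_pdivrMr//; lra.
have dlE : dl = u * (s + 2) by rewrite /u mulfVK// gt_eqF.
have := xlnx_lower_bound u1 u2.
have : ln (1 + u) <= u by apply: le_ln1Dx.
have lnE : ln (s + dl + 2) = ln (s + 2) + ln (1 + u).
  rewrite dlE -lnM ?posrE//; last by lra.
  by congr ln; ring.
rewrite /xlog lnE; set L := ln (1 + u); set L2 := ln (s + 2).
move=> h1 h2.
have -> : dl ^+ 2 / (6 * (s + 2)) = u ^+ 2 / 6 * (s + 2).
  by rewrite dlE; field; rewrite gt_eqF.
have -> : dl * (L2 + s / (s + 2)) = dl * L2 + u * s.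
  by rewrite dlE; field; rewrite gt_eqF.
rewrite dlE.
have := ler_wpM2r (ltW s2) h2.
nra.
Qed.

(** The jump [eta * (a + b - f i - f j)] is centred: the linear term of [xlog_jump] averages to zero
    and only the variance of the jump survives. *)
Lemma bern2_xlog f i j : i != j -> (forall t, 0 <= f t <= 1) ->
  bern2 (f i) (f j) (fun a b => - xlog (total (update1 f i j a b)))
  <= - xlog (total f)
     - eta ^+ 2 / 6 * (f i * (1 - f i) + f j * (1 - f j)) / (total f + 2).
Proof.
move=> ij f01; have S0 : 0 <= total f by apply: sumr_ge0 => t _; case/andP: (f01 t).
have /andP[e0 e1] := heta.
have /andP[p0 p1] := f01 i; have /andP[q0 q1] := f01 j.
have s2 : 0 < total f + 2 by lra.
set s := total f in S0 s2 *.
apply: (le_trans (y := bern2 (f i) (f j) (fun a b =>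
   - (xlog s + (eta * (a + b - f i - f j)) * (ln (s + 2) + s / (s + 2))
     + (eta * (a + b - f i - f j)) ^+ 2 / (6 * (s + 2)))))).
  apply: le_bern2 => // a b /andP[a0 a1] /andP[b0 b1].
  rewrite lerN2 total_update1//; apply: xlog_jump => //; nra.
rewrite /bern2 le_eqVlt; apply/orP; left; apply/eqP.
by field; rewrite gt_eqF.
Qed.

(** The exact remainder of the first order expansion in [dl] is [dl ^+ 2 / (s + 2) ^+ 2] times
    [Q' / (s + dl + 2)], and this last factor is at most 1. *)
Lemma div_jump (Q' s dl : R) : 0 <= s -> -2 < dl -> Q' <= s + dl ->
  Q' / (s + dl + 2) <= Q' / (s + 2) - Q' * dl / (s + 2) ^+ 2
    + dl ^+ 2 / (s + 2) ^+ 2.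
Proof.
move=> s0 d0 Qs; have s2 : 0 < s + 2 by lra.
have sd : 0 < s + dl + 2 by lra.
rewrite -subr_ge0.
have -> : Q' / (s + 2) - Q' * dl / (s + 2) ^+ 2 + dl ^+ 2 / (s + 2) ^+ 2 -
  Q' / (s + dl + 2) = dl ^+ 2 / (s + 2) ^+ 2 * ((s + dl + 2 - Q') / (s + dl + 2)).
  by field; rewrite !gt_eqF.
by rewrite mulr_ge0// divr_ge0 ?sqr_ge0// ?ltW//; lra.
Qed.

(** The mean change of [total_sq] contributes the coefficient 1 of the local variances and the whole
    disagreement term. The covariance between the new [total_sq] and the jump of [total] is
    nonnegative and enters with a minus sign, so it is dropped. The remainder of [div_jump] adds
    another 1/2, because [total f + 2 >= 2]. *)
Lemma bern2_ratio f i j : i != j -> (forall t, 0 <= f t <= 1) ->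
  bern2 (f i) (f j) (fun a b =>
    total_sq (update1 f i j a b) / (total (update1 f i j a b) + 2))
  <= total_sq f / (total f + 2)
     + (3 / 2 * eta ^+ 2 * (f i * (1 - f i) + f j * (1 - f j))
        - 2 * eta * (1 - eta) * (f i - f j) ^+ 2) / (total f + 2).
Proof.
move=> ij f01; have S0 : 0 <= total f by apply: sumr_ge0 => t _; case/andP: (f01 t).
have /andP[e0 e1] := heta.
have /andP[p0 p1] := f01 i; have /andP[q0 q1] := f01 j.
have s2 : 0 < total f + 2 by lra.
set s := total f in S0 s2 *.
pose del a b := eta * (a + b - f i - f j).
pose dQ a b := total_sq f
    + (((1 - eta) * f i + eta * b) ^+ 2 - f i ^+ 2)
    + (((1 - eta) * f j + eta * a) ^+ 2 - f j ^+ 2).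
apply: (le_trans (y := bern2 (f i) (f j) (fun a b =>
   dQ a b / (s + 2) - dQ a b * del a b / (s + 2) ^+ 2
     + del a b ^+ 2 / (s + 2) ^+ 2))).
  apply: le_bern2 => // a b a01 b01.
  rewrite [X in _ / (X + 2)]total_update1// total_sq_update1// -/s -/(dQ a b).
  apply: div_jump => //.
    by rewrite /del; move: a01 b01 => /andP[a0 a1] /andP[b0 b1]; nra.
  rewrite /dQ -total_sq_update1// -total_update1//.
  apply: ler_sum => t _.
  suff /andP[t0 t1] : 0 <= update1 f i j a b t <= 1 by nra.
  move: a01 b01 => /andP[a0 a1] /andP[b0 b1].
  rewrite /update1; case: ifP => _; [|case: ifP => _ //]; nra.
set Vi := f i * (1 - f i); set Vj := f j * (1 - f j).
have Vi0 : 0 <= Vi by rewrite mulr_ge0//; lra.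
have Vj0 : 0 <= Vj by rewrite mulr_ge0//; lra.
have -> : bern2 (f i) (f j) (fun a b =>
   dQ a b / (s + 2) - dQ a b * del a b / (s + 2) ^+ 2
     + del a b ^+ 2 / (s + 2) ^+ 2) =
  total_sq f / (s + 2)
  + (eta ^+ 2 * (Vi + Vj) - 2 * eta * (1 - eta) * (f i - f j) ^+ 2) / (s + 2)
  - eta ^+ 2 * (Vi * (2 * f j * (1 - eta) + eta) + Vj * (2 * f i * (1 - eta) + eta))
     / (s + 2) ^+ 2
  + eta ^+ 2 * (Vi + Vj) / (s + 2) ^+ 2.
  by rewrite /bern2 /dQ /del /Vi /Vj; field; rewrite gt_eqF.
have h1 : 0 <= eta ^+ 2 * (Vi * (2 * f j * (1 - eta) + eta)
    + Vj * (2 * f i * (1 - eta) + eta)) / (s + 2) ^+ 2.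
  rewrite divr_ge0 ?sqr_ge0// mulr_ge0 ?sqr_ge0//.
  by apply: addr_ge0; apply: mulr_ge0 => //; nra.
have h2 : eta ^+ 2 * (Vi + Vj) / (s + 2) ^+ 2
   <= 1 / 2 * (eta ^+ 2 * (Vi + Vj)) / (s + 2).
  have -> : 1 / 2 * (eta ^+ 2 * (Vi + Vj)) / (s + 2) =
    eta ^+ 2 * (Vi + Vj) * ((s + 2) / 2) / (s + 2) ^+ 2.
    by field; rewrite gt_eqF.
  rewrite ler_pM2r ?invr_gt0 ?exprn_gt0// ler_peMr//; last by lra.
  by rewrite mulr_ge0 ?sqr_ge0 ?addr_ge0.
have h3 : (3 / 2 * eta ^+ 2 * (Vi + Vj) - 2 * eta * (1 - eta) * (f i - f j) ^+ 2) / (s + 2)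
  = (eta ^+ 2 * (Vi + Vj) - 2 * eta * (1 - eta) * (f i - f j) ^+ 2) / (s + 2)
   + 1 / 2 * (eta ^+ 2 * (Vi + Vj)) / (s + 2).
  by field; rewrite gt_eqF.
lra.
Qed.

Definition pot1 (ca cb : R) (f : I -> R) : R :=
  cb * (total_sq f / (total f + 2)) - ca * xlog (total f).

Lemma bern2_pot1 ca cb f i j : 0 <= ca -> 0 <= cb -> i != j ->
  (forall t, 0 <= f t <= 1) ->
  bern2 (f i) (f j) (fun a b => pot1 ca cb (update1 f i j a b)) - pot1 ca cb f
  <= ((3 / 2 * eta ^+ 2 * cb - eta ^+ 2 / 6 * ca)
        * (f i * (1 - f i) + f j * (1 - f j))
      - 2 * eta * (1 - eta) * cb * (f i - f j) ^+ 2) / (total f + 2).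
Proof.
move=> ca0 cb0 ij f01.
have h1 := ler_wpM2l cb0 (bern2_ratio ij f01).
have h2 := ler_wpM2l ca0 (bern2_xlog ij f01).
have -> : bern2 (f i) (f j) (fun a b => pot1 ca cb (update1 f i j a b)) =
  cb * bern2 (f i) (f j) (fun a b =>
    total_sq (update1 f i j a b) / (total (update1 f i j a b) + 2)) +
  ca * bern2 (f i) (f j) (fun a b => - xlog (total (update1 f i j a b))).
  by rewrite /bern2 /pot1; ring.
have := lerD h1 h2; rewrite /pot1.
set A1 := _ * bern2 _ _ _; set A2 := _ * bern2 _ _ _.
set V := _ + f j * _; set Q := total_sq f; set s := total f.
set D := (f i - f j) ^+ 2; set r := (s + 2)^-1; set X := xlog s => h; lra.
Qed.

End potential.

(** * The spectral gap and the Poincare inequality *)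

Section spectral_gap.
Variables (R : realType) (I : finType) (nu : I -> I -> R).
Hypotheses (I2 : (2 <= #|I|)%N) (rates : meeting_rates nu).
Local Notation N := (#|I|%:R : R).

Let N0 : 0 < N.
Proof. by rewrite ltr0n; apply: leq_trans I2. Qed.

Lemma dirichlet_formE (f : I -> R) :
  dirichlet_form nu f = (\sum_i \sum_j nu i j * (f i - f j) ^+ 2) / (2 * N).
Proof.
rewrite /dirichlet_form mulr_suml; apply: eq_bigr => i _.
rewrite mulr_suml; apply: eq_bigr => j _.
by rewrite -mulrA [_^-1 * _]mulrC mulrA.
Qed.

Lemma uniform_varianceE (f : I -> R) :
  uniform_variance f = (total_sq f - total f ^+ 2 / N) / N.
Proof.
rewrite /uniform_variance /uniform_mean -/(total f); congr (_ / _).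
set c := total f / N.
have sq i : (f i - c) ^+ 2 = f i ^+ 2 - 2 * c * f i + c ^+ 2 by ring.
under eq_bigr => i _ do rewrite sq.
rewrite big_split sumrB /= -/(total_sq f) -mulr_sumr -/(total f).
rewrite sumr_const -mulr_natr cardT -cardE /c.
by field; rewrite gt_eqF.
Qed.

Lemma uniform_variance_ge0 (f : I -> R) : 0 <= uniform_variance f.
Proof.
by rewrite /uniform_variance /uniform_mean divr_ge0 ?ler0n// sumr_ge0// => i _; rewrite sqr_ge0.
Qed.

Lemma dirichlet_form_ge0 f : 0 <= dirichlet_form nu f.
Proof.
rewrite dirichlet_formE divr_ge0 ?mulr_ge0 ?ler0n//.
by apply: sumr_ge0 => i _; apply: sumr_ge0 => j _; rewrite mulr_ge0 ?sqr_ge0// (rate_ge0 rates).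
Qed.

Lemma spectral_gap_le f : uniform_variance f != 0 ->
  spectral_gap nu <= dirichlet_form nu f / uniform_variance f.
Proof.
move=> f0; apply: ge_inf; last by exists f.
exists 0 => _ [g _ <-].
by rewrite divr_ge0 ?dirichlet_form_ge0 ?uniform_variance_ge0.
Qed.

(** Both sides are [N] times those of the variational inequality. Functions of zero variance are
    excluded from the infimum and are treated apart: for them the left side vanishes. *)
Lemma poincare (f : I -> R) :
  spectral_gap nu * (total_sq f - total f ^+ 2 / N)
  <= (\sum_i \sum_j nu i j * (f i - f j) ^+ 2) / 2.
Proof.
have key : spectral_gap nu * uniform_variance f <= dirichlet_form nu f.
  have [->|f0] := eqVneq (uniform_variance f) 0.
    by rewrite mulr0 dirichlet_form_ge0.
  have := spectral_gap_le f0.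
  by rewrite ler_pdivlMr// lt0r f0 uniform_variance_ge0.
move: key; rewrite uniform_varianceE dirichlet_formE.
move=> /(ler_wpM2r (ltW N0)).
set a := _ - _; set b := \sum__ _; set l := spectral_gap _.
have -> : l * (a / N) * N = l * a by field; rewrite gt_eqF.
have -> // : b / (2 * N) * N = b / 2 by field; rewrite gt_eqF.
Qed.

Lemma sum_rates : \sum_i \sum_j nu i j = N.
Proof.
by under eq_bigr => i _ do rewrite (rate_normalized rates);
  rewrite sumr_const cardT -cardE.
Qed.

Lemma sum_rates_sym (f : I -> R) :
  \sum_i \sum_j nu i j * (f i + f j) = 2 * total f.
Proof.
have -> : \sum_i \sum_j nu i j * (f i + f j) =
  \sum_i \sum_j nu i j * f i + \sum_i \sum_j nu i j * f j.
  rewrite -big_split /=; apply: eq_bigr => i _.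
  by rewrite -big_split /=; apply: eq_bigr => j _; rewrite mulrDr.
have H : \sum_i \sum_j nu i j * f i = total f.
  apply: eq_bigr => i _.
  by rewrite -mulr_suml (rate_normalized rates) mul1r.
rewrite H [X in _ + X]exchange_big/=.
under eq_bigr => j _ do under eq_bigr => i _ do rewrite (rate_sym rates).
by rewrite H mulr_natl mulr2n.
Qed.

(** The test function is the indicator of one agent. The bound serves to absorb constants into
    multiples of [1 / spectral_gap nu]. *)
Lemma spectral_gap_le2 : spectral_gap nu <= 2.
Proof.
have [i0 _] : exists i0 : I, i0 \in I by apply/card_gt0P; apply: leq_trans I2.
pose f (i : I) : R := (i == i0)%:R.
have Sf : total f = 1.
  by rewrite /total (bigD1 i0)//= big1 ?addr0 /f ?eqxx// => i /negbTE ni; rewrite ni.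
have Qf : total_sq f = 1.
  rewrite /total_sq (bigD1 i0)//= big1 ?addr0 /f ?eqxx ?expr1n// => i /negbTE ni.
  by rewrite ni expr0n.
have N2 : 2 <= N by rewrite ler_nat.
have := poincare f; rewrite Sf Qf expr1n.
have -> : \sum_i \sum_j nu i j * (f i - f j) ^+ 2 = 2.
  rewrite -[RHS]mulr1 -[X in _ = _ * X]Sf -sum_rates_sym.
  apply: eq_bigr => i _; apply: eq_bigr => j _; rewrite /f.
  have [->|ij] := eqVneq i j; first by rewrite (rate_diag rates) !mul0r.
  congr (_ * _); case: eqP => [ii|_]; case: eqP => [jj|_] /=; try ring.
  by move: ij; rewrite ii jj eqxx.
rewrite div1r => h.
have : N^-1 <= 2^-1 by rewrite lef_pV2 ?posrE//; lra.
have [l0|l0] := leP (spectral_gap nu) 0; first by move=> _; lra.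
by move=> h2; nra.
Qed.

End spectral_gap.

(** * Potential and dissipation of a configuration *)

Section configurations.
Variables (R : realType) (eta : R) (I : finType) (nu : I -> I -> R) (sigma : nat).
Hypotheses (heta : 0 < eta < 1) (I2 : (2 <= #|I|)%N) (rates : meeting_rates nu).
Hypothesis (gap0 : 0 < spectral_gap nu).
Local Notation N := (#|I|%:R : R).
Local Notation config := (I -> 'I_sigma -> R).
Implicit Types (x : config) (k l m : 'I_sigma).

Let N2 : 2 <= N. Proof. by rewrite ler_nat. Qed.

Definition valid x := forall i, probability_vector (x i).

Definition update x i j k l : config := fun t m =>
  update1 eta (x^~ m) i j (m == k)%:R (m == l)%:R t.

Lemma valid_le1 x i k : valid x -> 0 <= x i k <= 1.
Proof.
move=> /(_ i)[x0 x1]; rewrite x0/= -x1 (bigD1 k)//= lerDl.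
by apply: sumr_ge0 => t _.
Qed.

Lemma valid_update x i j k l : i != j -> valid x -> valid (update x i j k l).
Proof.
move=> ij vx t; have /andP[e0 e1] := heta.
have sum1 (q : 'I_sigma) : \sum_m (m == q)%:R = 1 :> R.
  by rewrite (bigD1 q)//= big1 ?addr0 ?eqxx// => m /negbTE ->.
split=> [m|].
  rewrite /update /update1; have /andP[? _] := @valid_le1 x i m vx.
  have /andP[? _] := @valid_le1 x j m vx; have /andP[? _] := @valid_le1 x t m vx.
  case: ifP => _; [|case: ifP => _ //];
    by apply: addr_ge0; apply: mulr_ge0 => //; lra.
rewrite /update /update1; case: (t == i); [|case: (t == j)].
- by rewrite big_split/= -!mulr_sumr (vx i).2 sum1; ring.
- by rewrite big_split/= -!mulr_sumr (vx j).2 sum1; ring.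
- exact: (vx t).2.
Qed.

(** A quantity attached to song [m] depends on the two plays only through the indicators that each
    of them is [m], and these are independent Bernoulli variables. *)
Lemma sum_song x i j m (h : R -> R -> R) : valid x ->
  \sum_k \sum_l x i k * x j l * h (m == k)%:R (m == l)%:R
  = bern2 (x i m) (x j m) h.
Proof.
move=> vx.
have aux t (g : R -> R) : \sum_l x t l * g (m == l)%:R = x t m * g 1 + (1 - x t m) * g 0.
  rewrite (bigD1 m)//= eqxx; congr (_ + _).
  have -> : 1 - x t m = \sum_(l | l != m) x t l.
    by rewrite -(vx t).2 (bigD1 m)//= addrC addrK.
  rewrite mulr_suml.
  by apply: eq_bigr => l; rewrite eq_sym => /negbTE ->.
under eq_bigr => k _ do under eq_bigr => l _ do rewrite -mulrA.
under eq_bigr => k _ do rewrite -mulr_sumr (aux j (h _)).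
rewrite (aux i (fun y => x j m * h y 1 + (1 - x j m) * h y 0)) /bern2; ring.
Qed.

Lemma sum_song1 x i j : valid x -> \sum_k \sum_l x i k * x j l = 1.
Proof.
move=> vx; under eq_bigr => k _ do rewrite -mulr_sumr (vx j).2 mulr1.
exact: (vx i).2.
Qed.

Lemma sum_total x : valid x -> \sum_m total (x^~ m) = N.
Proof.
move=> vx; rewrite /total exchange_big/=.
by under eq_bigr => i _ do rewrite (vx i).2; rewrite sumr_const cardT -cardE.
Qed.

Lemma total_ge0 x m : valid x -> 0 <= total (x^~ m).
Proof. by move=> vx; apply: sumr_ge0 => i _; case/andP: (@valid_le1 x i m vx). Qed.

(* Chosen so that the total drift is exactly
   [- (A + N Var) / (S + 2)] for each song; see [pot1_drift]. *)
Definition spread_coef : R := (4 * eta * (1 - eta) * spectral_gap nu)^-1.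
Definition entropy_coef : R := (3 * eta ^+ 2 * spread_coef + 1) * 3 / eta ^+ 2.

Lemma spread_coef_gt0 : 0 < spread_coef.
Proof. by have /andP[e0 e1] := heta; rewrite invr_gt0 !mulr_gt0//; lra. Qed.

Lemma entropy_coef_gt0 : 0 < entropy_coef.
Proof.
have /andP[e0 e1] := heta; have b0 := spread_coef_gt0.
rewrite /entropy_coef divr_gt0 ?exprn_gt0// mulr_gt0// ltr_wpDl//.
by rewrite mulr_ge0 ?(ltW b0)// mulr_ge0 ?sqr_ge0.
Qed.

Definition pot x : R := entropy_coef * (N * ln (N + 2))
  + \sum_m pot1 entropy_coef spread_coef (x^~ m).

Definition diss x : R :=
  \sum_m total (x^~ m) * (1 - total (x^~ m) / N) / (total (x^~ m) + 2).

Lemma pot1_drift (f : I -> R) : (forall t, 0 <= f t <= 1) ->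
  \sum_i \sum_j nu i j *
    (bern2 (f i) (f j) (fun a b => pot1 entropy_coef spread_coef (update1 eta f i j a b))
     - pot1 entropy_coef spread_coef f)
  <= - (total f * (1 - total f / N) / (total f + 2)).
Proof.
move=> f01; have /andP[e0 e1] := heta.
have b0 := spread_coef_gt0; have a0 := entropy_coef_gt0.
have s0 : 0 <= total f by apply: sumr_ge0 => t _; case/andP: (f01 t).
have s2 : 0 < total f + 2 by lra.
pose V i := f i * (1 - f i).
apply: (le_trans (y := (\sum_i \sum_j nu i j * (V i + V j) * (- (1 / 2))
   - 2 * eta * (1 - eta) * spread_coef * (\sum_i \sum_j nu i j * (f i - f j) ^+ 2))
     / (total f + 2))).
  rewrite [X in _ - X]mulr_sumr -sumrB mulr_suml; apply: ler_sum => i _.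
  rewrite [X in _ - X]mulr_sumr -sumrB mulr_suml; apply: ler_sum => j _.
  have [->|ij] := eqVneq i j.
    by rewrite (rate_diag rates) !(mul0r, mulr0) subr0 mul0r.
  have := ler_wpM2l (rate_ge0 rates i j)
    (bern2_pot1 heta (ltW a0) (ltW b0) ij f01).
  (* This equation determines [entropy_coef]: the entropy compensates the noise of the quadratic
     term and leaves 1/2 per agent and meeting, that is, 1 per agent after summing over ordered
     pairs. *)
  have -> : 3 / 2 * eta ^+ 2 * spread_coef - eta ^+ 2 / 6 * entropy_coef = - (1 / 2).
    by rewrite /entropy_coef; field; rewrite gt_eqF.
  move/le_trans; apply; rewrite le_eqVlt; apply/orP; left; apply/eqP.
  by rewrite /V; ring.
have P := poincare I2 rates f.
rewrite -[X in _ <= X]mulNr ler_pM2r ?invr_gt0//.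
have -> : \sum_i \sum_j nu i j * (V i + V j) * (- (1 / 2)) = - total V.
  under eq_bigr => i _ do rewrite -mulr_suml.
  by rewrite -mulr_suml (sum_rates_sym rates); field.
have -> : total V = total f - total_sq f.
  by rewrite /total /total_sq -sumrB; apply: eq_bigr => i _; rewrite /V; ring.
set E := (\sum_i _) in P *.
have h : 2 * eta * (1 - eta) * spread_coef * E * spectral_gap nu * 2 = E.
  rewrite /spread_coef; field.
  by rewrite (gt_eqF gap0) (gt_eqF e0) subr_eq0 eq_sym lt_eqF.
(* Here the value of [spread_coef] cancels the gap in the Poincare inequality. *)
have h2 : total_sq f - total f ^+ 2 / N <= 2 * eta * (1 - eta) * spread_coef * E.
  rewrite -(ler_pM2r gap0); lra.
have -> : total f * (1 - total f / N) = total f - total f ^+ 2 / N by ring.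
lra.
Qed.

Lemma pot_drift x : valid x ->
  \sum_i \sum_j nu i j *
    \sum_k \sum_l x i k * x j l * (pot (update x i j k l) - pot x)
  <= - diss x.
Proof.
move=> vx.
have -> : \sum_i \sum_j nu i j *
    \sum_k \sum_l x i k * x j l * (pot (update x i j k l) - pot x)
  = \sum_m \sum_i \sum_j nu i j *
    (bern2 (x i m) (x j m) (fun a b => pot1 entropy_coef spread_coef (update1 eta (x^~ m) i j a b))
     - pot1 entropy_coef spread_coef (x^~ m)).
  rewrite [RHS]exchange_big/=; apply: eq_bigr => i _.
  rewrite [RHS]exchange_big/=; apply: eq_bigr => j _.
  rewrite -mulr_sumr; congr (_ * _).
  have splitE (c : R) : c = \sum_k \sum_l x i k * x j l * c.
    under eq_bigr => k _ do rewrite -mulr_suml.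
    by rewrite -mulr_suml (sum_song1 i j vx) mul1r.
  under [RHS]eq_bigr => m _ do
    rewrite -(sum_song i j m _ vx) [X in _ - X]splitE -sumrB.
  rewrite [RHS]exchange_big/=; apply: eq_bigr => k _.
  under [RHS]eq_bigr => m _ do rewrite -sumrB.
  rewrite [RHS]exchange_big/=; apply: eq_bigr => l _.
  rewrite /pot opprD addrACA subrr add0r -sumrB mulr_sumr.
  by apply: eq_bigr => m _; rewrite mulrBr.
rewrite /diss -sumrN; apply: ler_sum => m _.
by apply: pot1_drift => t; exact: valid_le1.
Qed.

Lemma total_le x k : valid x -> total (x^~ k) <= N.
Proof.
move=> vx; rewrite -(sum_total vx) (bigD1 k)//= lerDl.
by apply: sumr_ge0 => l _; exact: total_ge0.
Qed.

Lemma sum_xlog_le x : valid x -> \sum_m xlog (total (x^~ m)) <= N * ln (N + 2).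
Proof.
move=> vx; rewrite -[X in _ <= X * _](sum_total vx) mulr_suml; apply: ler_sum => m _.
have s0 := total_ge0 m vx.
by rewrite /xlog ler_wpM2l// ler_ln ?posrE ?lerD2r ?total_le//; lra.
Qed.

Lemma ln_ge1BV (y : R) : 0 < y -> 1 - y^-1 <= ln y.
Proof.
move=> y0; have yi : 0 < y^-1 by rewrite invr_gt0.
have := @le_ln1Dx R (y^-1 - 1); rewrite addrCA subrr addr0 lnV ?posrE//.
by move=> /(_ ltac:(lra)); lra.
Qed.

(** Gibbs' inequality against the uniform distribution on songs: apply [ln y >= 1 - 1 / y] to
    [y = (S + 2) * sigma / (N + 2)], which is the ratio of [S + 2] to [(N + 2) / sigma]. The loss 2
    is the difference between the sum of [(N + 2) / sigma] over all songs and the total weight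
    [N]. *)
Lemma sum_xlog_ge x : valid x -> (1 <= sigma)%N ->
  N * ln (N + 2) - N * ln sigma%:R - 2 <= \sum_m xlog (total (x^~ m)).
Proof.
move=> vx sg1; have sg0 : 0 < sigma%:R :> R by rewrite ltr0n.
set sg : R := sigma%:R in sg0 *.
suff : \sum_m (total (x^~ m) - (N + 2) / sg)
    <= \sum_m total (x^~ m) * (ln (total (x^~ m) + 2) + ln sg - ln (N + 2)).
  rewrite sumrB (sum_total vx) sumr_const card_ord -[_ *+ sigma]mulr_natr divfK ?gt_eqF//.
  under [X in _ <= X]eq_bigr => m _ do rewrite -addrA mulrDr.
  rewrite big_split/= -mulr_suml (sum_total vx) -/(xlog _) => h.
  rewrite /xlog; lra.
apply: ler_sum => m _; have s0 := total_ge0 m vx.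
set s := total _ in s0 *.
have s2 : 0 < s + 2 by lra.
have N20 : 0 < N + 2 by rewrite ltr_wpDl ?ler0n.
have y0 : 0 < (s + 2) * sg / (N + 2) by rewrite divr_gt0 ?mulr_gt0.
have := ler_wpM2l s0 (ln_ge1BV y0).
rewrite [ln (_ / _)]ln_div ?posrE ?mulr_gt0// [ln (_ * _)]lnM ?posrE//.
move/(le_trans _); apply.
have -> : ((s + 2) * sg / (N + 2))^-1 = (N + 2) / sg / (s + 2).
  by field; rewrite !gt_eqF.
rewrite mulrBr mulr1 lerD2l lerN2 mulrCA ler_piMr//.
  by rewrite divr_ge0 ?(ltW sg0)//; lra.
by rewrite ler_pdivrMr//; lra.
Qed.

Lemma total_sq_le x m : valid x -> total_sq (x^~ m) <= total (x^~ m).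
Proof.
move=> vx; apply: ler_sum => i _.
by have /andP[p0 p1] := @valid_le1 x i m vx; nra.
Qed.

Lemma total_sq_ge0 (f : I -> R) : 0 <= total_sq f.
Proof. by apply: sumr_ge0 => i _; exact: sqr_ge0. Qed.

Lemma potE x : pot x = entropy_coef * (N * ln (N + 2) - \sum_m xlog (total (x^~ m)))
  + spread_coef * \sum_m (total_sq (x^~ m) / (total (x^~ m) + 2)).
Proof. by rewrite /pot /pot1 sumrB -!mulr_sumr; ring. Qed.

Lemma pot_ge0 x : valid x -> 0 <= pot x.
Proof.
move=> vx; rewrite potE; apply: addr_ge0; apply: mulr_ge0.
- exact/ltW/entropy_coef_gt0.
- by rewrite subr_ge0 sum_xlog_le.
- exact/ltW/spread_coef_gt0.
- apply: sumr_ge0 => m _; rewrite divr_ge0 ?total_sq_ge0//.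
  by rewrite addr_ge0 ?total_ge0.
Qed.

Lemma pot_le x : valid x -> (1 <= sigma)%N ->
  pot x <= entropy_coef * (N * ln sigma%:R + 2) + spread_coef * N.
Proof.
move=> vx sg; rewrite potE.
apply: lerD; rewrite ler_wpM2l ?(ltW entropy_coef_gt0) ?(ltW spread_coef_gt0)//.
  by have := sum_xlog_ge vx sg; lra.
rewrite -(sum_total vx); apply: ler_sum => m _.
have s0 := total_ge0 m vx; have q := total_sq_le m vx.
by rewrite ler_pdivrMr; [nra|lra].
Qed.

Definition close k x : R := (N - total (x^~ k) <= 1 / 2)%R%:R.

(** As [N >= 2], at most one song can miss weight at most 1/2, so at most one term of the sum is
    nonzero; the product is the indicator that there is no such song. *)
Definition psi x : R := \sum_k close k x * ((N - total (x^~ k)) / eta)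
  + \prod_k (1 - close k x).

(** The term of [k] is dropped. Every other song [l] has a factor [1 - S_l / N >= 1/2], and [S_l] is
    part of the weight missed by [k], which bounds the denominator. *)
Lemma diss_ge x k : valid x -> (forall l, l != k -> total (x^~ l) <= N / 2) ->
  (N - total (x^~ k)) / 2 / (N - total (x^~ k) + 2) <= diss x.
Proof.
move=> vx h; have sk := total_le k vx.
set Y := N - total (x^~ k).
have YE : \sum_(l | l != k) total (x^~ l) = Y.
  by rewrite /Y -(sum_total vx) [in RHS](bigD1 k)//= [X in _ = X - _]addrC addrK.
have Y0 : 0 <= Y by rewrite subr_ge0.
have N0 : 0 < N by rewrite ltr0n; apply: leq_trans I2.
rewrite /diss (bigD1 k)//=; apply: ler_wpDl.
  rewrite divr_ge0 ?addr_ge0 ?total_ge0// mulr_ge0 ?total_ge0// subr_ge0.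
  by rewrite ler_pdivrMr// mul1r.
rewrite -YE !mulr_suml; apply: ler_sum => l lk.
have sl := total_ge0 l vx; have slN := h l lk.
rewrite YE; apply: ler_pM => //.
- by rewrite divr_ge0.
- by rewrite invr_ge0; lra.
- rewrite ler_wpM2l// lerBrDr -lerBrDl.
  by rewrite ler_pdivrMr//; lra.
- rewrite lef_pV2 ?posrE ?lerD2r; try lra.
  rewrite -YE (bigD1 l)//= lerDl.
  by apply: sumr_ge0 => t _; exact: total_ge0.
Qed.

(** The bound of [diss_ge] is [Y / (2 * (Y + 2))], where [Y] is the weight missed by [k]. It is at
    least [Y / 10] for [Y <= 1/2], which settles the case of a close song. If no song is close, take
    [k] of maximal weight: then [Y > 1/2] and the bound is at least 1/10, its value at 1/2. *)
Lemma psi_le_diss x : valid x -> (1 <= sigma)%N ->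
  eta / 10 * psi x <= diss x.
Proof.
move=> vx sg; have /andP[e0 e1] := heta.
have [/existsP[k hk]|] := boolP [exists k, N - total (x^~ k) <= 1 / 2].
  have small l : l != k -> total (x^~ l) <= 1 / 2.
    move=> lk; apply: le_trans hk.
    rewrite -(sum_total vx) (bigD1 k)//= addrC addrK (bigD1 l)//= lerDl.
    by apply: sumr_ge0 => t _; exact: total_ge0.
  have far l : l != k -> close l x = 0.
    move=> lk; have sl := small _ lk; rewrite /close; case: leP => //= h.
    by have N2' := N2; set s := total _ in h sl; set n := #|I|%:R in h N2'; lra.
  have ck : close k x = 1 by rewrite /close hk.
  have -> : psi x = (N - total (x^~ k)) / eta.
    rewrite /psi (bigD1 k)//= ck mul1r big1; last by move=> l /far ->; rewrite mul0r.
    by rewrite (bigD1 k)//= ck subrr mul0r !addr0.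
  apply: (le_trans _ (diss_ge vx (k := k) _)); last first.
    move=> l /small /le_trans; apply.
    by rewrite ler_pM2r ?invr_gt0// ler1n; apply: leq_trans I2.
  set Y := N - _ in hk *.
  have Y0 : 0 <= Y by rewrite subr_ge0 total_le.
  have -> : eta / 10 * (Y / eta) = Y / 10 by field; rewrite gt_eqF.
  by rewrite ler_pdivlMr; nra.
rewrite negb_exists => /forallP far.
have c0 k : close k x = 0 by rewrite /close (negbTE (far k)).
have -> : psi x = 1.
  rewrite /psi !big1 ?add0r// => k _; rewrite c0 ?subr0//.
  by rewrite mul0r.
pose k0 : 'I_sigma := Ordinal sg.
pose k := [arg max_(l > k0) total (x^~ l)]%O.
have kmax l : total (x^~ l) <= total (x^~ k).
  by rewrite /k; case: arg_maxP => //= ? _; apply.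
apply: (le_trans _ (diss_ge vx (k := k) _)); last first.
  move=> l lk; have := kmax l.
  suff : total (x^~ l) + total (x^~ k) <= N by lra.
  rewrite -(sum_total vx) (bigD1 k)//= (bigD1 l)//= addrCA addrA lerDl.
  by apply: sumr_ge0 => t _; exact: total_ge0.
have := far k; rewrite -ltNge; set Y := N - _ => Yk.
by rewrite ler_pdivlMr; nra.
Qed.

End configurations.

(** * The explicit constant, and the drift of the weight of the other songs *)

Section configuration_bounds.
Variables (R : realType) (eta : R) (I : finType) (nu : I -> I -> R) (sigma : nat).
Hypotheses (heta : 0 < eta < 1) (I2 : (2 <= #|I|)%N).
Local Notation N := (#|I|%:R : R).
Implicit Types (x : I -> 'I_sigma -> R).

(** The factor [10 / eta] undoes that of [psi_le_diss]. The bracket is three times a bound on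
    [entropy_coef] plus twice [spread_coef], both multiplied by the gap; the summand 1 in
    [entropy_coef] has become 2 because the gap is at most 2. *)
Definition fixation_const : R :=
  10 / eta * (3 * ((3 * eta ^+ 2 * (4 * eta * (1 - eta))^-1 + 2) * 3 / eta ^+ 2)
              + 2 * (4 * eta * (1 - eta))^-1).

(** For at least two songs [ln sigma >= 1/2], so the additive terms 2 and [N] of [pot_le] are at
    most twice [N * ln sigma]. *)
Lemma pot_le_const x : meeting_rates nu -> 0 < spectral_gap nu -> valid x ->
  (2 <= sigma)%N ->
  10 / eta * pot eta nu x
    <= fixation_const * ln sigma%:R * (N / spectral_gap nu).
Proof.
move=> rates gap0 vx sg2; have /andP[e0 e1] := heta.
have gap2 := spectral_gap_le2 I2 rates.
have lns : 1 / 2 <= ln (sigma%:R : R).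
  have s0 : 0 < sigma%:R :> R by rewrite ltr0n; apply: leq_trans sg2.
  apply: le_trans (ln_ge1BV s0).
  have : (sigma%:R)^-1 <= 2^-1 :> R by rewrite lef_pV2 ?posrE// ler_nat.
  lra.
have N2 : 2 <= N by rewrite ler_nat.
have b0 := spread_coef_gt0 heta gap0; have a0 := entropy_coef_gt0 heta gap0.
have := pot_le heta gap0 vx (leq_trans (leqnSn 1) sg2).
rewrite /fixation_const -[X in _ -> _ <= X]mulrA -[X in _ -> _ <= X]mulrA.
set c := (4 * eta * (1 - eta))^-1; set L := ln _ in lns *.
set n := (#|I|%:R : R) in N2 *; set p := pot _ _ _ => hp.
set lam := spectral_gap nu in gap0 gap2 *.
have c0 : 0 < c by rewrite invr_gt0 !mulr_gt0//; lra.
have ie0 : 0 < 3 / eta ^+ 2 by rewrite divr_gt0 ?exprn_gt0.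
have bE : spread_coef eta nu = c / lam by rewrite /spread_coef -/lam invfM.
have aE : entropy_coef eta nu <= ((3 * eta ^+ 2 * c + 2) * 3 / eta ^+ 2) / lam.
  have step : 3 * eta ^+ 2 * (c / lam) + 1 <= (3 * eta ^+ 2 * c + 2) / lam.
    have -> : 3 * eta ^+ 2 * (c / lam) = 3 * eta ^+ 2 * c / lam by ring.
    by rewrite [X in _ <= X]mulrDl lerD2l ler_pdivlMr// mul1r.
  have := ler_wpM2r (ltW ie0) step; rewrite /entropy_coef bE !mulrA => /le_trans; apply.
  by rewrite le_eqVlt; apply/orP; left; apply/eqP; ring.
rewrite ler_pM2l ?divr_gt0//; apply: (le_trans hp).
have nL : n <= 2 * (n * L) by nra.
set ca := (_ * 3 / _) in aE *.
have ca0 : 0 < ca.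
  by rewrite /ca -mulrA mulr_gt0// ltr_wpDl// !mulr_ge0 ?sqr_ge0// ltW.
apply: (le_trans (y := ca / lam * (3 * (n * L)) + c / lam * (2 * (n * L)))).
  rewrite bE; apply: lerD.
    by apply: ler_pM => //; lra.
  by rewrite ler_wpM2l// divr_ge0// ltW.
rewrite le_eqVlt; apply/orP; left; apply/eqP; field; by rewrite gt_eqF.
Qed.

(* Playing a pair of songs other than [(k, k)] costs 1; otherwise the total
   weight of the songs other than [k] is updated. *)
Definition deviation x i j k (a b : R) : R :=
  a * b * ((N - total (update1 eta (x^~ k) i j a b)) / eta) + (1 - a * b).

(** Write [p], [q] for the two weights and [z = Y / eta] for the right side. A meeting where both
    play [k] lowers [z] by [(1 - p) + (1 - q)]; this number is at most [Y], hence at most [z]. The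
    average is then [z] minus a sum of two nonnegative products. *)
Lemma deviation_drift x i j k : i != j -> valid x ->
  bern2 (x i k) (x j k) (deviation x i j k) <= (N - total (x^~ k)) / eta.
Proof.
move=> ij vx; have /andP[e0 e1] := heta.
have /andP[p0 p1] := valid_le1 i k vx; have /andP[q0 q1] := valid_le1 j k vx.
have Y1 : (1 - x i k) + (1 - x j k) <= N - total (x^~ k).
  have -> : N - total (x^~ k) = \sum_t (1 - x t k).
    by rewrite sumrB sumr_const cardT -cardE.
  rewrite (bigD1 i)//= (bigD1 j)/=; last by rewrite eq_sym.
  rewrite [X in _ <= X]addrA lerDl; apply: sumr_ge0 => t _.
  by have /andP[? ?] := valid_le1 t k vx; lra.
rewrite /bern2 /deviation !total_update1//.
set Y := N - _ in Y1 *; set p := x i k in p0 p1 Y1 *; set q := x j k in q0 q1 Y1 *.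
rewrite !(mulr0, mul0r, mulr1, subr0, subrr, add0r, addr0).
have -> : N - (total (x^~ k) + eta * (1 + 1 - p - q)) =
  Y - eta * (1 + 1 - p - q) by rewrite /Y; ring.
have -> : (Y - eta * (1 + 1 - p - q)) / eta = Y / eta - (1 + 1 - p - q).
  by field; rewrite gt_eqF.
have Ye : (1 - p) + (1 - q) <= Y / eta.
  by apply: (le_trans Y1); rewrite ler_pdivlMr//; nra.
set z := Y / eta in Ye *.
apply: (le_trans (y := z - ((z - ((1 - p) + (1 - q))) * (1 - p * q)
   + (1 - p) * (1 - q)))).
  by rewrite le_eqVlt; apply/orP; left; apply/eqP; ring.
by rewrite gerBl addr_ge0// mulr_ge0//; nra.
Qed.

End configuration_bounds.

(** * Expectations of bounded random variables *)

Section integral_lemmas.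
Context d (T : measurableType d) (R : realType).

Import HBNNSimple.

(* The integral of a nonnegative function is a supremum over simple functions
   below it, so the smaller function need not be measurable. *)
Lemma ge0_le_integral_ae (mu : {measure set T -> \bar R}) (f g : T -> \bar R) :
  (forall w, 0 <= f w)%E -> (forall w, 0 <= g w)%E -> measurable_fun setT g ->
  {ae mu, forall w, (f w <= g w)%E} ->
  (\int[mu]_w f w <= \int[mu]_w g w)%E.
Proof.
move=> f0 g0 mg fg; rewrite ge0_integralTE//.
apply: ge_ereal_sup => _ [h /= hf <-].
have -> : sintegral mu h = (\int[mu]_w (h w)%:E)%E.
  by rewrite integral_nnsfun// patch_setT.
apply: ae_ge0_le_integral => //.
- by move=> w _; rewrite lee_fin; exact: fun_ge0.
- by apply/measurable_EFinP; exact: measurable_funPT.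
- by apply: filterS fg => w fgw _; exact: le_trans (hf w) fgw.
Qed.

End integral_lemmas.

Section expectation.
Context d (T : measurableType d) (R : realType) (P : probability T R).

(** The bound holds at every point, which makes integrability and stability under sums and products
    immediate. *)
Definition bounded_rv (f : T -> R) : Prop :=
  measurable_fun setT f /\ exists K, forall w, `|f w| <= K.

Definition Ex (f : T -> R) : R := \int[P]_w f w.

Lemma bounded_rv_integrable f : bounded_rv f -> P.-integrable setT (EFin \o f).
Proof.
move=> [mf [K fK]]; apply: measurable_bounded_integrable => //.
  by apply: (le_lt_trans (probability_le1 P _)) => //; rewrite ltry.
exists K; split; first by rewrite num_real.
by move=> M KM w _ /=; rewrite (le_trans (fK w))// ltW.
Qed.

Lemma bounded_rv_cst c : bounded_rv (fun=> c).
Proof. by split; [exact: measurable_cst|exists `|c|]. Qed.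

Lemma bounded_rvD f g : bounded_rv f -> bounded_rv g ->
  bounded_rv (fun w => f w + g w).
Proof.
move=> [mf [K fK]] [mg [L gL]]; split; first exact: measurable_funD.
by exists (K + L) => w; rewrite (le_trans (ler_normD _ _))// lerD.
Qed.

Lemma bounded_rvM f g : bounded_rv f -> bounded_rv g ->
  bounded_rv (fun w => f w * g w).
Proof.
move=> [mf [K fK]] [mg [L gL]]; split; first exact: measurable_funM.
by exists (K * L) => w; rewrite normrM ler_pM.
Qed.

Lemma bounded_rvZ c f : bounded_rv f -> bounded_rv (fun w => c * f w).
Proof. by move=> bf; apply: bounded_rvM => //; exact: bounded_rv_cst. Qed.

Lemma bounded_rvB f g : bounded_rv f -> bounded_rv g ->
  bounded_rv (fun w => f w - g w).
Proof.
move=> bf bg; apply: bounded_rvD => //.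
have -> : (fun w => - g w) = (fun w => -1 * g w) by apply/funext => w; rewrite mulN1r.
exact: bounded_rvZ.
Qed.

Lemma bounded_rv_sum (J : Type) (r : seq J) (Q : pred J) (f : J -> T -> R) :
  (forall j, Q j -> bounded_rv (f j)) ->
  bounded_rv (fun w => \sum_(j <- r | Q j) f j w).
Proof.
move=> bf; elim: r => [|j r IH].
  under eq_fun do rewrite big_nil; exact: bounded_rv_cst.
under eq_fun do rewrite big_cons; case: (boolP (Q j)) => // Qj.
by apply: bounded_rvD => //; exact: bf.
Qed.

Lemma bounded_rv_indic A : measurable A -> bounded_rv (\1_A).
Proof.
move=> mA; split; first exact: measurable_indic.
by exists 1 => w; rewrite indicE; case: (_ \in _); rewrite ?normr1 ?normr0.
Qed.

Lemma Ex_cst c : Ex (fun=> c) = c.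
Proof.
rewrite /Ex Rintegral_cst// -[RHS]mulr1; congr (_ * _).
exact: (congr1 fine (@probability_setT _ _ _ P)).
Qed.

Lemma ExD f g : bounded_rv f -> bounded_rv g ->
  Ex (fun w => f w + g w) = Ex f + Ex g.
Proof. by move=> bf bg; rewrite /Ex RintegralD//; exact: bounded_rv_integrable. Qed.

Lemma ExB f g : bounded_rv f -> bounded_rv g ->
  Ex (fun w => f w - g w) = Ex f - Ex g.
Proof. by move=> bf bg; rewrite /Ex RintegralB//; exact: bounded_rv_integrable. Qed.

Lemma ExZ c f : bounded_rv f -> Ex (fun w => c * f w) = c * Ex f.
Proof. by move=> bf; rewrite /Ex RintegralZl//; exact: bounded_rv_integrable. Qed.

Lemma ExZr c f : bounded_rv f -> Ex (fun w => f w * c) = Ex f * c.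
Proof. by move=> bf; rewrite /Ex RintegralZr//; exact: bounded_rv_integrable. Qed.

Lemma Ex_sum (J : Type) (r : seq J) (Q : pred J) (f : J -> T -> R) :
  (forall j, Q j -> bounded_rv (f j)) ->
  Ex (fun w => \sum_(j <- r | Q j) f j w) = \sum_(j <- r | Q j) Ex (f j).
Proof.
move=> bf; elim: r => [|j r IH].
  by under eq_fun do rewrite big_nil; rewrite big_nil Ex_cst.
rewrite big_cons; under eq_fun do rewrite big_cons; case: (boolP (Q j)) => // Qj.
by rewrite ExD ?IH//; [exact: bf|exact: bounded_rv_sum].
Qed.

Lemma Ex_ge0 f : (forall w, 0 <= f w) -> 0 <= Ex f.
Proof. by move=> f0; exact: Rintegral_ge0. Qed.

Lemma Ex_EFin f : bounded_rv f -> (\int[P]_w (f w)%:E = (Ex f)%:E)%E.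
Proof.
move=> bf; rewrite /Ex /Rintegral fineK//.
by apply: integrable_fin_num => //; exact: bounded_rv_integrable.
Qed.

Lemma le_Ex_ae f g : bounded_rv f -> bounded_rv g ->
  {ae P, forall w, f w <= g w} -> Ex f <= Ex g.
Proof.
move=> bf bg fg; have [mf [K fK]] := bf; have [mg _] := bg.
have Kf w : 0 <= f w + K by have := fK w; rewrite ler_norml; lra.
(* After the shift by [K] the smaller function is nonnegative everywhere, but [g + K] may be
   negative on a null set; [g'] repairs it there. *)
pose g' w := Num.max (g w + K) 0.
have mg' : measurable_fun setT g' by apply: measurable_maxr => //; exact: measurable_funD.
have bg' : bounded_rv g'.
  split => //; have [_ [L gL]] := bg; exists (L + `|K|) => w.
  have := gL w; rewrite ler_norml => /andP[g1 g2].
  have := normr_ge0 K; have := ler_norm K => K1 K2.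
  by rewrite ger0_norm ?le_max ?lexx ?orbT// ge_max; apply/andP; split; lra.
have bfK : bounded_rv (fun w => f w + K) by apply: bounded_rvD => //; exact: bounded_rv_cst.
have bgK : bounded_rv (fun w => g w + K) by apply: bounded_rvD => //; exact: bounded_rv_cst.
suff : Ex (fun w => f w + K) <= Ex (fun w => g w + K).
  by rewrite !ExD ?Ex_cst ?lerD2r//; exact: bounded_rv_cst.
have -> : Ex (fun w => g w + K) = Ex g'.
  rewrite /Ex /Rintegral; congr fine; apply: ae_eq_integral => //.
  - exact/measurable_EFinP/bgK.1.
  - exact/measurable_EFinP.
  - apply: filterS fg => w fgw _; congr (_%:E); rewrite /g' max_l//.
    by apply: (le_trans (Kf w)); rewrite lerD2r.
rewrite -lee_fin -!Ex_EFin//; apply: ae_ge0_le_integral => //.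
- by move=> w _; rewrite lee_fin.
- exact/measurable_EFinP/bfK.1.
- by move=> w _; rewrite lee_fin le_max lexx orbT.
- exact/measurable_EFinP.
- apply: filterS fg => w fgw _; rewrite lee_fin /g' le_max.
  by rewrite lerD2r fgw.
Qed.

Lemma le_Ex f g : bounded_rv f -> bounded_rv g -> (forall w, f w <= g w) ->
  Ex f <= Ex g.
Proof. by move=> bf bg fg; apply: le_Ex_ae => //; exact: aeW. Qed.

Lemma probEFin A : measurable A -> P A = (Ex \1_A)%:E.
Proof.
by move=> mA; rewrite -Ex_EFin ?integral_indic ?setIT//; exact: bounded_rv_indic.
Qed.

Lemma Ex_indic_ge0 A : 0 <= Ex \1_A.
Proof. by apply: Ex_ge0 => w. Qed.

Lemma Ex_indicM A f : measurable A -> bounded_rv f ->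
  (\int[P]_(w in A) (f w)%:E = (Ex (fun w => \1_A w * f w))%:E)%E.
Proof.
move=> mA bf; rewrite -Ex_EFin; last by apply: bounded_rvM => //; exact: bounded_rv_indic.
rewrite integral_mkcond; apply: eq_integral => w _.
by rewrite patchE indicE; case: ifP => _; rewrite ?mul1r ?mul0r.
Qed.

(** The sum counts the positive integers up to [y], so it is the integer part of [y]. *)
Lemma sum_ltn_truncn (y : R) m : 0 <= y -> y <= m%:R ->
  y - 1 <= \sum_(q < m) (q.+1%:R <= y)%R%:R <= y.
Proof.
move=> y0 ym; have /andP[t1 t2] := truncn_itv y0.
have tm : (Num.truncn y <= m)%N by rewrite -(ler_nat R) (le_trans t1).
have -> : \sum_(q < m) (q.+1%:R <= y)%R%:R = (Num.truncn y)%:R :> R.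
  under eq_bigr => q _ do rewrite -truncn_gt_nat.
  rewrite (eq_bigr (fun q : 'I_m => if (q < Num.truncn y)%N then 1 else 0)); last first.
    by move=> q _; case: ifP.
  by rewrite -big_mkcond/= -(big_ord_widen _ (fun=> 1)) // sumr_const card_ord.
by rewrite t1 andbT; move: t2; rewrite -natr1; lra.
Qed.

(* Approximate the weight from below by a combination of its level sets. *)
Lemma le_Ex_weight (G : set (set T)) (g U V : T -> R) :
  G `<=` measurable -> (forall a, G [set w | a <= g w]) ->
  bounded_rv g -> (forall w, 0 <= g w) ->
  bounded_rv U -> (forall w, 0 <= U w) -> bounded_rv V -> (forall w, 0 <= V w) ->
  (forall A, G A -> Ex (fun w => \1_A w * U w) <= Ex (fun w => \1_A w * V w)) ->
  Ex (fun w => g w * U w) <= Ex (fun w => g w * V w).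
Proof.
move=> Gm Gg bg g0 bU U0 bV V0 GUV.
have [_ [K gK]] := bg.
suff H n : Ex (fun w => g w * U w) <= Ex (fun w => g w * V w) + Ex U / n.+1%:R.
  apply/ler_addgt0Pr => e e0.
  have U0' : 0 <= Ex U by exact: Ex_ge0.
  have /andP[_ tn] := truncn_itv (divr_ge0 U0' (ltW e0)).
  apply: (le_trans (H (Num.truncn (Ex U / e)))); rewrite lerD2l.
  by rewrite ler_pdivrMr ?ltr0n// mulrC -ler_pdivrMr// ltW.
pose m := (Num.truncn (K * n.+1%:R)).+1.
have n0 : 0 < n.+1%:R :> R by rewrite ltr0n.
pose A (q : nat) := [set w | q.+1%:R / n.+1%:R <= g w].
have GA q : G (A q) by exact: Gg.
have mA q : measurable (A q) by exact/Gm/GA.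
pose gn w := n.+1%:R^-1 * \sum_(q < m) \1_(A q) w : R.
have bA q : bounded_rv \1_(A q) by exact: bounded_rv_indic.
have bgn : bounded_rv gn by apply: bounded_rvZ; apply: bounded_rv_sum.
have gnE w : gn w <= g w <= gn w + n.+1%:R^-1.
  have y0 : 0 <= g w * n.+1%:R by rewrite mulr_ge0.
  have ym : g w * n.+1%:R <= m%:R.
    apply: (le_trans (y := K * n.+1%:R)).
      by rewrite ler_wpM2r// (le_trans (ler_norm _) (gK w)).
    have K0 : 0 <= K * n.+1%:R by rewrite mulr_ge0// (le_trans _ (gK w)).
    by have /andP[_ /ltW] := truncn_itv K0.
  have := sum_ltn_truncn y0 ym.
  have -> : \sum_(q < m) (q.+1%:R <= g w * n.+1%:R)%R%:R = \sum_(q < m) \1_(A q) w :> R.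
    apply: eq_bigr => q _; rewrite indicE /A; congr (nat_of_bool _)%:R.
    by apply/idP/idP; rewrite inE /= ler_pdivrMr.
  rewrite /gn; set s := \sum__ _ => /andP[s1 s2].
  rewrite mulrC ler_pdivrMr// s2/= -[X in _ + X]mul1r -mulrDl ler_pdivlMr//.
  lra.
have bm f h : bounded_rv f -> bounded_rv h -> bounded_rv (fun w => f w * h w).
  exact: bounded_rvM.
have gnU W : bounded_rv W -> Ex (fun w => gn w * W w)
    = n.+1%:R^-1 * \sum_(q < m) Ex (fun w => \1_(A q) w * W w).
  move=> bW; rewrite -Ex_sum; last by move=> q _; exact: bm.
  rewrite -ExZ; last by apply: bounded_rv_sum => q _; exact: bm.
  by congr Ex; apply/funext => w; rewrite /gn -mulrA mulr_suml.
apply: (le_trans (y := Ex (fun w => gn w * U w + n.+1%:R^-1 * U w))).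
  apply: le_Ex => [||w]; first exact: bm.
    by apply: bounded_rvD; [exact: bm|exact: bounded_rvZ].
  by rewrite -mulrDl ler_wpM2r//; case/andP: (gnE w).
rewrite ExD; [|exact: bm|exact: bounded_rvZ].
rewrite ExZ// [X in _ + X]mulrC lerD2r.
apply: (le_trans (y := Ex (fun w => gn w * V w))).
  by rewrite !gnU// ler_wpM2l ?invr_ge0// ler_sum// => q _; exact: GUV.
apply: le_Ex => [||w]; [exact: bm|exact: bm|].
by rewrite ler_wpM2r//; case/andP: (gnE w).
Qed.

End expectation.

(** * Functions measurable for a smaller sigma-algebra *)

Section sub_sigma_algebra.
Context d (T : measurableType d) (R : realType) (G : set (set T)).
Hypotheses (sG : sigma_algebra setT G) (Gm : G `<=` measurable).

(** Typing the domain by the sigma-algebra generated by [G] makes the usual closure lemmas for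
    measurable functions apply to [G] as well. *)
Definition adapted (g : T -> R) : Prop :=
  measurable_fun (setT : set (g_sigma_algebraType G)) (g : g_sigma_algebraType G -> R).

Lemma adaptedP g : adapted g <-> forall B, measurable B -> G (g @^-1` B).
Proof.
rewrite -(measurable_g_measurableTypeE sG); split=> [mg B mB|mg _ B mB].
  by rewrite -[X in measurable X]setTI; exact: mg.
by rewrite setTI; exact: mg.
Qed.

Lemma adapted_measurable g : adapted g -> measurable_fun setT g.
Proof. by move/adaptedP => mg _ B mB; rewrite setTI; exact/Gm/mg. Qed.

Lemma adapted_ge g a : adapted g -> G [set w | a <= g w].
Proof.
move/adaptedP => /(_ `[a, +oo[%classic (measurable_itv _)).
by congr G; apply/seteqP; split => w /=; rewrite in_itv /= andbT.
Qed.

Lemma adapted_indic A : G A -> adapted \1_A.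
Proof.
move=> GA; apply: measurable_indic.
by rewrite -(measurable_g_measurableTypeE sG) in GA.
Qed.

End sub_sigma_algebra.

(** * Poisson clocks *)

Section sigma_algebra_closure.
Context (T : pointedType) (G : set (set T)).
Hypothesis sG : sigma_algebra setT G.

Lemma sigma_setC A : G A -> G (~` A).
Proof. by case: sG => _ + _ => /[apply]; rewrite setTD. Qed.

Lemma sigma_exists (J : countType) (A : J -> set T) :
  (forall j, G (A j)) -> G [set w | exists j, A j w].
Proof.
move=> GA; case: (sG) => G0 _ GU.
have -> : [set w | exists j, A j w] =
    \bigcup_n (if (unpickle n : option J) is Some j then A j else set0).
  apply/seteqP; split=> w /=.
    by move=> [j Ajw]; exists (pickle j) => //; rewrite pickleK.
  by move=> [n _]; case: unpickle => // j Ajw; exists j.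
by apply: GU => n; case: unpickle.
Qed.

Lemma sigma_forall (J : countType) (A : J -> set T) :
  (forall j, G (A j)) -> G [set w | forall j, A j w].
Proof.
move=> GA; have -> : [set w | forall j, A j w] =
    ~` [set w | exists j, (~` A j) w].
  apply/seteqP; split=> w /=; first by move=> h [j]; apply.
  by move=> h j; apply: contrapT => nA; apply: h; exists j.
by apply/sigma_setC/sigma_exists => j; exact/sigma_setC/GA.
Qed.

Lemma sigma_setI A B : G A -> G B -> G (A `&` B).
Proof.
move=> GA GB; have -> : A `&` B = [set w | forall b : bool, (if b then A else B) w].
  by apply/seteqP; split=> w /= => [[? ?] []//|h]; split; [exact: h true|exact: h false].
by apply: sigma_forall => -[].
Qed.

Lemma sigma_setU A B : G A -> G B -> G (A `|` B).
Proof.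
move=> GA GB; have -> : A `|` B = [set w | exists b : bool, (if b then A else B) w].
  apply/seteqP; split=> w /= => [[?|?]|[[] ?]]; [by exists true|by exists false|by left|by right].
by apply: sigma_exists => -[].
Qed.

Lemma sigma_setD A B : G A -> G B -> G (A `\` B).
Proof. by move=> GA GB; rewrite setDE; apply: sigma_setI => //; exact: sigma_setC. Qed.

Lemma sigma_set0 : G set0. Proof. by case: sG. Qed.

Lemma sigma_setT : G setT. Proof. by rewrite -setC0; apply/sigma_setC/sigma_set0. Qed.

Lemma sigma_prop (Q : Prop) (A : set T) : (Q -> G A) -> G [set w | Q -> A w].
Proof.
move=> QA; have [q|nq] := pselect Q.
  have -> : [set w | Q -> A w] = A by apply/seteqP; split=> w /=; [exact|].
  exact: QA.
have -> : [set w | Q -> A w] = setT by apply/seteqP; split=> w /=.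
exact: sigma_setT.
Qed.

End sigma_algebra_closure.

Section poisson_prob_values.
Variables (R : realType).

Lemma poisson_prob_0 (r : R) : 0 <= r ->
  poisson_prob r 0%N [set 0%N] = (expR (- r))%:E.
Proof.
rewrite le_eqVlt => /predU1P[<-|r0].
  by rewrite /poisson_prob ltxx diracE mem_set// oppr0 expR0.
rewrite /poisson_prob r0 esum_set1 ?lee_fin ?poisson_pmf_ge0//.
by rewrite /poisson_pmf r0 expr0 fact0 invr1 !mul1r.
Qed.

Lemma poisson_prob_1 (r : R) : 0 <= r ->
  poisson_prob r 0%N [set 1%N] = (r * expR (- r))%:E.
Proof.
rewrite le_eqVlt => /predU1P[<-|r0].
  by rewrite /poisson_prob ltxx diracE memNset// mul0r.
rewrite /poisson_prob r0 esum_set1 ?lee_fin ?poisson_pmf_ge0//.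
by rewrite /poisson_pmf r0 expr1 factS fact0 invr1 mulr1.
Qed.

End poisson_prob_values.

(** * Meeting times and the number of meetings in an interval *)

Section clocks.
Context (R : realType) (I : finType) (nu : I -> I -> R)
  (d : measure_display) (T : measurableType d) (P : probability T R)
  (F : R -> set (set T)) (M : I -> I -> R -> T -> nat).
Hypotheses (rates : meeting_rates nu) (filt : filtration F)
  (clocks : poisson_clocks nu P F M).
Local Notation N := (#|I|%:R : R).

(** Right continuity is what excludes an infimum that is not attained: if the count at [t] is at
    most [n], it remains so on a right neighbourhood of [t], and the meeting time exceeds [t]. *)
Lemma meeting_time_le i j n t w : i != j -> 0 <= t ->
  (meeting_time M i j n w <= t%:E)%E <-> (n < M i j t w)%N.
Proof.
move=> ij t0; split=> [|nt]; last by apply: ereal_inf_lbound; exists t.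
rewrite leNgt => h; rewrite ltnNge; apply/negP => Mn; move/negP: h; apply.
have [e /= e0 he] := clocks_right_continuous clocks w ij t0.
apply: (@lt_le_trans _ _ (t + e)%:E); first by rewrite lte_fin ltrDl.
apply: le_ereal_inf_tmp => _ [s [s0 ns] <-]; rewrite lee_fin leNgt.
apply/negP => se; move: ns; rewrite ltnNge => /negP; apply.
have [st|ts] := leP s t.
  exact: leq_trans (clocks_nondecreasing clocks w ij s0 st) Mn.
rewrite (he s _ ts)// /ball/= ltr_distlC; apply/andP; split; lra.
Qed.

Lemma meeting_time_gt i j n t w : i != j -> 0 <= t ->
  (t%:E < meeting_time M i j n w)%E <-> (M i j t w <= n)%N.
Proof.
move=> ij t0; have h := meeting_time_le n w ij t0.
rewrite ltNge leqNgt; split=> /negP nh; apply/negP => /h//.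
Qed.

Lemma meeting_time_real i j n w : i != j -> (meeting_time M i j n w < +oo)%E ->
  exists2 t, 0 < t & meeting_time M i j n w = t%:E.
Proof.
move=> ij fin; have gt0 : (0%:E < meeting_time M i j n w)%E.
  by apply/meeting_time_gt => //; rewrite (clocks_start clocks).
case E : (meeting_time M i j n w) fin gt0 => [t| |]//= _.
by rewrite lte_fin => t0; exists t.
Qed.

Lemma meeting_time_lty i j n w : i != j -> (meeting_time M i j n w < +oo)%E <->
  exists m : nat, (n < M i j m%:R w)%N.
Proof.
move=> ij; split=> [/meeting_time_real-/(_ ij)[t t0 tE]|[m nm]].
  exists (Num.truncn t).+1; apply/(meeting_time_le n w ij); first by [].
  by rewrite tE lee_fin; have /andP[_ /ltW] := truncn_itv (ltW t0).
by apply: (le_lt_trans _ (ltry m%:R)); apply/meeting_time_le.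
Qed.

Definition incr_is (m : I -> I -> nat) (s t : R) : set T :=
  [set w | forall i j, i != j -> (M i j t w - M i j s w)%N = m i j].

Definition none : R -> R -> set T := incr_is (fun _ _ => 0%N).

Definition single (a b : I) : R -> R -> set T :=
  incr_is (fun i j => (i == a) && (j == b) : nat).

(** Taken as a complement, so that its probability follows from the two exact ones by
    subtraction. *)
Definition several (s t : R) : set T :=
  ~` (none s t `|` [set w | exists p : I * I, p.1 != p.2 /\ single p.1 p.2 s t w]).

Lemma incr_probE (m : nat) i j (s t : R) : i != j -> 0 <= s -> s <= t ->
  P [set w | (M i j t w - M i j s w)%N = m] =
  poisson_prob (nu i j * (t - s)) 0%N [set m].
Proof. by move=> ij s0 st; rewrite -(clocks_poisson clocks [set m] ij s0 st). Qed.

Lemma sum_rates_offdiag : \sum_(p : I * I | p.1 != p.2) nu p.1 p.2 = N.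
Proof.
rewrite -(sum_rates rates) pair_big/= [RHS](bigID (fun p => p.1 != p.2))/=.
rewrite [X in _ + X]big1 ?addr0// => p; rewrite negbK => /eqP ->.
exact: (rate_diag rates).
Qed.

Lemma none_indep (s t : R) A : 0 <= s -> s <= t -> F s A ->
  P (A `&` none s t) = (P A * (expR (- (N * (t - s))))%:E)%E.
Proof.
move=> s0 st FA; rewrite (clocks_independent clocks _ s0 st FA); congr (_ * _)%E.
rewrite (eq_bigr (fun p => (expR (- (nu p.1 p.2 * (t - s))))%:E)); last first.
  move=> p pp; rewrite incr_probE// poisson_prob_0// mulr_ge0 ?subr_ge0//.
  exact: (rate_ge0 rates).
by rewrite prodEFin -expR_sum sumrN -mulr_suml sum_rates_offdiag.
Qed.

Lemma single_indep a b (s t : R) A : a != b -> 0 <= s -> s <= t -> F s A ->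
  P (A `&` single a b s t)
  = (P A * (nu a b * (t - s) * expR (- (N * (t - s))))%:E)%E.
Proof.
move=> ab s0 st FA; rewrite (clocks_independent clocks _ s0 st FA); congr (_ * _)%E.
have r0 p : 0 <= nu p.1 p.2 * (t - s).
  by rewrite mulr_ge0 ?subr_ge0//; exact: (rate_ge0 rates).
rewrite (bigD1 (a, b))//= incr_probE// !eqxx/= poisson_prob_1//; last exact: (r0 (a, b)).
rewrite (eq_bigr (fun p => (expR (- (nu p.1 p.2 * (t - s))))%:E)); last first.
  move=> [i j] /andP[/= ij nab].
  have -> : (i == a) && (j == b) = false.
    by apply/negbTE; move: nab; rewrite xpair_eqE.
  by rewrite incr_probE// poisson_prob_0//; exact: (r0 (i, j)).
rewrite prodEFin -EFinM -expR_sum -[X in X%:E = _]mulrA -expRD sumrN -opprD.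
by rewrite -sum_rates_offdiag [in RHS]mulr_suml [in RHS](bigD1 (a, b)).
Qed.

Let sF t : 0 <= t -> sigma_algebra setT (F t).
Proof. exact: (filtration_sigma_algebra filt). Qed.

Lemma count_adapted i j t (U : set nat) : i != j -> 0 <= t ->
  F t [set w | U (M i j t w)].
Proof.
move=> ij t0; have -> : [set w | U (M i j t w)]
    = [set w | exists n, (U n -> M i j t w = n) /\ U n].
  apply/seteqP; split=> w /=; first by exists (M i j t w).
  by move=> [n [h Un]]; rewrite h.
apply: (sigma_exists (sF t0)) => n; have [Un|nU] := pselect (U n); last first.
  have -> : (fun w => (U n -> M i j t w = n) /\ U n) = set0.
    by apply/seteqP; split=> w //= [].
  exact: (sigma_set0 (sF t0)).
have -> : (fun w => (U n -> M i j t w = n) /\ U n) = [set w | M i j t w = n].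
  by apply/seteqP; split=> w /=; [case=> h _; exact: h|].
exact: (clocks_adapted clocks).
Qed.

Lemma incr_adapted i j s t (U : set nat) : i != j -> 0 <= s -> s <= t ->
  F t [set w | U (M i j t w - M i j s w)%N].
Proof.
move=> ij s0 st; have t0 := le_trans s0 st.
have -> : [set w | U (M i j t w - M i j s w)%N] = [set w | exists n,
    ([set w | M i j s w = n] `&` [set w | U (M i j t w - n)%N]) w].
  apply/seteqP; split=> w /=; first by exists (M i j s w).
  by move=> [n [-> ]].
apply: (sigma_exists (sF t0)) => n; apply: (sigma_setI (sF t0)).
  by apply: (filtration_nondecreasing filt s0 st); exact: (clocks_adapted clocks).
exact: (count_adapted (fun m => U (m - n)%N)).
Qed.

Lemma incr_is_adapted m s t : 0 <= s -> s <= t -> F t (incr_is m s t).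
Proof.
move=> s0 st; have sFt := sF (le_trans s0 st).
apply: (sigma_forall sFt) => i; apply: (sigma_forall sFt) => j.
by apply: (sigma_prop sFt) => ij; exact: (incr_adapted (fun n => n = m i j)).
Qed.

Lemma several_adapted s t : 0 <= s -> s <= t -> F t (several s t).
Proof.
move=> s0 st; have sFt := sF (le_trans s0 st).
apply: (sigma_setC sFt); apply: (sigma_setU sFt); first exact: incr_is_adapted.
apply: (sigma_exists sFt) => p.
have [pp|pp] := boolP (p.1 != p.2).
  rewrite (_ : (fun _ => _) = single p.1 p.2 s t); first exact: incr_is_adapted.
  by apply/seteqP; split=> w //= [].
rewrite (_ : (fun _ => _) = set0); first exact: (sigma_set0 sFt).
by apply/seteqP; split=> w //= [].
Qed.

Lemma none_single a b s t w : a != b -> none s t w -> single a b s t w -> False.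
Proof. by move=> ab /(_ a b ab) + /(_ a b ab) => ->; rewrite !eqxx. Qed.

Lemma single_inj a b a' b' s t w : a != b -> single a b s t w ->
  single a' b' s t w -> (a = a') /\ (b = b').
Proof.
by move=> ab /(_ a b ab) + /(_ a b ab) => ->; rewrite !eqxx; do 2 case: eqP.
Qed.

Lemma indic_several s t w : \1_(several s t) w =
  1 - \1_(none s t) w - \sum_(p : I * I | p.1 != p.2) \1_(single p.1 p.2 s t) w :> R.
Proof.
rewrite !indicE.
have [nn|nn] := pselect (none s t w).
  rewrite (mem_set nn) memNset; last by apply; left.
  rewrite big1 ?subr0 ?subrr// => p pp.
  by rewrite indicE memNset// => sp; exact: none_single nn sp.
rewrite (memNset nn) subr0.
have [[p [pp sp]]|ns] := pselect (exists p : I * I, p.1 != p.2 /\ single p.1 p.2 s t w).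
  rewrite memNset; last by apply; right; exists p.
  rewrite (bigD1 p)//= indicE (mem_set sp) big1 ?addr0 ?subrr// => q /andP[qq qp].
  rewrite indicE memNset// => sq; move/eqP: qp; apply.
  by have [] := single_inj pp sp sq; case: (p) (q) => [? ?] [? ?] /= -> ->.
rewrite mem_set; last by case.
by rewrite big1 ?subr0// => p pp; rewrite indicE memNset// => sp; apply: ns; exists p.
Qed.

(** With [y = N * (t - s)], the conditional probability given the past of [s] is
    [1 - expR (- y) * (1 + y)], and [expR (- y) >= 1 - y] bounds it by [y ^+ 2]. *)
Lemma several_prob s t A : 0 <= s -> s <= t -> F s A ->
  Ex P (fun w => \1_A w * \1_(several s t) w) <= (N * (t - s)) ^+ 2 * Ex P \1_A.
Proof.
move=> s0 st FA; have mA := filtration_measurable filt s0 FA.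
have t0 := le_trans s0 st; have mF := filtration_measurable filt t0.
have bA : bounded_rv (\1_A : T -> R) by exact: bounded_rv_indic.
have mn : measurable (none s t) by apply/mF/incr_is_adapted.
have ms p : measurable (single p.1 p.2 s t) by apply/mF/incr_is_adapted.
have bn : bounded_rv (\1_(none s t) : T -> R) by exact: bounded_rv_indic.
have bs (p : I * I) : bounded_rv (\1_(single p.1 p.2 s t) : T -> R) by exact: bounded_rv_indic.
have ExI B : measurable B -> (Ex P (fun w => \1_A w * \1_B w))%:E = P (A `&` B).
  move=> mB; rewrite probEFin; last exact: measurableI.
  by rewrite indicI.
have En : Ex P (fun w => \1_A w * \1_(none s t) w) = Ex P \1_A * expR (- (N * (t - s))).
  by apply: EFin_inj; rewrite ExI// (none_indep s0 st FA) (probEFin _ mA).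
have Es (p : I * I) : p.1 != p.2 -> Ex P (fun w => \1_A w * \1_(single p.1 p.2 s t) w) =
    Ex P \1_A * (nu p.1 p.2 * (t - s) * expR (- (N * (t - s)))).
  by move=> pp; apply: EFin_inj; rewrite ExI// (single_indep pp s0 st FA) (probEFin _ mA).
have -> : Ex P (fun w => \1_A w * \1_(several s t) w) =
  Ex P \1_A - Ex P (fun w => \1_A w * \1_(none s t) w)
  - \sum_(p : I * I | p.1 != p.2) Ex P (fun w => \1_A w * \1_(single p.1 p.2 s t) w).
  rewrite -Ex_sum; last by move=> p _; exact: bounded_rvM.
  rewrite -!ExB//; first last.
  - exact: bounded_rvM.
  - by apply: bounded_rv_sum => p _; exact: bounded_rvM.
  - by apply: bounded_rvB => //; exact: bounded_rvM.
  by congr Ex; apply/funext => w; rewrite indic_several !mulrBr mulr1 mulr_sumr.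
rewrite En (eq_bigr _ Es) -mulr_sumr -!mulr_suml sum_rates_offdiag.
have A0 : 0 <= Ex P (\1_A : T -> R) by exact: Ex_indic_ge0.
set y := N * (t - s); have y0 : 0 <= y by rewrite mulr_ge0 ?subr_ge0.
have := expR_ge1Dx (- y); set e := expR _ => e1.
have h : 0 <= y ^+ 2 - (1 - e * (1 + y)) by nra.
by have := mulr_ge0 A0 h; lra.
Qed.

End clocks.

(** * Analytic preliminaries on the process *)

Lemma left_limit_eq (R : realType) (f : R -> R) (c s t : R) : s < t ->
  (forall r, s <= r -> r < t -> f r = c) -> left_limit f t = c.
Proof.
move=> st fc; rewrite /left_limit; apply: cvg_lim => //; apply: cvg_near_cst.
near=> r; apply: fc; near: r; first exact: nbhs_left_ge.
exact: nbhs_left_lt.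
Unshelve. all: by end_near. Qed.

Lemma le_of_le_div (R : realType) (x y c : R) : (forall n : nat, x <= y + c / n.+1%:R) -> x <= y.
Proof.
move=> h; apply/ler_addgt0Pr => e e0.
have ce : 0 <= `|c| / e by rewrite divr_ge0 ?normr_ge0 ?ltW.
have /andP[_ tn] := truncn_itv ce.
apply: (le_trans (h (Num.truncn (`|c| / e)))); rewrite lerD2l.
rewrite ler_pdivrMr ?ltr0n// (le_trans (ler_norm _))//.
by rewrite mulrC -ler_pdivrMr// ltW.
Qed.

(* The left limit at a random time is the limit of the states at the last grid
   point before it, whence its measurability. *)
Definition grid_before (R : realType) (m : nat) (t : R) : R :=
  (`|Num.ceil (t * m.+1%:R) - 1|%N)%:R / m.+1%:R.

Section grid.
Variable R : realType.
Implicit Types t : R.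

(** The grid intervals are open on the left, so the grid point lies strictly before [t], as a left
    limit at [t] requires. *)
Lemma grid_before_eq m t (q : nat) :
  q%:R / m.+1%:R < t -> t <= q.+1%:R / m.+1%:R -> grid_before m t = q%:R / m.+1%:R.
Proof.
have m0 : 0 < m.+1%:R :> R by rewrite ltr0n.
rewrite ltr_pdivrMr// ler_pdivlMr// => qt tq; rewrite /grid_before.
have qE : q.+1%:Z - 1 = q by rewrite intS addrAC subrr add0r.
have -> : Num.ceil (t * m.+1%:R) = q.+1%:Z by apply: ceil_def; rewrite qE qt tq.
by rewrite qE.
Qed.

Lemma grid_before_exists m t : 0 < t ->
  exists q : nat, q%:R / m.+1%:R < t /\ t <= q.+1%:R / m.+1%:R.
Proof.
move=> t0; have m0 : 0 < m.+1%:R :> R by rewrite ltr0n.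
have y0 : 0 < t * m.+1%:R by rewrite mulr_gt0.
have := ceil_itv (t * m.+1%:R).
have : 0 <= Num.ceil (t * m.+1%:R) - 1 by rewrite subr_ge0 -gtz0_ge1 ceil_gt0.
case E : (Num.ceil (t * m.+1%:R) - 1) => [q|//] _ /andP[h1 h2].
exists q; rewrite ltr_pdivrMr// ler_pdivlMr//; split => //.
move: h2; rewrite -[Num.ceil _](subrK 1) E => /le_trans; apply.
by rewrite rmorphD /= -natr1.
Qed.

Lemma grid_before_itv m t : 0 < t ->
  t - m.+1%:R^-1 <= grid_before m t < t.
Proof.
move=> t0; have [q [q1 q2]] := grid_before_exists m t0.
rewrite (grid_before_eq q1 q2) q1 andbT lerBlDr.
by rewrite -[X in _ <= _ + X]mul1r -mulrDl natr1.
Qed.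

Lemma cvg_grid_before t : 0 < t -> grid_before m t @[m --> \oo] --> t.
Proof.
move=> t0; apply: (@squeeze_cvgr _ _ _ _ (fun m => t - harmonic m) (fun=> t)).
- near=> m; have /andP[h1 /ltW h2] := grid_before_itv m t0.
  by rewrite h1 h2.
- rewrite -[X in _ --> X]subr0; apply: cvgB; first exact: cvg_cst.
  exact: cvg_harmonic.
- exact: cvg_cst.
Unshelve. all: by end_near. Qed.

Definition clamp01 (y : R) : R := Num.max 0 (Num.min 1 y).

Lemma clamp01_itv y : 0 <= clamp01 y <= 1.
Proof.
by rewrite /clamp01 le_max lexx ge_max ler01 ge_min lexx.
Qed.

Lemma clamp01_id y : 0 <= y <= 1 -> clamp01 y = y.
Proof. by move=> /andP[y0 y1]; rewrite /clamp01 min_r// max_r. Qed.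

End grid.

(** * Measurable functionals of the configuration *)

Section functionals.
Variables (R : realType) (eta : R) (I : finType) (nu : I -> I -> R) (sigma : nat).
Hypotheses (heta : 0 < eta < 1).
Local Notation N := (#|I|%:R : R).
Local Notation config := (I -> 'I_sigma -> R).

(** Quantifying over all measurable spaces gives measurability with respect to the whole space and
    adaptedness to each [F s] from one proof. *)
Definition state_measurable (G : config -> R) : Prop :=
  forall dd (T' : measurableType dd) (Z : T' -> config), (forall w, valid (Z w)) ->
  (forall i k, measurable_fun setT (fun w => Z w i k)) ->
  measurable_fun setT (fun w => G (Z w)).

Lemma state_measurable_update G a b k l : a != b -> state_measurable G ->
  state_measurable (fun x => G (update eta x a b k l)).
Proof.
move=> ab mG dd T' Z vZ mZ; apply: (mG _ _ (fun w => update eta (Z w) a b k l)).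
  by move=> w; exact: valid_update.
move=> i m; rewrite /update /update1; case: (i == a); [|case: (i == b)] => //.
- by apply: measurable_funD => //; apply: measurable_funM.
- by apply: measurable_funD => //; apply: measurable_funM.
Qed.

Lemma state_measurable_total m : state_measurable (fun x => total (x^~ m)).
Proof. by move=> dd T' Z vZ mZ; apply: measurable_sum => i; exact: mZ. Qed.

Lemma state_measurable_pot : state_measurable (fun x => pot eta nu x).
Proof.
move=> dd T' Z vZ mZ; apply: measurable_funD => //.
apply: measurable_sum => m.
have mt := state_measurable_total m vZ mZ.
have mt2 : measurable_fun setT (fun w => total ((Z w)^~ m) + 2) by exact: measurable_funD.
have mln : measurable_fun setT (fun w => ln (total ((Z w)^~ m) + 2)).
  by apply: measurableT_comp => //; exact: measurable_ln.
(* The denominator is positive for valid configurations, so division becomes a composition of [expR]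
   and [ln]. *)
have -> : (fun w => pot1 (entropy_coef eta nu) (spread_coef eta nu) ((Z w)^~ m)) =
  (fun w => spread_coef eta nu * (total_sq ((Z w)^~ m) * expR (- ln (total ((Z w)^~ m) + 2)))
     - entropy_coef eta nu * xlog (total ((Z w)^~ m))).
  apply/funext => w; rewrite /pot1 expRN lnK// posrE.
  by have := total_ge0 m (vZ w); lra.
apply: measurable_funB; apply: measurable_funM => //; apply: measurable_funM => //.
- by apply: measurable_sum => i; exact: measurable_funX.
- apply: measurableT_comp; first exact: measurable_expR.
  exact: measurableT_comp.
Qed.

Lemma state_measurable_close k : state_measurable (close k).
Proof.
move=> dd T' Z vZ mZ.
have mt := state_measurable_total k vZ mZ.
have mb : measurable_fun setT (fun w => N - total ((Z w)^~ k) <= 1 / 2).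
  by apply: measurable_fun_ler => //; exact: measurable_funB.
have -> : (fun w => close k (Z w)) =
    \1_((fun w => N - total ((Z w)^~ k) <= 1 / 2) @^-1` [set true]).
  apply/funext => w; rewrite indicE /close; congr (nat_of_bool _)%:R.
  by apply/idP/idP; rewrite inE.
apply: measurable_indic; rewrite -[X in measurable X]setTI; exact: mb.
Qed.

Lemma state_measurable_psi : state_measurable (fun x => psi eta x).
Proof.
move=> dd T' Z vZ mZ; apply: measurable_funD.
  apply: measurable_sum => k; apply: measurable_funM; first exact: state_measurable_close.
  apply: measurable_funM => //; apply: measurable_funB => //.
  exact: state_measurable_total.
apply: measurable_prod => k _; apply: measurable_funB => //.
exact: state_measurable_close.
Qed.

Lemma state_measurable_deviation a b k u v : a != b ->
  state_measurable (fun x => deviation eta x a b k u v).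
Proof.
move=> ab dd T' Z vZ mZ; rewrite /deviation.
under eq_fun do rewrite total_update1//.
apply: measurable_funD => //; apply: measurable_funM => //; apply: measurable_funM => //.
apply: measurable_funB => //; apply: measurable_funD; first exact: state_measurable_total.
apply: measurable_funM => //; apply: measurable_funB; last exact: mZ.
by apply: measurable_funB.
Qed.

Lemma close_itv k (x : config) : 0 <= close k x <= 1.
Proof. by rewrite /close; case: (N - _ <= _); rewrite /= ?lexx ?ler01. Qed.

Lemma psi_itv (x : config) : valid x -> 0 <= psi eta x <= sigma%:R * (N / eta) + 1.
Proof.
move=> vx; have /andP[e0 e1] := heta.
have Y0 k : 0 <= (N - total (x^~ k)) / eta <= N / eta.
  apply/andP; split; first by apply: divr_ge0; [rewrite subr_ge0 total_le|exact: ltW].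
  by rewrite ler_pM2r ?invr_gt0// gerBl total_ge0.
have c0 k : 0 <= close k x by case/andP: (close_itv k x).
have c1 k : close k x <= 1 by case/andP: (close_itv k x).
have p0 : 0 <= \prod_k (1 - close k x).
  by apply: prodr_ge0 => k _; rewrite subr_ge0.
rewrite /psi; apply/andP; split.
  apply: addr_ge0 => //; apply: sumr_ge0 => k _.
  by apply: mulr_ge0 => //; case/andP: (Y0 k).
apply: lerD; last by apply: prodr_ile1 => k _; rewrite subr_ge0 c1 gerBl c0.
have -> : sigma%:R * (N / eta) = \sum_(k < sigma) N / eta.
  by rewrite sumr_const card_ord mulr_natl.
apply: ler_sum => k _; have /andP[y0 y1] := Y0 k.
by apply: (le_trans _ y1); rewrite ler_piMl.
Qed.

End functionals.

(** * Bounds on lower limits in the extended reals *)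

Section limn_einf_bounds.
Context (R : realType).
Implicit Types (u : (\bar R)^nat) (a : \bar R).
Local Open Scope ereal_scope.

Lemma limn_einf_ereal_sup u : limn_einf u = ereal_sup (range (einfs u)).
Proof. by rewrite limn_einf_lim; apply: cvg_lim => //; exact: cvg_einfs_sup. Qed.

Lemma limn_einf_ge u a J : (forall j, (J <= j)%N -> a <= u j) -> a <= limn_einf u.
Proof.
move=> au; rewrite limn_einf_ereal_sup; apply: (@le_trans _ _ (einfs u J)).
  by apply: le_ereal_inf_tmp => _ [j /= Jj <-]; exact: au.
by apply: ereal_sup_ubound; exists J.
Qed.

Lemma limn_einf_le u a : (forall j, u j <= a) -> limn_einf u <= a.
Proof.
move=> ua; rewrite limn_einf_ereal_sup; apply: ge_ereal_sup => _ [j _ <-].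
by apply: (le_trans _ (ua j)); apply: ereal_inf_lbound; exists j => //=.
Qed.

End limn_einf_bounds.

(** * The process over a short time interval *)

Section process.
Context (R : realType) (I : finType) (nu : I -> I -> R) (eta : R)
  (sigma : nat) (x0 : I -> 'I_sigma -> R)
  (d : measure_display) (T : measurableType d) (P : probability T R)
  (F : R -> set (set T)) (M : I -> I -> R -> T -> nat)
  (song : I -> I -> nat -> T -> 'I_sigma * 'I_sigma)
  (X : R -> I -> 'I_sigma -> T -> R).
Hypotheses (heta : 0 < eta < 1) (rates : meeting_rates nu) (vx0 : valid x0)
  (ipod : ipod_process nu eta x0 P F M song X).
Local Notation N := (#|I|%:R : R).
Let clocks : poisson_clocks nu P F M. Proof. exact: ipod_clocks ipod. Qed.
Let filt : filtration F. Proof. exact: ipod_filtration ipod. Qed.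

Let sF t : 0 <= t -> sigma_algebra setT (F t).
Proof. exact: (filtration_sigma_algebra filt). Qed.

Let Fm t : 0 <= t -> F t `<=` measurable.
Proof. exact: (filtration_measurable filt). Qed.

Let Fmono s t : 0 <= s -> s <= t -> F s `<=` F t.
Proof. exact: (filtration_nondecreasing filt). Qed.

Let M_mono i j (s t : R) w : i != j -> 0 <= s -> s <= t -> (M i j s w <= M i j t w)%N.
Proof. exact: (clocks_nondecreasing clocks). Qed.

Definition state (s : R) (w : T) : I -> 'I_sigma -> R := fun i k => X s i k w.

(** Meetings are numbered from 0, so the first one after [s] has the index [M a b s w]. *)
Definition next_song (a b : I) (s : R) (w : T) := song a b (M a b s w) w.

Definition regular (w : T) : Prop :=
  (forall i j n (t : R) k, i != j -> meeting_time M i j n w = t%:E ->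
    X t i k w = (1 - eta) * left_limit (fun s => X s i k w) t
                + eta * (k == (song i j n w).2)%:R /\
    X t j k w = (1 - eta) * left_limit (fun s => X s j k w) t
                + eta * (k == (song i j n w).1)%:R) /\
  (forall i (s t : R) k, 0 <= s -> s <= t ->
    (forall j, j != i -> M i j t w = M i j s w /\ M j i t w = M j i s w) ->
    X t i k w = X s i k w).

Lemma ae_regular : {ae P, forall w, regular w}.
Proof.
by apply: filterS2 (ipod_meeting ipod) (ipod_unchanged ipod) => w; split.
Qed.

Lemma none_between a b i j (s r t : R) w : 0 <= s -> s <= r -> r <= t -> i != j ->
  single M a b s t w -> (i == a) && (j == b) = false -> M i j r w = M i j s w.
Proof.
move=> s0 sr rt ij /(_ i j ij) + nab; rewrite nab => h.
apply/eqP; rewrite eqn_leq [X in _ && X]M_mono// andbT.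
apply: (leq_trans (M_mono w ij (le_trans s0 sr) rt)).
by rewrite -subn_eq0 h.
Qed.

Lemma state_none (s t : R) w : 0 <= s -> s <= t -> regular w -> none M s t w ->
  state t w = state s w.
Proof.
move=> s0 st [_ unch] nn; apply/funext => i; apply/funext => k.
apply: unch => // j ji; have ij : i != j by rewrite eq_sym.
by split; apply/eqP; rewrite eqn_leq [X in _ && X]M_mono// andbT -subn_eq0;
  apply/eqP; exact: nn.
Qed.

(** No clock rings between [s] and the meeting, so the state is constant there and its left limit at
    the random time [tau] is the state at the deterministic time [s]. *)
Lemma meeting_of_single a b (s t : R) w : a != b -> 0 <= s -> s <= t -> regular w ->
  single M a b s t w -> exists tau, [/\ s < tau, tau <= t,
    meeting_time M a b (M a b s w) w = tau%:E,
    (forall i k, left_limit (fun r => X r i k w) tau = X s i k w) &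
    (forall r, tau <= r -> r <= t -> M a b r w = (M a b s w).+1)].
Proof.
move=> ab s0 st [_ unch] one.
have t0 := le_trans s0 st.
set n := M a b s w.
have Mt : M a b t w = n.+1.
  have := one a b ab; rewrite !eqxx/= => h.
  by rewrite -(subnK (M_mono w ab s0 st)) h add1n.
have mt_t : (meeting_time M a b n w <= t%:E)%E.
  by apply/(meeting_time_le clocks n w ab t0); rewrite Mt.
have mt_s : (s%:E < meeting_time M a b n w)%E by apply/(meeting_time_gt clocks n w ab s0).
have [tau tau0 tauE] := meeting_time_real clocks ab (le_lt_trans mt_t (ltry t)).
have stau : s < tau by rewrite -lte_fin -tauE.
have taut : tau <= t by rewrite -lee_fin -tauE.
have Mr r : s <= r -> r < tau -> M a b r w = n.
  move=> sr rtau; apply/eqP; rewrite eqn_leq [X in _ && X]M_mono// andbT.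
  by apply/(meeting_time_gt clocks n w ab (le_trans s0 sr)); rewrite tauE lte_fin.
exists tau; split=> // [i k|r taur rt]; last first.
  have r0 := le_trans (ltW tau0) taur.
  apply/eqP; rewrite eqn_leq -{1}Mt M_mono//=.
  by apply/(meeting_time_le clocks n w ab r0); rewrite tauE lee_fin.
apply: (left_limit_eq stau) => r sr rtau.
apply: unch => // j ji; have ij : i != j by rewrite eq_sym.
have rt : r <= t by rewrite (le_trans (ltW rtau)).
split.
  have [/andP[/eqP -> /eqP ->]|nab] := boolP ((i == a) && (j == b)); first exact: Mr.
  by apply: (none_between s0 sr rt ij one); exact/negbTE.
have [/andP[/eqP -> /eqP ->]|nab] := boolP ((j == a) && (i == b)); first exact: Mr.
by apply: (none_between s0 sr rt ji one); exact/negbTE.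
Qed.

Lemma state_single a b (s t : R) w : a != b -> 0 <= s -> s <= t -> regular w ->
  single M a b s t w ->
  state t w = update eta (state s w) a b (next_song a b s w).1 (next_song a b s w).2.
Proof.
move=> ab s0 st reg one; have [meet unch] := reg.
have [tau [stau taut tauE LL Mtau]] := meeting_of_single ab s0 st reg one.
set n := M a b s w in tauE Mtau *.
have tau0 : 0 <= tau by exact: le_trans s0 (ltW stau).
have Xt i k : X t i k w = X tau i k w.
  apply: unch => // j ji; have ij : i != j by rewrite eq_sym.
  split.
    have [/andP[/eqP -> /eqP ->]|nab] := boolP ((i == a) && (j == b)).
      by rewrite !Mtau.
    rewrite (none_between (r := t) s0 st _ ij one) ?(negbTE nab)//.
    by rewrite (none_between (r := tau) s0 (ltW stau) taut ij one) ?(negbTE nab).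
  have [/andP[/eqP -> /eqP ->]|nab] := boolP ((j == a) && (i == b)).
    by rewrite !Mtau.
  rewrite (none_between (r := t) s0 st _ ji one) ?(negbTE nab)//.
  by rewrite (none_between (r := tau) s0 (ltW stau) taut ji one) ?(negbTE nab).
apply/funext => i; apply/funext => k; rewrite /state /update /update1 Xt /next_song -/n.
have [ha hb] := meet a b n tau k ab tauE.
case: eqP => [->|/eqP ia]; first by rewrite ha LL.
case: eqP => [->|/eqP ib]; first by rewrite hb LL.
rewrite -Xt; apply: unch => // j ji; have ij : i != j by rewrite eq_sym.
by split; apply: (none_between s0 st (lexx t) _ one); rewrite ?(negbTE ia) ?(negbTE ib) ?andbF.
Qed.

(** * The state consists of probability vectors almost surely *)

Definition good (s : R) : set T := [set w | valid (state s w)].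

Lemma X_adapted s i k : 0 <= s -> adapted (F s) (X s i k).
Proof.
move=> s0; apply/adaptedP; first exact: sF.
by move=> B mB; exact: (ipod_state_adapted ipod).
Qed.

Lemma adapted_preimage s (g : T -> R) (B : set R) : 0 <= s -> adapted (F s) g ->
  measurable B -> F s [set w | B (g w)].
Proof. by move=> s0 /(adaptedP (sF s0)); exact. Qed.

Lemma good_adapted s : 0 <= s -> F s (good s).
Proof.
move=> s0; apply: (sigma_forall (sF s0)) => i; apply: (sigma_setI (sF s0)).
  apply: (sigma_forall (sF s0)) => k.
  exact: (adapted_ge (sF s0) 0 (X_adapted i k s0)).
have := @adapted_preimage s (fun w => \sum_k X s i k w) [set 1] s0.
apply => //; apply: measurable_sum => k; exact: X_adapted.
Qed.

(* The set of configurations of probability vectors can only be left at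
   simultaneous meetings, here bounded by several meetings in a short interval. *)
Lemma good_step s t : 0 <= s -> s <= t ->
  Ex P \1_(~` good t) <= Ex P \1_(~` good s) + (N * (t - s)) ^+ 2.
Proof.
move=> s0 st; have t0 := le_trans s0 st.
have mg r : 0 <= r -> measurable (~` good r).
  by move=> r0; apply/measurableC/(Fm r0)/good_adapted.
have bg r : 0 <= r -> bounded_rv (\1_(~` good r) : T -> R).
  by move=> r0; exact/bounded_rv_indic/mg.
have ms : measurable (several M s t).
  by apply: (Fm t0); exact: (several_adapted filt clocks).
have bs : bounded_rv (\1_(several M s t) : T -> R) by exact: bounded_rv_indic.
apply: (le_trans (y := Ex P (fun w => \1_(~` good s) w + \1_(several M s t) w))).
  apply: le_Ex_ae; [exact: bg|apply: bounded_rvD => //; exact: bg|].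
  apply: filterS ae_regular => w reg; rewrite !indicE.
  have key : w \in ~` good t -> (w \in ~` good s) || (w \in several M s t).
    rewrite inE => ngt; apply/orP.
    have [gs|ngs] := pselect (good s w); last by left; rewrite inE.
    have [sw|nsw] := pselect (several M s t w); [by right; rewrite inE|exfalso].
    apply: ngt; move/contrapT: nsw => [nn|[[a b] /= [ab one]]].
      by rewrite /good /= (state_none s0 st reg nn).
    by rewrite /good /= (state_single ab s0 st reg one); exact: valid_update.
  move: key; case: (w \in ~` good t) => [/(_ isT)/orP[->|->]|_].
  - by rewrite lerDl.
  - by rewrite lerDr.
  - by rewrite addr_ge0.
rewrite ExD//; last exact: bg.
have := several_prob rates filt clocks s0 st (sigma_setT (sF s0)).
have -> : (fun w => \1_setT w * \1_(several M s t) w) = (\1_(several M s t) : T -> R).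
  by apply/funext => w; rewrite indicT mul1r.
by rewrite indicT Ex_cst mulr1 lerD2l.
Qed.

(** Over [n.+1] equal steps the errors of [good_step] add up to [(N * t) ^+ 2 / n.+1], which is
    arbitrarily small. *)
Lemma ae_good t : 0 <= t -> {ae P, forall w, good t w}.
Proof.
move=> t0; have mg : measurable (~` good t) by apply/measurableC/(Fm t0)/good_adapted.
suff E0 : Ex P \1_(~` good t) <= 0.
  apply/negligibleP => //; transitivity ((Ex P \1_(~` good t))%:E).
    exact: probEFin.
  by congr (_%:E); apply/eqP; rewrite eq_le E0 Ex_indic_ge0.
apply: (@le_of_le_div _ _ _ ((N * t) ^+ 2)) => n; rewrite add0r.
have n0 : 0 < n.+1%:R :> R by rewrite ltr0n.
pose h := t / n.+1%:R; have h0 : 0 <= h by rewrite divr_ge0.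
have step q : Ex P \1_(~` good (q%:R * h)) <= q%:R * (N * h) ^+ 2.
  elim: q => [|q IH].
    rewrite !mul0r (_ : ~` good 0 = set0); last first.
      apply/seteqP; split => w //=; apply; move: vx0; congr valid.
      by apply/funext => i; apply/funext => k; rewrite /state (ipod_initial ipod).
    by rewrite indic0 Ex_cst.
  have q0 : 0 <= q%:R * h by rewrite mulr_ge0.
  have qs : q%:R * h <= q.+1%:R * h by rewrite ler_wpM2r// ler_nat.
  apply: (le_trans (good_step q0 qs)).
  by rewrite -mulrBl -natrB// subSnn mul1r -natr1 mulrDl mul1r lerD2r.
have := step n.+1; rewrite /h mulrC divfK ?gt_eqF// => /le_trans; apply.
rewrite le_eqVlt; apply/orP; left; apply/eqP.
by set a := n.+1%:R in n0 *; field; rewrite gt_eqF.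
Qed.

(** * Law of the songs played at a meeting, given its strict past *)

Definition finite_meeting (a b : I) (n : nat) : set T :=
  [set w | (meeting_time M a b n w < +oo)%E].

Definition before_meeting (a b : I) (n : nat) (i : I) (k : 'I_sigma) (w : T) : R :=
  left_limit (fun t => X t i k w) (fine (meeting_time M a b n w)).

Lemma count_le_measurable a b n t : a != b -> 0 <= t ->
  F t [set w | (M a b t w <= n)%N].
Proof. by move=> ab t0; exact: (count_adapted filt clocks (fun q => (q <= n)%N)). Qed.

Lemma count_gt_measurable a b n t : a != b -> 0 <= t ->
  F t [set w | (n < M a b t w)%N].
Proof. by move=> ab t0; exact: (count_adapted filt clocks (fun q => (n < q)%N)). Qed.

Lemma finite_meeting_measurable a b n : a != b -> measurable (finite_meeting a b n).
Proof.
move=> ab; have -> : finite_meeting a b n =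
    \bigcup_m [set w | (n < M a b m%:R w)%N].
  apply/seteqP; split=> w /=; first by move/(meeting_time_lty clocks _ _ ab) => [m]; exists m.
  by move=> [m _ h]; apply/(meeting_time_lty clocks _ _ ab); exists m.
apply: bigcup_measurable => m _; apply: (@Fm m%:R) => //.
exact: count_gt_measurable.
Qed.

Lemma cvg_before_meeting a b n i k w : a != b -> finite_meeting a b n w ->
  X (grid_before m (fine (meeting_time M a b n w))) i k w @[m --> \oo]
    --> before_meeting a b n i k w.
Proof.
move=> ab /(meeting_time_real clocks ab)[t t0 tE].
rewrite /before_meeting tE /=.
have := ipod_left_limits ipod (i := i) (k := k) (w := w) t0.
move/cvg_at_leftP => /(_ (fun m => grid_before m t)); apply; split.
  by move=> m; case/andP: (grid_before_itv m t0).
exact: cvg_grid_before.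
Qed.

Lemma before_meeting_measurable a b n i k : a != b ->
  measurable_fun (finite_meeting a b n) (before_meeting a b n i k).
Proof.
move=> ab; have mD := finite_meeting_measurable n ab.
apply: (@measurable_fun_cvg _ _ _ _
  (fun m w => X (grid_before m (fine (meeting_time M a b n w))) i k w)); last first.
  by move=> w Dw; exact: cvg_before_meeting.
move=> m _ B mB.
have m0 : 0 < m.+1%:R :> R by rewrite ltr0n.
pose r (q : nat) : R := q%:R / m.+1%:R.
have r0 q : 0 <= r q by rewrite divr_ge0.
have -> : finite_meeting a b n `&`
    (fun w => X (grid_before m (fine (meeting_time M a b n w))) i k w) @^-1` B =
  \bigcup_q ([set w | (M a b (r q) w <= n)%N] `&` [set w | (n < M a b (r q.+1) w)%N]
             `&` [set w | B (X (r q) i k w)]).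
  apply/seteqP; split=> w /=.
    move=> [] /(meeting_time_real clocks ab)[t t0 tE]; rewrite tE/=.
    have [q [q1 q2]] := grid_before_exists m t0.
    rewrite (grid_before_eq q1 q2) => BX; exists q => //=.
    split=> //; split.
      by apply/(meeting_time_gt clocks _ _ ab (r0 q)); rewrite tE lte_fin.
    by apply/(meeting_time_le clocks _ _ ab (r0 _)); rewrite tE lee_fin.
  move=> [q _ [[]]] /(meeting_time_gt clocks _ _ ab (r0 q)) h1
    /(meeting_time_le clocks _ _ ab (r0 _)) h2 BX.
  have fin : finite_meeting a b n w by exact: le_lt_trans h2 (ltry _).
  split=> //; have [t t0 tE] := meeting_time_real clocks ab fin.
  move: h1 h2; rewrite tE lte_fin lee_fin => h1 h2 /=.
  by rewrite (grid_before_eq h1 h2).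
apply: bigcup_measurable => q _; apply: measurableI; first apply: measurableI.
- by apply: (Fm (r0 q)); exact: count_le_measurable.
- by apply: (Fm (r0 q.+1)); exact: count_gt_measurable.
- apply: (Fm (r0 q)); exact: (ipod_state_adapted ipod).
Qed.

Lemma ae_good_grid : {ae P, forall w, forall m q : nat, good (q%:R / m.+1%:R) w}.
Proof.
apply: ae_foralln => m; apply: ae_foralln => q.
by apply: (ae_good); rewrite divr_ge0.
Qed.

(** [ae_good] concerns fixed times. It holds simultaneously at the countably many grid points, hence
    at the grid point before the random meeting time, and the bounds pass to the limit. *)
Lemma ae_before_meeting a b n i k : a != b ->
  {ae P, forall w, finite_meeting a b n w -> 0 <= before_meeting a b n i k w <= 1}.
Proof.
move=> ab; apply: filterS ae_good_grid => w gw Dw.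
have h := @cvg_before_meeting a b n i k w ab Dw.
have gr m : 0 <= X (grid_before m (fine (meeting_time M a b n w))) i k w <= 1.
  exact: (valid_le1 i k (gw m _)).
apply/andP; split.
  by apply: (cvgr_to_ge h); near=> m; case/andP: (gr m).
by apply: (cvgr_to_le h); near=> m; case/andP: (gr m).
Unshelve. all: by end_near. Qed.

(* The clamping only acts on a null event. *)
Definition song_density (a b : I) (n : nat) (k l : 'I_sigma) : T -> R :=
  (fun w => clamp01 (before_meeting a b n a k w * before_meeting a b n b l w))
    \_ (finite_meeting a b n).

Lemma song_density_itv a b n k l w : 0 <= song_density a b n k l w <= 1.
Proof. by rewrite /song_density patchE; case: ifP => _; [exact: clamp01_itv|rewrite lexx ler01]. Qed.

Lemma song_density_bounded a b n k l : a != b ->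
  bounded_rv (song_density a b n k l).
Proof.
move=> ab; split; last first.
  exists 1 => w; have /andP[h0 h1] := song_density_itv a b n k l w.
  by rewrite ger0_norm.
apply/(measurable_restrictT _ (finite_meeting_measurable n ab)).
apply: measurable_maxr; first exact: measurable_cst.
apply: measurable_minr; first exact: measurable_cst.
by apply: measurable_funM; exact: before_meeting_measurable.
Qed.

(** This is [ipod_song_law] with the condition that the meeting comes after [s] read off from the
    count at [s], and with the bounded [song_density] in place of the product of left limits. *)
Lemma song_law_density a b n s A k l : a != b -> 0 <= s -> F s A ->
  let B := A `&` [set w | (M a b s w <= n)%N] `&` finite_meeting a b n in
  Ex P (\1_(B `&` [set w | song a b n w = (k, l)])) =
  Ex P (fun w => \1_B w * song_density a b n k l w).
Proof.
move=> ab s0 FA B.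
have mD := finite_meeting_measurable n ab.
have mB : measurable B.
  apply: measurableI => //; apply: (Fm s0); apply: (sigma_setI (sF s0)) => //.
  exact: count_le_measurable.
have bs := song_density_bounded n k l ab.
have BE : B = A `&` [set w | (s%:E < meeting_time M a b n w < +oo)%E].
  rewrite /B -setIA; congr (_ `&` _); apply/seteqP; split=> w /=.
    by move=> [/(meeting_time_gt clocks _ _ ab s0) h1 h2]; apply/andP.
  by move=> /andP[/(meeting_time_gt clocks _ _ ab s0) h1 h2].
have msong : measurable (B `&` [set w | song a b n w = (k, l)]).
  have -> : B `&` [set w | song a b n w = (k, l)] = B `&` \bigcup_m
     [set w | (meeting_time M a b n w <= m%:R%:E)%E /\ song a b n w = (k, l)].
    apply/seteqP; split=> w /=.
      move=> [Bw sw]; split=> //; have [_ /(meeting_time_lty clocks _ _ ab)[m nm]] := Bw.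
      exists m => //; split=> //; exact/(meeting_time_le clocks _ _ ab).
    by move=> [Bw [m _ [_]]].
  apply: measurableI => //; apply: bigcup_measurable => m _; apply: (@Fm m%:R) => //.
  exact: (ipod_song_adapted ipod).
have law := ipod_song_law ipod n k l ab s0 FA.
apply: EFin_inj; rewrite -(Ex_indicM _ mB bs) -probEFin// [in LHS]BE law -BE.
apply: ae_eq_integral => //.
- apply/measurable_EFinP; apply: measurable_funS mD _ _ => //; first by move=> w [].
  by apply: measurable_funM; exact: before_meeting_measurable.
- by apply/measurable_EFinP; apply: measurable_funTS; case: bs.
- apply: filterS2 (ae_before_meeting n a k ab) (ae_before_meeting n b l ab) => w h1 h2 Bw.
  have Dw : finite_meeting a b n w by case: Bw.
  congr (_%:E); rewrite /song_density patchE mem_set// clamp01_id//.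
  have /andP[p0 p1] := h1 Dw; have /andP[q0 q1] := h2 Dw.
  by rewrite mulr_ge0//= mulr_ile1.
Qed.

(* Replacing the state on the null event where it is not made of probability
   vectors keeps all functionals of it bounded. *)
Definition vstate (s : R) (w : T) : I -> 'I_sigma -> R :=
  if `[< good s w >] then state s w else x0.

Lemma vstate_valid s w : valid (vstate s w).
Proof. by rewrite /vstate; case: asboolP. Qed.

Lemma ae_vstate s : 0 <= s -> {ae P, forall w, vstate s w = state s w}.
Proof.
move=> s0; apply: filterS (ae_good s0) => w gw.
by rewrite /vstate; case: asboolP.
Qed.

Lemma vstate_adapted s i k : 0 <= s -> adapted (F s) (fun w => vstate s w i k).
Proof.
move=> s0; have Fg := good_adapted s0.
have -> : (fun w => vstate s w i k) =
    (fun w => \1_(good s) w * X s i k w + (1 - \1_(good s) w) * x0 i k).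
  apply/funext => w; rewrite /vstate indicE.
  case: asboolP => gw; [rewrite mem_set//|rewrite memNset//].
    by rewrite mul1r subrr mul0r addr0.
  by rewrite mul0r subr0 mul1r add0r.
have i1 : adapted (F s) (\1_(good s) : T -> R) by apply: adapted_indic => //; exact: sF.
apply: measurable_funD; apply: measurable_funM => //.
- exact: (X_adapted).
- by apply: measurable_funB.
Qed.

(** * Probability that the only meeting in an interval has given songs *)

Definition pick (a b : I) (s t : R) (k l : 'I_sigma) : set T :=
  single M a b s t `&` [set w | next_song a b s w = (k, l)].

Lemma single_count a b s t w : a != b -> 0 <= s -> s <= t -> single M a b s t w ->
  M a b t w = (M a b s w).+1.
Proof.
move=> ab s0 st /(_ a b ab); rewrite !eqxx/= => h.
by rewrite -(subnK (clocks_nondecreasing clocks w ab s0 st)) h add1n.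
Qed.

Lemma pick_adapted a b s t k l : a != b -> 0 <= s -> s <= t -> F t (pick a b s t k l).
Proof.
move=> ab s0 st; have t0 := le_trans s0 st.
have -> : pick a b s t k l = [set w | exists n, ([set w | M a b s w = n] `&`
    single M a b s t `&`
    [set w | (meeting_time M a b n w <= t%:E)%E /\ song a b n w = (k, l)]) w].
  apply/seteqP; split=> w /=.
    move=> [one sw]; exists (M a b s w); split=> //; split=> //.
    by apply/(meeting_time_le clocks _ _ ab t0); rewrite (single_count ab s0 st one).
  by move=> [n [[<- one] [_ sw]]].
apply: (sigma_exists (sF t0)) => n; apply: (sigma_setI (sF t0)).
  apply: (sigma_setI (sF t0)); last exact: (incr_is_adapted filt clocks).
  exact/(Fmono s0 st)/(clocks_adapted clocks).
exact: (ipod_song_adapted ipod).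
Qed.

Let density (a b : I) (k l : 'I_sigma) (s : R) (w : T) : R :=
  vstate s w a k * vstate s w b l.

Lemma density_itv a b k l s w : 0 <= density a b k l s w <= 1.
Proof.
have /andP[p0 p1] := valid_le1 a k (vstate_valid s w).
have /andP[q0 q1] := valid_le1 b l (vstate_valid s w).
by rewrite /density mulr_ge0//= mulr_ile1.
Qed.

Lemma vstate_bounded s i k : 0 <= s -> bounded_rv (fun w => vstate s w i k).
Proof.
move=> s0; split; last first.
  exists 1 => w; have /andP[p0 p1] := valid_le1 i k (vstate_valid s w).
  by rewrite ger0_norm.
apply: (adapted_measurable (sF s0) (Fm s0)); exact: vstate_adapted.
Qed.

Lemma density_bounded a b k l s : 0 <= s -> bounded_rv (density a b k l s).
Proof. by move=> s0; apply: bounded_rvM; exact: vstate_bounded. Qed.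

Lemma indic_ge0 (A : set T) w : 0 <= (\1_A w : R).
Proof. by rewrite indicE. Qed.

#[local] Hint Resolve indic_ge0 : core.

Lemma pick_bound_ge0 a b k l s t w :
  0 <= \1_(single M a b s t) w * density a b k l s w + \1_(several M s t) w.
Proof.
have /andP[d0 _] := density_itv a b k l s w.
by apply: addr_ge0 => //; exact: mulr_ge0.
Qed.

(** The law of the songs is available for meetings after a fixed time; subtracting its instance at
    [t] from the one at [s] gives it for the meeting number [n] lying in ]s, t], the event [B']. On
    [B'], either this is the only meeting in the interval and the density is that of the state at
    [s], or there are several meetings and the density is at most 1. *)
Lemma pick_le_count a b s t n A k l : a != b -> 0 <= s -> s <= t -> F s A ->
  Ex P (fun w => \1_(A `&` [set w | M a b s w = n]) w * \1_(pick a b s t k l) w)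
  <= Ex P (fun w => \1_(A `&` [set w | M a b s w = n]) w *
      (\1_(single M a b s t) w * density a b k l s w + \1_(several M s t) w)).
Proof.
move=> ab s0 st FA; have t0 := le_trans s0 st.
set An := A `&` _.
have FAn : F s An by apply: (sigma_setI (sF s0)) => //; exact: (clocks_adapted clocks).
pose S := [set w | song a b n w = (k, l)].
pose h := song_density a b n k l.
pose Bs := An `&` [set w | (M a b s w <= n)%N] `&` finite_meeting a b n.
pose Bt := An `&` [set w | (M a b t w <= n)%N] `&` finite_meeting a b n.
pose B' := An `&` [set w | (n < M a b t w)%N].
have mAn : measurable An by exact: Fm FAn.
have mfin : measurable (finite_meeting a b n) by exact: (finite_meeting_measurable).
have mBs : measurable Bs.
  by do 2 apply: measurableI => //; exact: (Fm s0 (count_le_measurable n ab s0)).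
have mBt : measurable Bt.
  by do 2 apply: measurableI => //; exact: (Fm t0 (count_le_measurable n ab t0)).
have mB' : measurable B'.
  by apply: measurableI => //; exact: (Fm t0 (count_gt_measurable n ab t0)).
have bh : bounded_rv h by exact: (song_density_bounded).
have splitB w : \1_Bs w = \1_B' w + \1_Bt w :> R.
  rewrite !indicE; have [Aw|nAw] := pselect (An w); last first.
    by rewrite !memNset ?addr0// => -[]// => -[].
  have ns : M a b s w = n by case: Aw.
  have [nt|tn] := ltnP n (M a b t w).
    rewrite [w \in Bt]memNset ?addr0; last by move=> [[_ /=]]; rewrite leqNgt nt.
    rewrite !mem_set//; split; [split=> //=; by rewrite ns|].
    exact: le_lt_trans ((meeting_time_le clocks n w ab t0).2 nt) (ltry _).
  rewrite [w \in B']memNset ?add0r; last by move=> [_ /=]; rewrite ltnNge tn.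
  congr (nat_of_bool _)%:R; apply/idP/idP; rewrite !inE => -[[_ _] fin]; split=> //.
  by split=> //=; rewrite ns.
have lawS := song_law_density n k l ab s0 FAn.
have lawT := song_law_density n k l ab t0 (Fmono s0 st FAn).
rewrite -/Bs -/h -/S in lawS; rewrite -/Bt -/h -/S in lawT.
have mS C : measurable C -> C `<=` finite_meeting a b n -> measurable (C `&` S).
  move=> mC Cf; have -> : C `&` S = C `&` \bigcup_m
     [set w | (meeting_time M a b n w <= m%:R%:E)%E /\ song a b n w = (k, l)].
    apply/seteqP; split=> w /=.
      move=> [Cw sw]; split=> //; have /(meeting_time_lty clocks _ _ ab)[m nm] := Cf _ Cw.
      exists m => //; split=> //; exact/(meeting_time_le clocks _ _ ab).
    by move=> [Cw [m _ [_]]].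
  apply: measurableI => //; apply: bigcup_measurable => m _; apply: (@Fm m%:R) => //.
  exact: (ipod_song_adapted ipod).
have B'f : B' `<=` finite_meeting a b n.
  move=> w [_ /= nt].
  exact: le_lt_trans ((meeting_time_le clocks n w ab t0).2 nt) (ltry _).
have mB'S := mS _ mB' B'f.
have mBtS : measurable (Bt `&` S) by apply: mS => // w [].
have bi C : measurable C -> bounded_rv (\1_C : T -> R) by exact: bounded_rv_indic.
have law' : Ex P \1_(B' `&` S) = Ex P (fun w => \1_B' w * h w).
  have E1 : Ex P \1_(Bs `&` S) = Ex P \1_(B' `&` S) + Ex P \1_(Bt `&` S).
    rewrite -ExD; [|exact: bi|exact: bi].
    have e C w : \1_(C `&` S) w = \1_C w * \1_S w :> R by rewrite indicI.
    by congr Ex; apply/funext => w; rewrite !e splitB mulrDl.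
  have E2 : Ex P (fun w => \1_Bs w * h w) =
      Ex P (fun w => \1_B' w * h w) + Ex P (fun w => \1_Bt w * h w).
    rewrite -ExD; [|by apply: bounded_rvM => //; exact: bi..].
    by congr Ex; apply/funext => w; rewrite splitB mulrDl.
  by move: E1; rewrite lawS lawT E2 => /addIr.
have msg : measurable (single M a b s t).
  exact: (Fm t0 (incr_is_adapted filt clocks _ s0 st)).
have msv : measurable (several M s t).
  exact: (Fm t0 (several_adapted filt clocks s0 st)).
have mpk : measurable (pick a b s t k l) by exact: (Fm t0 (pick_adapted _ _ ab s0 st)).
apply: (le_trans (y := Ex P \1_(B' `&` S))).
  apply: le_Ex => [||w]; [by apply: bounded_rvM; exact: bi|exact: bi|].
  rewrite indicE; have [|_] := boolP (w \in An); last by rewrite mul0r.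
  rewrite inE => Aw; rewrite mul1r indicE.
  have [|_] := boolP (w \in pick a b s t k l) => //.
  rewrite inE => -[one sw].
  have ns : M a b s w = n by case: Aw.
  rewrite indicE mem_set//; split; last by rewrite /S /= -ns.
  by split=> //=; rewrite (single_count ab s0 st one) ns.
rewrite law'; apply: le_Ex_ae => [||]; first by apply: bounded_rvM => //; exact: bi.
  apply: bounded_rvM; first exact: bi.
  apply: bounded_rvD; last exact: bi.
  by apply: bounded_rvM; [exact: bi|exact: density_bounded].
apply: filterS2 (ae_regular) (ae_vstate s0) => w reg vs.
have V0 := pick_bound_ge0 a b k l s t w.
have [B'w|nB'] := pselect (B' w); last first.
  by rewrite [X in X * _]indicE memNset// mul0r mulr_ge0.
have [Aw nt] := B'w; have ns : M a b s w = n by case: Aw.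
rewrite [X in X * _ <= _]indicE [X in _ <= X * _]indicE !mem_set// !mul1r.
have [one|none1] := pselect (single M a b s t w).
  apply: ler_wpDr => //; rewrite indicE mem_set// mul1r.
  have [tau [_ _ tauE LL _]] := meeting_of_single ab s0 st reg one.
  rewrite ns in tauE.
  rewrite /h /song_density patchE mem_set; last exact: B'f.
  rewrite /before_meeting tauE /= !LL.
  rewrite /density vs /state clamp01_id//.
  by have := density_itv a b k l s w; rewrite /density vs.
rewrite [\1_(several M s t) w]indicE mem_set.
  apply: ler_wpDl; first by have /andP[d0 _] := density_itv a b k l s w; rewrite mulr_ge0.
  by have /andP[] := song_density_itv a b n k l w.
case=> [nn|[[a' b'] /= [ab' one']]].
  by move: nt; rewrite /= -ns ltnNge -subn_eq0 (nn a b ab).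
have := one' a b ab; case: eqP => [aa|_]; case: eqP => [bb|_] /= h0;
  try by move: nt; rewrite /= -ns ltnNge -subn_eq0 h0.
by apply: none1; rewrite aa bb.
Qed.

(** Sum [pick_le_count] over the possible values [n] of the count at [s]. *)
Lemma pick_le a b s t A k l : a != b -> 0 <= s -> s <= t -> F s A ->
  Ex P (fun w => \1_A w * \1_(pick a b s t k l) w)
  <= Ex P (fun w => \1_A w *
      (\1_(single M a b s t) w * density a b k l s w + \1_(several M s t) w)).
Proof.
move=> ab s0 st FA; have t0 := le_trans s0 st.
have mA : measurable A by exact: Fm FA.
pose An n := A `&` [set w | M a b s w = n].
have mAn n : measurable (An n).
  by apply: measurableI => //; exact: (Fm s0 (clocks_adapted clocks _ ab s0)).
have AE : A = \bigcup_n An n.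
  by apply/seteqP; split=> [w Aw|w [n _ []]//]; exists (M a b s w).
have tAn : trivIset setT An.
  by move=> n m _ _ [w [[_ <-] [_ <-]]].
have bi C : measurable C -> bounded_rv (\1_C : T -> R) by exact: bounded_rv_indic.
have b1 : bounded_rv (\1_(pick a b s t k l) : T -> R).
  exact: (bi _ (Fm t0 (pick_adapted _ _ ab s0 st))).
have b2 : bounded_rv (fun w =>
    \1_(single M a b s t) w * density a b k l s w + \1_(several M s t) w).
  apply: bounded_rvD.
    apply: bounded_rvM; last exact: density_bounded.
    exact: (bi _ (Fm t0 (incr_is_adapted filt clocks _ s0 st))).
  exact: (bi _ (Fm t0 (several_adapted filt clocks s0 st))).
have IA f : bounded_rv f -> (forall w, 0 <= f w) ->
    (\int[P]_(w in A) (f w)%:E = \sum_(n <oo) \int[P]_(w in An n) (f w)%:E)%E.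
  move=> [mf _] f0; rewrite AE; apply: ge0_integral_bigcup => //.
    by apply/measurable_EFinP; exact: measurable_funTS.
  by move=> w _; rewrite lee_fin.
rewrite -lee_fin -!Ex_indicM// !IA//; last by move=> w; exact: pick_bound_ge0.
apply: lee_nneseries => [n _ _|n _]; first by apply: integral_ge0 => w _; rewrite lee_fin.
by rewrite !Ex_indicM// lee_fin; exact: pick_le_count.
Qed.

(** * Probabilities of no, one and several meetings under an adapted weight *)

Section weights.
Variables (s t : R) (g : T -> R) (K : R).
Hypotheses (s0 : 0 <= s) (st : s <= t) (ag : adapted (F s) g)
  (gK : forall w, 0 <= g w <= K).
Let t0 : 0 <= t. Proof. exact: le_trans s0 st. Qed.
Let g0 w : 0 <= g w. Proof. by case/andP: (gK w). Qed.

Lemma weight_bounded : bounded_rv g.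
Proof.
split; first exact: (adapted_measurable (sF s0) (Fm s0)).
by exists K => w; rewrite ger0_norm//; case/andP: (gK w).
Qed.

Let Gg a : F s [set w | a <= g w]. Proof. exact: (adapted_ge (sF s0)). Qed.

Lemma none_weight :
  Ex P (fun w => g w * \1_(none M s t) w) <= expR (- (N * (t - s))) * Ex P g.
Proof.
have mn := Fm t0 (incr_is_adapted filt clocks (fun _ _ => 0%N) s0 st).
have -> : expR (- (N * (t - s))) * Ex P g = Ex P (fun w => g w * expR (- (N * (t - s)))).
  by rewrite ExZr 1?mulrC//; exact: weight_bounded.
apply: (le_Ex_weight (Fm s0)) => //.
- exact: weight_bounded.
- exact: bounded_rv_indic.
- exact: bounded_rv_cst.
move=> A FA; have mA := Fm s0 FA; rewrite -lee_fin.
have -> : Ex P (fun w => \1_A w * expR (- (N * (t - s)))) = Ex P \1_A * expR (- (N * (t - s))).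
  by rewrite ExZr//; exact: bounded_rv_indic.
have -> : (fun w => \1_A w * \1_(none M s t) w) = \1_(A `&` none M s t) :> (T -> R).
  by rewrite indicI.
rewrite -probEFin; last exact: measurableI.
by rewrite (none_indep rates clocks s0 st FA) (probEFin P mA).
Qed.

Lemma single_weight a b : a != b ->
  Ex P (fun w => g w * \1_(single M a b s t) w) <= nu a b * (t - s) * Ex P g.
Proof.
move=> ab; have mn : measurable (single M a b s t).
  exact: (Fm t0 (incr_is_adapted filt clocks _ s0 st)).
have r0 : 0 <= nu a b * (t - s) by rewrite mulr_ge0 ?subr_ge0//; exact: (rate_ge0 rates).
have -> : nu a b * (t - s) * Ex P g = Ex P (fun w => g w * (nu a b * (t - s))).
  by rewrite ExZr 1?mulrC//; exact: weight_bounded.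
apply: (le_Ex_weight (Fm s0)) => //.
- exact: weight_bounded.
- exact: bounded_rv_indic.
- exact: bounded_rv_cst.
move=> A FA; have mA := Fm s0 FA.
have -> : Ex P (fun w => \1_A w * (nu a b * (t - s))) = Ex P \1_A * (nu a b * (t - s)).
  by rewrite ExZr//; exact: bounded_rv_indic.
apply: (le_trans (y := Ex P \1_A * (nu a b * (t - s) * expR (- (N * (t - s)))))).
  rewrite -lee_fin.
  have -> : (fun w => \1_A w * \1_(single M a b s t) w) = \1_(A `&` single M a b s t) :> (T -> R).
    by rewrite indicI.
  rewrite -probEFin; last exact: measurableI.
  by rewrite (single_indep rates clocks ab s0 st FA) (probEFin P mA).
rewrite ler_wpM2l ?Ex_indic_ge0// ler_piMr// -expR0 ler_expR oppr_le0.
by rewrite mulr_ge0 ?subr_ge0.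
Qed.

Lemma several_weight :
  Ex P (fun w => g w * \1_(several M s t) w) <= (N * (t - s)) ^+ 2 * Ex P g.
Proof.
have mn := Fm t0 (several_adapted filt clocks s0 st).
have -> : (N * (t - s)) ^+ 2 * Ex P g = Ex P (fun w => g w * (N * (t - s)) ^+ 2).
  by rewrite ExZr 1?mulrC//; exact: weight_bounded.
apply: (le_Ex_weight (Fm s0)) => //.
- exact: weight_bounded.
- exact: bounded_rv_indic.
- exact: bounded_rv_cst.
- by move=> w; exact: sqr_ge0.
move=> A FA; have mA := Fm s0 FA.
have -> : Ex P (fun w => \1_A w * (N * (t - s)) ^+ 2) = (N * (t - s)) ^+ 2 * Ex P \1_A.
  by rewrite ExZr 1?mulrC//; exact: bounded_rv_indic.
exact: (several_prob rates filt clocks).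
Qed.

End weights.

(** The product of [g] with the probability of the two songs is itself adapted to [F s], so
    [single_weight] applies to it as the weight. *)
Lemma pick_weight s t g K a b k l : 0 <= s -> s <= t -> adapted (F s) g ->
  (forall w, 0 <= g w <= K) -> a != b ->
  Ex P (fun w => g w * \1_(pick a b s t k l) w)
  <= nu a b * (t - s) * Ex P (fun w => g w * (vstate s w a k * vstate s w b l))
     + (N * (t - s)) ^+ 2 * K.
Proof.
move=> s0 st ag gK ab; have t0 := le_trans s0 st.
have bi C : measurable C -> bounded_rv (\1_C : T -> R) by exact: bounded_rv_indic.
have bg := weight_bounded s0 ag gK.
have g0 w : 0 <= g w by case/andP: (gK w).
have b1 : bounded_rv (\1_(pick a b s t k l) : T -> R).
  exact: (bi _ (Fm t0 (pick_adapted _ _ ab s0 st))).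
have bsg : bounded_rv (\1_(single M a b s t) : T -> R).
  exact: (bi _ (Fm t0 (incr_is_adapted filt clocks _ s0 st))).
have bsv : bounded_rv (\1_(several M s t) : T -> R).
  exact: (bi _ (Fm t0 (several_adapted filt clocks s0 st))).
have bd := density_bounded a b k l s0.
have b2 : bounded_rv (fun w =>
    \1_(single M a b s t) w * density a b k l s w + \1_(several M s t) w).
  by apply: bounded_rvD => //; exact: bounded_rvM.
apply: (le_trans (y := Ex P (fun w => g w *
    (\1_(single M a b s t) w * density a b k l s w + \1_(several M s t) w)))).
  apply: (le_Ex_weight (Fm s0)) => //.
  - by move=> c; exact: (adapted_ge (sF s0)).
  - by move=> w; exact: pick_bound_ge0.
  - by move=> A FA; exact: pick_le.
have -> : (fun w => g w *
    (\1_(single M a b s t) w * density a b k l s w + \1_(several M s t) w)) =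
  (fun w => (g w * density a b k l s w) * \1_(single M a b s t) w +
     g w * \1_(several M s t) w).
  by apply/funext => w; ring.
have bgd : bounded_rv (fun w => g w * density a b k l s w) by exact: bounded_rvM.
rewrite ExD; [|exact: bounded_rvM|exact: bounded_rvM].
apply: lerD.
  apply: (@single_weight s t (fun w => g w * density a b k l s w) K) => //.
    apply: measurable_funM => //; apply: measurable_funM; exact: vstate_adapted.
  move=> w; have /andP[d0 d1] := density_itv a b k l s w; have /andP[g1 g2] := gK w.
  by rewrite mulr_ge0//= (le_trans _ g2)// ler_piMr.
apply: (le_trans (several_weight s0 st ag gK)).
rewrite ler_wpM2l ?sqr_ge0// -[leRHS](Ex_cst P); apply: le_Ex => //.
  exact: bounded_rv_cst.
by move=> w; case/andP: (gK w).
Qed.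

(* [h0] bounds [Z] if there is no meeting, and [h a b k l] if [a] and [b] have the
   only meeting and play the songs [k] and [l]; several meetings cost O((t - s)^2). *)
Lemma one_step (s t K : R) (Z h0 : T -> R) (h : I -> I -> 'I_sigma -> 'I_sigma -> T -> R) :
  0 <= s -> s <= t ->
  bounded_rv Z -> (forall w, 0 <= Z w <= K) ->
  adapted (F s) h0 -> (forall w, 0 <= h0 w <= K) ->
  (forall a b k l, a != b -> adapted (F s) (h a b k l)) ->
  (forall a b k l w, a != b -> 0 <= h a b k l w <= K) ->
  {ae P, forall w, none M s t w -> Z w <= h0 w} ->
  {ae P, forall w a b, a != b -> single M a b s t w ->
    Z w <= h a b (next_song a b s w).1 (next_song a b s w).2 w} ->
  Ex P Z <= Ex P h0 + (t - s) * Ex P (fun w =>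
    \sum_(p : I * I | p.1 != p.2) nu p.1 p.2 * \sum_k \sum_l
      vstate s w p.1 k * vstate s w p.2 l * (h p.1 p.2 k l w - h0 w))
  + (N ^+ 2 * sigma%:R ^+ 2 + 2) * N ^+ 2 * K * (t - s) ^+ 2.
Proof.
move=> s0 st bZ ZK ah0 h0K ah hK Znone Zone; have t0 := le_trans s0 st.
have bi C : measurable C -> bounded_rv (\1_C : T -> R) by exact: bounded_rv_indic.
have bnn : bounded_rv (\1_(none M s t) : T -> R).
  exact: (bi _ (Fm t0 (incr_is_adapted filt clocks _ s0 st))).
have bsv : bounded_rv (\1_(several M s t) : T -> R).
  exact: (bi _ (Fm t0 (several_adapted filt clocks s0 st))).
have bp (a b : I) k l : a != b -> bounded_rv (\1_(pick a b s t k l) : T -> R).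
  by move=> ab; exact: (bi _ (Fm t0 (pick_adapted _ _ ab s0 st))).
have bh0 := weight_bounded s0 ah0 h0K.
have bh (a b : I) k l (ab : a != b) : bounded_rv (h a b k l).
  by apply: (weight_bounded s0 (ah a b k l ab)) => w; exact: hK.
have K0 : 0 <= K.
  by have /andP[h1 h2] := ZK point; exact: le_trans h1 h2.
pose W w := h0 w * \1_(none M s t) w
  + \sum_(p : I * I | p.1 != p.2) \sum_k \sum_l h p.1 p.2 k l w * \1_(pick p.1 p.2 s t k l) w
  + K * \1_(several M s t) w.
have bsum : bounded_rv (fun w => \sum_(p : I * I | p.1 != p.2) \sum_k \sum_l
    h p.1 p.2 k l w * \1_(pick p.1 p.2 s t k l) w).
  apply: bounded_rv_sum => p pp; do 2 apply: bounded_rv_sum => ? _.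
  by apply: bounded_rvM; [exact: bh|exact: bp].
have bW : bounded_rv W.
  apply: bounded_rvD; last exact: bounded_rvZ.
  by apply: bounded_rvD => //; exact: bounded_rvM.
have ZW : Ex P Z <= Ex P W.
  apply: le_Ex_ae => //; apply: filterS2 Znone Zone => w Zn Zo.
  have t1 : 0 <= h0 w * \1_(none M s t) w by rewrite mulr_ge0//; case/andP: (h0K w).
  have t3 : 0 <= K * \1_(several M s t) w by rewrite mulr_ge0.
  have t2l p k l : p.1 != p.2 -> 0 <= h p.1 p.2 k l w * \1_(pick p.1 p.2 s t k l) w.
    by move=> pp; rewrite mulr_ge0//; case/andP: (hK p.1 p.2 k l w pp).
  have t2 p : p.1 != p.2 -> 0 <= \sum_k \sum_l h p.1 p.2 k l w * \1_(pick p.1 p.2 s t k l) w.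
    by move=> pp; do 2 apply: sumr_ge0 => ? _; exact: t2l.
  have t2' : 0 <= \sum_(p : I * I | p.1 != p.2) \sum_k \sum_l
      h p.1 p.2 k l w * \1_(pick p.1 p.2 s t k l) w by exact: sumr_ge0.
  rewrite /W; have [nn|nn] := pselect (none M s t w).
    rewrite -addrA; apply: ler_wpDr; first exact: addr_ge0.
    by rewrite indicE mem_set// mulr1; exact: Zn.
  have [[[a b] /= [ab one]]|ns] := pselect (exists p : I * I, p.1 != p.2 /\ single M p.1 p.2 s t w).
    apply: ler_wpDr => //; apply: ler_wpDl => //.
    rewrite (bigD1 (a, b))//=; apply: ler_wpDr; first by apply: sumr_ge0 => p /andP[pp _]; exact: t2.
    set kl := next_song a b s w.
    rewrite (bigD1 kl.1)//=; apply: ler_wpDr.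
      by do 2 apply: sumr_ge0 => ? _; exact: (t2l (a, b)).
    rewrite (bigD1 kl.2)//=; apply: ler_wpDr.
      by apply: sumr_ge0 => ? _; exact: (t2l (a, b)).
    rewrite indicE mem_set ?mulr1; first exact: Zo.
    by split=> //=; rewrite -/kl -surjective_pairing.
  apply: ler_wpDl; first exact: addr_ge0.
  rewrite indicE mem_set ?mulr1; first by case/andP: (ZK w).
  by case.
apply: (le_trans ZW).
rewrite /W ExD; [|by apply: bounded_rvD => //; exact: bounded_rvM|exact: bounded_rvZ].
rewrite ExD; [|exact: bounded_rvM|exact: bsum].
rewrite ExZ// Ex_sum; last first.
  move=> p pp; do 2 apply: bounded_rv_sum => ? _.
  by apply: bounded_rvM; [exact: bh|exact: bp].
set dl := t - s; have dl0 : 0 <= dl by rewrite subr_ge0.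
have e1 := none_weight s0 st ah0 h0K.
have Eh0 : 0 <= Ex P h0 by apply: Ex_ge0 => w; case/andP: (h0K w).
have Eh0K : Ex P h0 <= K.
  rewrite -[leRHS](Ex_cst P); apply: le_Ex => //; first exact: bounded_rv_cst.
  by move=> w; case/andP: (h0K w).
have e2 : K * Ex P \1_(several M s t) <= (N * dl) ^+ 2 * K.
  rewrite mulrC ler_wpM2r//.
  have := several_prob rates filt clocks s0 st (sigma_setT (sF s0)).
  have -> : (fun w => \1_setT w * \1_(several M s t) w) = (\1_(several M s t) : T -> R).
    by apply/funext => w; rewrite indicT mul1r.
  by rewrite indicT Ex_cst mulr1.
pose D (p : I * I) k l := Ex P (fun w => h p.1 p.2 k l w * (vstate s w p.1 k * vstate s w p.2 l)).
have e3 : \sum_(p : I * I | p.1 != p.2) Ex P (fun w => \sum_k \sum_l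
      h p.1 p.2 k l w * \1_(pick p.1 p.2 s t k l) w)
   <= dl * (\sum_(p : I * I | p.1 != p.2) nu p.1 p.2 * \sum_k \sum_l D p k l)
      + N ^+ 2 * sigma%:R ^+ 2 * ((N * dl) ^+ 2 * K).
  apply: (le_trans (y := \sum_(p : I * I | p.1 != p.2)
      (dl * (nu p.1 p.2 * \sum_k \sum_l D p k l) + sigma%:R ^+ 2 * ((N * dl) ^+ 2 * K)))).
    apply: ler_sum => p pp; rewrite Ex_sum; last first.
      by move=> k _; apply: bounded_rv_sum => l _; apply: bounded_rvM; [exact: bh|exact: bp].
    apply: (le_trans (y := \sum_(k < sigma) \sum_(l < sigma)
       (nu p.1 p.2 * dl * D p k l + (N * dl) ^+ 2 * K))).
      apply: ler_sum => k _; rewrite Ex_sum; last first.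
        by move=> l _; apply: bounded_rvM; [exact: bh|exact: bp].
      apply: ler_sum => l _; apply: (pick_weight k l s0 st (ah _ _ _ _ pp)) => // w.
      exact: hK.
    rewrite le_eqVlt; apply/orP; left; apply/eqP.
    under eq_bigr => k _ do rewrite big_split/= sumr_const card_ord -mulr_sumr.
    rewrite big_split/= sumr_const card_ord -mulr_sumr -[_ *+ sigma]mulr_natl -[_ *+ sigma]mulr_natl.
    by ring.
  rewrite big_split/= -mulr_sumr lerD2l sumr_const.
  rewrite -[_ *+ _]mulr_natl -mulrA ler_wpM2r ?mulr_ge0 ?sqr_ge0 ?exprn_ge0//.
  rewrite -natrX ler_nat (leq_trans (max_card _))//.
  by rewrite card_prod mulnn.
have bvs i k : bounded_rv (fun w => vstate s w i k) by exact: vstate_bounded.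
(* Song probabilities sum to 1 and rates to [N], so subtracting [h0] costs exactly [N * Ex P h0],
   the first order loss in the probability of no meeting. *)
have e4 : Ex P (fun w =>
    \sum_(p : I * I | p.1 != p.2) nu p.1 p.2 * \sum_k \sum_l
      vstate s w p.1 k * vstate s w p.2 l * (h p.1 p.2 k l w - h0 w))
  = \sum_(p : I * I | p.1 != p.2) nu p.1 p.2 * \sum_k \sum_l D p k l - N * Ex P h0.
  have -> : (fun w =>
    \sum_(p : I * I | p.1 != p.2) nu p.1 p.2 * \sum_k \sum_l
      vstate s w p.1 k * vstate s w p.2 l * (h p.1 p.2 k l w - h0 w)) =
    (fun w => \sum_(p : I * I | p.1 != p.2) nu p.1 p.2 * (\sum_k \sum_l
      h p.1 p.2 k l w * (vstate s w p.1 k * vstate s w p.2 l)) - N * h0 w).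
    apply/funext => w; rewrite -(sum_rates_offdiag rates) mulr_suml -sumrB.
    apply: eq_bigr => p _; rewrite -mulrBr; congr (_ * _).
    rewrite -[h0 w in RHS]mul1r -(sum_song1 p.1 p.2 (vstate_valid s w)) mulr_suml -sumrB.
    apply: eq_bigr => k _; rewrite mulr_suml -sumrB; apply: eq_bigr => l _.
    by ring.
  have bb p k l : p.1 != p.2 -> bounded_rv (fun w =>
      h p.1 p.2 k l w * (vstate s w p.1 k * vstate s w p.2 l)).
    by move=> pp; apply: bounded_rvM; [exact: bh|exact: bounded_rvM].
  rewrite ExB; [|apply: bounded_rv_sum => p pp; apply: bounded_rvZ;
    do 2 apply: bounded_rv_sum => ? _; exact: bb|exact: bounded_rvZ].
  rewrite ExZ//; congr (_ - _); rewrite Ex_sum; last first.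
    move=> p pp; apply: bounded_rvZ; do 2 apply: bounded_rv_sum => ? _; exact: bb.
  apply: eq_bigr => p pp; rewrite ExZ; last first.
    by do 2 apply: bounded_rv_sum => ? _; exact: bb.
  congr (_ * _); rewrite Ex_sum; last by move=> k _; apply: bounded_rv_sum => l _; exact: bb.
  by apply: eq_bigr => k _; rewrite Ex_sum// => l _; exact: bb.
rewrite e4.
set S := \sum_(p | _) nu p.1 p.2 * _ in e3 *.
set y := N * dl in e1 e2 e3 *; have y0 : 0 <= y by rewrite mulr_ge0.
(* From [(1 - y + y ^+ 2) * (1 + y) = 1 + y ^+ 3] and [1 + y <= expR y]. *)
have e5 : expR (- y) <= 1 - y + y ^+ 2.
  have := expR_ge1Dx y; rewrite expRN => e.
  have ey : 0 < expR y by exact: expR_gt0.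
  rewrite -(ler_pM2r ey) mulVf ?gt_eqF//.
  have yy : 0 <= 1 - y + y ^+ 2 by nra.
  by apply: le_trans (ler_wpM2l yy e); nra.
have e6 : expR (- y) * Ex P h0 <= Ex P h0 - y * Ex P h0 + y ^+ 2 * K.
  apply: (le_trans (ler_wpM2r Eh0 e5)).
  have : y ^+ 2 * Ex P h0 <= y ^+ 2 * K by rewrite ler_wpM2l ?sqr_ge0.
  by lra.
have yE : y ^+ 2 = N ^+ 2 * dl ^+ 2 by rewrite /y exprMn.
have -> : (N ^+ 2 * sigma%:R ^+ 2 + 2) * N ^+ 2 * K * dl ^+ 2 =
   N ^+ 2 * sigma%:R ^+ 2 * (y ^+ 2 * K) + 2 * (y ^+ 2 * K) by rewrite yE; ring.
have -> : dl * (S - N * Ex P h0) = dl * S - y * Ex P h0 by rewrite /y; ring.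
lra.
Qed.

Lemma sum_offdiag (h : I -> I -> R) :
  \sum_(p : I * I | p.1 != p.2) nu p.1 p.2 * h p.1 p.2 = \sum_i \sum_j nu i j * h i j.
Proof.
rewrite pair_big/= [RHS](bigID (fun p => p.1 != p.2))/=.
rewrite [X in _ + X]big1 ?addr0// => p; rewrite negbK => /eqP ->.
by rewrite (rate_diag rates) mul0r.
Qed.

(** It depends on [N] and [sigma], but it only multiplies squared step lengths and disappears as the
    grid is refined. *)
Definition step_const : R := (N ^+ 2 * sigma%:R ^+ 2 + 2) * N ^+ 2.

Lemma one_step_le (s t K : R) (Z h0 D : T -> R)
    (h : I -> I -> 'I_sigma -> 'I_sigma -> T -> R) :
  0 <= s -> s <= t ->
  bounded_rv Z -> (forall w, 0 <= Z w <= K) ->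
  adapted (F s) h0 -> (forall w, 0 <= h0 w <= K) ->
  (forall a b k l, a != b -> adapted (F s) (h a b k l)) ->
  (forall a b k l w, a != b -> 0 <= h a b k l w <= K) ->
  {ae P, forall w, none M s t w -> Z w <= h0 w} ->
  {ae P, forall w a b, a != b -> single M a b s t w ->
    Z w <= h a b (next_song a b s w).1 (next_song a b s w).2 w} ->
  bounded_rv D ->
  (forall w, \sum_i \sum_j nu i j * \sum_k \sum_l
      vstate s w i k * vstate s w j l * (h i j k l w - h0 w) <= D w) ->
  Ex P Z <= Ex P h0 + (t - s) * Ex P D + step_const * K * (t - s) ^+ 2.
Proof.
move=> s0 st bZ ZK ah0 h0K ah hK Zn Zo bD hD.
apply: (le_trans (one_step s0 st bZ ZK ah0 h0K ah hK Zn Zo)).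
rewrite lerD2r lerD2l ler_wpM2l ?subr_ge0//; apply: le_Ex => // [|w]; last first.
  by rewrite (sum_offdiag (fun i j => \sum_k \sum_l
    vstate s w i k * vstate s w j l * (h i j k l w - h0 w))).
apply: bounded_rv_sum => p pp; apply: bounded_rvZ.
do 2 apply: bounded_rv_sum => ? _.
apply: bounded_rvM; first by apply: bounded_rvM; exact: vstate_bounded.
apply: bounded_rvB.
  by apply: (weight_bounded s0 (ah _ _ _ _ pp)) => w; exact: hK.
exact: weight_bounded s0 ah0 h0K.
Qed.

Lemma functional_adapted G s : state_measurable G -> 0 <= s ->
  adapted (F s) (fun w => G (vstate s w)).
Proof.
move=> mG s0.
apply: (mG _ (g_sigma_algebraType (F s)) (fun w : g_sigma_algebraType (F s) => vstate s w)).
  by move=> w; exact: vstate_valid.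
by move=> i k; exact: (vstate_adapted).
Qed.

Lemma functional_bounded G s : state_measurable G -> 0 <= s ->
  (exists K, forall x, valid x -> `|G x| <= K) ->
  bounded_rv (fun w => G (vstate s w)).
Proof.
move=> mG s0 [K GK]; split.
  exact: (adapted_measurable (sF s0) (Fm s0) (functional_adapted mG s0)).
by exists K => w; apply: GK; exact: vstate_valid.
Qed.

Lemma ae_vstate_none s t : 0 <= s -> s <= t ->
  {ae P, forall w, none M s t w -> vstate t w = vstate s w}.
Proof.
move=> s0 st; have t0 := le_trans s0 st.
have a1 := ae_vstate s0; have a2 := ae_vstate t0.
apply: filterS2 (ae_regular) (filterI a1 a2) => w reg [-> ->] nn.
exact: (state_none s0 st reg nn).
Qed.

Lemma ae_vstate_single s t : 0 <= s -> s <= t ->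
  {ae P, forall w a b, a != b -> single M a b s t w -> vstate t w =
    update eta (vstate s w) a b (next_song a b s w).1 (next_song a b s w).2}.
Proof.
move=> s0 st; have t0 := le_trans s0 st.
have a1 := ae_vstate s0; have a2 := ae_vstate t0.
apply: filterS2 (ae_regular) (filterI a1 a2) => w reg [-> ->] a b ab one.
exact: (state_single ab s0 st reg one).
Qed.

(** * Decrease of the expected potential along a time grid *)

Section potential_decrease.
Variable K : R.
Hypotheses (I2 : (2 <= #|I|)%N) (gap0 : 0 < spectral_gap nu) (sg : (1 <= sigma)%N)
  (potK : forall x : I -> 'I_sigma -> R, valid x -> pot eta nu x <= K).

Let K0 : 0 <= K.
Proof. exact: le_trans (pot_ge0 heta gap0 vx0) (potK vx0). Qed.

Lemma pot_bounded s : 0 <= s -> bounded_rv (fun w => pot eta nu (vstate s w)).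
Proof.
move=> s0; apply: functional_bounded => //; first exact: state_measurable_pot.
by exists K => x vx; rewrite ger0_norm ?potK//; exact: (pot_ge0 heta gap0).
Qed.

Lemma psi_bounded s : 0 <= s -> bounded_rv (fun w => psi eta (vstate s w)).
Proof.
move=> s0; apply: functional_bounded => //; first exact: state_measurable_psi.
exists (sigma%:R * (N / eta) + 1) => x vx.
by have /andP[p0 p1] := psi_itv heta vx; rewrite ger0_norm.
Qed.

Lemma pot_step s t : 0 <= s -> s <= t ->
  Ex P (fun w => pot eta nu (vstate t w)) <= Ex P (fun w => pot eta nu (vstate s w))
    - (t - s) * (eta / 10 * Ex P (fun w => psi eta (vstate s w)))
    + step_const * K * (t - s) ^+ 2.
Proof.
move=> s0 st; have t0 := le_trans s0 st; have /andP[e0 e1] := heta.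
have vv r w : valid (vstate r w) by exact: vstate_valid.
have mpot : state_measurable (fun x : I -> 'I_sigma -> R => pot eta nu x).
  exact: state_measurable_pot.
have pK (x : I -> 'I_sigma -> R) : valid x -> 0 <= pot eta nu x <= K.
  by move=> vx; apply/andP; split; [exact: (pot_ge0 heta gap0)|exact: potK].
pose h a b k l (w : T) := pot eta nu (update eta (vstate s w) a b k l).
have bpsi := psi_bounded s0.
have -> : Ex P (fun w => pot eta nu (vstate s w))
    - (t - s) * (eta / 10 * Ex P (fun w => psi eta (vstate s w))) =
  Ex P (fun w => pot eta nu (vstate s w))
    + (t - s) * Ex P (fun w => - (eta / 10) * psi eta (vstate s w)).
  by rewrite ExZ// mulNr mulrN.
apply: (@one_step_le s t K
  (fun w => pot eta nu (vstate t w)) (fun w => pot eta nu (vstate s w)) _ h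
  s0 st (pot_bounded t0)).
- by move=> w; exact/pK/vv.
- exact: functional_adapted.
- by move=> w; exact/pK/vv.
- move=> a b k l ab.
  exact: (functional_adapted (state_measurable_update heta k l ab mpot)).
- by move=> a b k l w ab; apply: pK; exact: valid_update.
- by apply: filterS (ae_vstate_none s0 st) => w vn nn; rewrite vn.
- by apply: filterS (ae_vstate_single s0 st) => w vn a b ab one; rewrite (vn a b ab one).
- exact: bounded_rvZ.
- move=> w; apply: (le_trans (pot_drift heta I2 rates gap0 (vv s w))).
  by rewrite mulNr lerN2; exact: (psi_le_diss heta I2 (vv s w) sg).
Qed.

(** [pot_step] telescopes, and the potential remaining at the end is dropped by nonnegativity. *)
Lemma pot_sum dl n : 0 <= dl ->
  dl * (eta / 10) * \sum_(m < n) Ex P (fun w => psi eta (vstate (m%:R * dl) w))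
  <= K + n%:R * (step_const * K * dl ^+ 2).
Proof.
move=> dl0.
suff H : Ex P (fun w => pot eta nu (vstate (n%:R * dl) w))
    + dl * (eta / 10) * \sum_(m < n) Ex P (fun w => psi eta (vstate (m%:R * dl) w))
    <= K + n%:R * (step_const * K * dl ^+ 2).
  apply: le_trans H; rewrite lerDr; apply: Ex_ge0 => w.
  by apply: (pot_ge0 heta gap0); exact: vstate_valid.
elim: n => [|n IH].
  rewrite big_ord0 mulr0 addr0 !mul0r addr0 -[leRHS](Ex_cst P).
  apply: le_Ex => [||w]; [exact: pot_bounded|exact: bounded_rv_cst|].
  by apply: potK; exact: vstate_valid.
have n0 : 0 <= n%:R * dl by rewrite mulr_ge0.
have nn : n%:R * dl <= n.+1%:R * dl by rewrite ler_wpM2r// ler_nat.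
have := pot_step n0 nn; rewrite -mulrBl -natrB// subSnn mul1r.
rewrite big_ord_recr/= mulrDr -[n.+1%:R in X in _ -> _ <= X]natr1.
set E1 := Ex P _; set E0 := Ex P _ in IH *; set E2 := Ex P _.
set S := \sum__ _ in IH *; set c := _ * dl ^+ 2 in IH *; lra.
Qed.

End potential_decrease.

(** * Probability of playing another song *)

(* The [n]-th meeting, counted from 0, takes place in ]s, t] if and only if
   [M i j s w <= n < M i j t w]. *)
Definition deviates (k : 'I_sigma) (s t : R) : set T := [set w | exists i j n,
  [/\ i != j, (M i j s w <= n)%N, (n < M i j t w)%N & song i j n w <> (k, k)]].

Lemma deviates_adapted k s t : 0 <= s -> s <= t -> F t (deviates k s t).
Proof.
move=> s0 st; have t0 := le_trans s0 st.
apply: (sigma_exists (sF t0)) => i; apply: (sigma_exists (sF t0)) => j.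
apply: (sigma_exists (sF t0)) => n.
have [ij|nij] := boolP (i != j); last first.
  rewrite (_ : (fun _ => _) = set0); first exact: (sigma_set0 (sF t0)).
  by apply/seteqP; split=> w //= [].
rewrite (_ : (fun _ => _) = [set w | (M i j s w <= n)%N] `&`
  [set w | exists kl, ([set w | kl <> (k, k) /\ ((meeting_time M i j n w <= t%:E)%E /\
     song i j n w = kl)]) w]); last first.
  apply/seteqP; split=> w /=.
    move=> [_ h1 h2 h3]; split=> //; exists (song i j n w); split=> //; split=> //.
    exact/(meeting_time_le clocks _ _ ij t0).
  move=> [h1 [kl [h3 [/(meeting_time_le clocks _ _ ij t0) h2 h4]]]].
  by split=> //; rewrite h4.
apply: (sigma_setI (sF t0)).
  by apply: (Fmono s0 st); exact: (count_le_measurable).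
apply: (sigma_exists (sF t0)) => kl.
have [kk|kk] := pselect (kl = (k, k)).
  rewrite (_ : [set _ | _] = set0); first exact: (sigma_set0 (sF t0)).
  by apply/seteqP; split=> w //= [].
rewrite (_ : [set _ | _] = [set w | (meeting_time M i j n w <= t%:E)%E /\ song i j n w = kl]).
  exact: (ipod_song_adapted ipod).
by apply/seteqP; split=> w /= => [[]//|].
Qed.

Definition other_weight (k : 'I_sigma) (x : I -> 'I_sigma -> R) : R :=
  (N - total (x^~ k)) / eta.

Lemma state_measurable_other_weight k : state_measurable (other_weight k).
Proof.
move=> dd T' Z vZ mZ; apply: measurable_funM => //; apply: measurable_funB => //.
exact: state_measurable_total.
Qed.

Lemma other_weight_itv k x : valid x -> 0 <= other_weight k x <= N / eta.
Proof.
move=> vx; have /andP[e0 e1] := heta; apply/andP; split.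
  by apply: divr_ge0; [rewrite subr_ge0 total_le|exact: ltW].
by rewrite ler_pM2r ?invr_gt0// gerBl total_ge0.
Qed.

Lemma deviationE (x : I -> 'I_sigma -> R) a b k k1 l1 :
  deviation eta x a b k (k == k1)%:R (k == l1)%:R =
  if (k1, l1) == (k, k) then other_weight k (update eta x a b k1 l1) else 1.
Proof.
rewrite xpair_eqE /deviation [k1 == k]eq_sym [l1 == k]eq_sym /other_weight /update.
case: (k == k1); case: (k == l1) => /=.
- by rewrite !mul1r subrr addr0.
- by rewrite mulr0 mul0r subr0 add0r.
- by rewrite !mul0r subr0 add0r.
- by rewrite !mul0r subr0 add0r.
Qed.

Lemma deviation_itv (x : I -> 'I_sigma -> R) a b k k1 l1 : a != b -> valid x ->
  0 <= deviation eta x a b k (k == k1)%:R (k == l1)%:R <= 1 + N / eta.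
Proof.
move=> ab vx; rewrite deviationE; have /andP[e0 e1] := heta.
have Ne : 0 <= N / eta by rewrite divr_ge0// ltW.
case: ifP => _; last by rewrite ler01 lerDl.
have /andP[h0 h1] := other_weight_itv k (valid_update heta k1 l1 ab vx).
by rewrite h0 (le_trans h1)// lerDr.
Qed.

Section from_event.
Variables (s : R) (A : set T) (k : 'I_sigma).
Hypotheses (s0 : 0 <= s) (FA : F s A).

(* Up to O(h^2) per time step, a supermartingale dominating the probability that a
   song other than [k] has been played. *)
Definition alarm (r : R) (w : T) : R :=
  \1_(A `&` deviates k s r) w + \1_(A `\` deviates k s r) w * other_weight k (vstate r w).

Let alarm_sets r : s <= r ->
  F r (A `&` deviates k s r) /\ F r (A `\` deviates k s r).
Proof.
move=> sr; have r0 := le_trans s0 sr; have FrA := Fmono s0 sr FA.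
have Fd := deviates_adapted k s0 sr.
by split; [exact: (sigma_setI (sF r0))|exact: (sigma_setD (sF r0))].
Qed.

Lemma alarm_adapted r : s <= r -> adapted (F r) (alarm r).
Proof.
move=> sr; have r0 := le_trans s0 sr; have [F1 F2] := alarm_sets sr.
have i1 : adapted (F r) (\1_(A `&` deviates k s r) : T -> R).
  by apply: adapted_indic => //; exact: sF.
have i2 : adapted (F r) (\1_(A `\` deviates k s r) : T -> R).
  by apply: adapted_indic => //; exact: sF.
apply: measurable_funD => //; apply: measurable_funM => //.
exact: (functional_adapted (state_measurable_other_weight k)).
Qed.

Lemma mix_itv r w (y c : R) : 0 <= y <= c -> 1 <= c ->
  0 <= \1_(A `&` deviates k s r) w + \1_(A `\` deviates k s r) w * y <= c.
Proof.
move=> /andP[y0 y1] c1; rewrite !indicE.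
have [Aw|nA] := pselect (A w); last first.
  by rewrite !memNset ?mul0r ?addr0 ?lexx ?(le_trans y0)// => -[].
have [dw|nd] := pselect (deviates k s r w).
  rewrite mem_set// memNset; last by case.
  by rewrite mul0r addr0 ler01.
rewrite memNset; last by case.
by rewrite mem_set// mul1r add0r y0.
Qed.

(** Without a meeting [alarm] does not change. Once a deviation has occurred it is frozen at 1 on
    [A], so the drift is carried by the event that none has occurred yet. There a meeting turns the
    weight into [deviation], to which [deviation_drift] applies. *)
Lemma alarm_step r t : s <= r -> r <= t ->
  Ex P (alarm t) <= Ex P (alarm r)
    + step_const * (1 + N / eta) * (t - r) ^+ 2.
Proof.
move=> sr rt; have r0 := le_trans s0 sr; have st := le_trans sr rt.
have t0 := le_trans r0 rt; have /andP[e0 e1] := heta.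
have Ne : 0 <= N / eta by rewrite divr_ge0// ltW.
have c1 : 1 <= 1 + N / eta by rewrite lerDl.
have vv q w : valid (vstate q w) by exact: vstate_valid.
have [F1 F2] := alarm_sets sr.
have i1 : adapted (F r) (\1_(A `&` deviates k s r) : T -> R).
  by apply: adapted_indic => //; exact: sF.
have i2 : adapted (F r) (\1_(A `\` deviates k s r) : T -> R).
  by apply: adapted_indic => //; exact: sF.
have alarm_itv q w : 0 <= alarm q w <= 1 + N / eta.
  apply: mix_itv => //; have /andP[h0 h1] := other_weight_itv k (vv q w).
  by rewrite h0 (le_trans h1)// lerDr.
pose h a b k1 l1 (w : T) : R := \1_(A `&` deviates k s r) w + \1_(A `\` deviates k s r) w *
  deviation eta (vstate r w) a b k (k == k1)%:R (k == l1)%:R.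
have -> : Ex P (alarm r) = Ex P (alarm r) + (t - r) * Ex P (fun=> 0).
  by rewrite Ex_cst mulr0 addr0.
apply: (@one_step_le r t (1 + N / eta)
  (alarm t) (alarm r) (fun=> 0) h r0 rt).
- exact: (weight_bounded t0 (alarm_adapted st) (alarm_itv t)).
- exact: alarm_itv.
- exact: alarm_adapted.
- exact: alarm_itv.
- move=> a b k1 l1 ab; apply: measurable_funD => //; apply: measurable_funM => //.
  exact: (functional_adapted (state_measurable_deviation eta k _ _ ab)).
- by move=> a b k1 l1 w ab; apply: mix_itv => //; exact: deviation_itv.
- apply: filterS (ae_vstate_none r0 rt) => w vn nn.
  suff dE : deviates k s t w <-> deviates k s r w.
    rewrite /alarm (vn nn) le_eqVlt; apply/orP; left; apply/eqP.
    congr (_ + _ * _); rewrite !indicE; congr (nat_of_bool _)%:R;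
      apply/idP/idP; rewrite !inE => -[Aw dw]; split=> //.
    - exact/dE.
    - exact/dE.
    - by move/dE.
    - by move/dE.
  have Me i j : i != j -> M i j t w = M i j r w.
    move=> ij; apply/eqP; rewrite eqn_leq (clocks_nondecreasing clocks w ij r0 rt) andbT.
    by rewrite -subn_eq0; apply/eqP; exact: nn.
  split=> -[i [j [n [ij h1 h2 h3]]]]; exists i, j, n; split=> //.
    by rewrite -Me.
  by rewrite Me.
- apply: filterS (ae_vstate_single r0 rt) => w vn a b ab one.
  rewrite /h; have Mab := single_count ab r0 rt one.
  set kl := next_song a b r w.
  rewrite deviationE -surjective_pairing.
  have dE : deviates k s t w <-> deviates k s r w \/ kl <> (k, k).
    split.
      move=> [i [j [n [ij h1 h2 h3]]]].
      have [nr|rn] := ltnP n (M i j r w); first by left; exists i, j, n.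
      right; have hij := one i j ij.
      have : (0 < M i j t w - M i j r w)%N by rewrite subn_gt0 (leq_ltn_trans rn).
      rewrite hij; case: eqP => //= ia; case: eqP => //= jb _.
      suff nE : n = M a b r w by rewrite /kl /next_song -nE -ia -jb.
      by apply/eqP; rewrite eqn_leq -ltnS -Mab -{1}ia -{1}jb h2 -ia -jb rn.
    case=> [[i [j [n [ij h1 h2 h3]]]]|kk].
      exists i, j, n; split=> //.
      exact: leq_trans h2 (clocks_nondecreasing clocks w ij r0 rt).
    exists a, b, (M a b r w); split=> //; last by rewrite Mab.
    exact: (clocks_nondecreasing clocks w ab s0 sr).
  rewrite /alarm (vn a b ab one) -/kl !indicE.
  have [Aw|nA] := pselect (A w); last first.
    by rewrite !memNset ?mul0r// => -[].
  have [dr|ndr] := pselect (deviates k s r w).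
    have dt : deviates k s t w by apply/dE; left.
    rewrite [w \in A `&` deviates k s t]mem_set// [w \in A `\` deviates k s t]memNset; last by case.
    rewrite [w \in A `&` deviates k s r]mem_set// [w \in A `\` deviates k s r]memNset; last by case.
    by rewrite !mul0r.
  rewrite [w \in A `&` deviates k s r]memNset; last by case.
  rewrite [w \in A `\` deviates k s r]mem_set// mul1r add0r.
  have [kk|nkk] := eqVneq kl (k, k).
    have ndt : ~ deviates k s t w by move/dE => [//|]; rewrite kk.
    rewrite [w \in A `&` deviates k s t]memNset; last by case.
    by rewrite [w \in A `\` deviates k s t]mem_set// mul1r add0r.
  have dt : deviates k s t w by apply/dE; right; exact/eqP.
  rewrite [w \in A `&` deviates k s t]mem_set// [w \in A `\` deviates k s t]memNset; last by case.
  by rewrite mul0r addr0.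
- exact: bounded_rv_cst.
move=> w; apply: sumr_le0 => i _; apply: sumr_le0 => j _.
have [->|ij] := eqVneq i j; first by rewrite (rate_diag rates) mul0r.
apply: mulr_ge0_le0; first exact: (rate_ge0 rates).
set c := \1_(A `\` deviates k s r) w : R.
have -> : \sum_k0 \sum_l vstate r w i k0 * vstate r w j l * (h i j k0 l w - alarm r w)
  = c * (bern2 (vstate r w i k) (vstate r w j k) (deviation eta (vstate r w) i j k)
         - other_weight k (vstate r w)).
  have splitE (y : R) : y = \sum_k0 \sum_l vstate r w i k0 * vstate r w j l * y.
    under eq_bigr => k0 _ do rewrite -mulr_suml.
    by rewrite -mulr_suml (sum_song1 i j (vv r w)) mul1r.
  rewrite -(sum_song i j k _ (vv r w)) [other_weight _ _ in RHS]splitE -sumrB mulr_sumr.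
  apply: eq_bigr => k0 _; rewrite -sumrB mulr_sumr.
  by apply: eq_bigr => l _; rewrite /h /alarm -/c; ring.
apply: mulr_ge0_le0; first by rewrite /c indicE.
by rewrite subr_le0; exact: (deviation_drift heta k ij (vv r w)).
Qed.

(** At time [s] no deviation has occurred, so the expected [alarm] starts at the right side; over
    [n.+1] equal steps it grows by [O(1 / n.+1)]. *)
Lemma deviates_prob t : s <= t ->
  Ex P \1_(A `&` deviates k s t) <= Ex P (fun w => \1_A w * other_weight k (vstate s w)).
Proof.
move=> st; have t0 := le_trans s0 st; have /andP[e0 e1] := heta.
have vv q w : valid (vstate q w) by exact: vstate_valid.
have Ne : 0 <= N / eta by rewrite divr_ge0// ltW.
have c1 : 1 <= 1 + N / eta by rewrite lerDl.
have alarm_itv q w : 0 <= alarm q w <= 1 + N / eta.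
  apply: mix_itv => //; have /andP[h0 h1] := other_weight_itv k (vv q w).
  by rewrite h0 (le_trans h1)// lerDr.
have balarm q : s <= q -> bounded_rv (alarm q).
  move=> sq; exact: (weight_bounded (le_trans s0 sq) (alarm_adapted sq) (alarm_itv q)).
have [F1 F2] := alarm_sets st.
apply: (le_trans (y := Ex P (alarm t))).
  apply: le_Ex => [||w]; [exact/bounded_rv_indic/(Fm t0)|exact: balarm|].
  rewrite /alarm lerDl mulr_ge0 ?indicE//.
  by case/andP: (other_weight_itv k (vv t w)).
have -> : Ex P (fun w => \1_A w * other_weight k (vstate s w)) = Ex P (alarm s).
  have d0 : deviates k s s = set0.
    apply/seteqP; split=> w //= [i [j [n [_ h1 h2]]]].
    by move: (leq_trans h2 h1); rewrite ltnn.
  by congr Ex; apply/funext => w; rewrite /alarm d0 setI0 setD0 indic0 add0r.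
pose c := step_const * (1 + N / eta).
apply: (@le_of_le_div _ _ _ (c * (t - s) ^+ 2)) => n.
have n0 : 0 < n.+1%:R :> R by rewrite ltr0n.
pose dl := (t - s) / n.+1%:R; have dl0 : 0 <= dl by rewrite divr_ge0 ?subr_ge0.
have step q : Ex P (alarm (s + q%:R * dl)) <= Ex P (alarm s) + q%:R * (c * dl ^+ 2).
  elim: q => [|q IH]; first by rewrite !mul0r !addr0.
  have q0 : s <= s + q%:R * dl by rewrite lerDl mulr_ge0.
  have qs : s + q%:R * dl <= s + q.+1%:R * dl by rewrite lerD2l ler_wpM2r// ler_nat.
  apply: (le_trans (alarm_step q0 qs)).
  rewrite opprD addrACA subrr add0r -mulrBl -natrB// subSnn mul1r -/c.
  by rewrite -natr1 mulrDl mul1r addrA lerD2r.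
have := step n.+1; rewrite /dl [n.+1%:R * (_ / _)]mulrC divfK ?gt_eqF// addrC subrK.
move/le_trans; apply; rewrite lerD2l le_eqVlt; apply/orP; left; apply/eqP.
by set a := n.+1%:R in n0 *; field; rewrite gt_eqF.
Qed.

Definition deviates_after : set T := \bigcup_m deviates k s (s + m%:R).

Lemma deviates_after_measurable : measurable deviates_after.
Proof.
apply: bigcup_measurable => m _.
have sm : s <= s + m%:R by rewrite lerDl.
exact: (Fm (le_trans s0 sm) (deviates_adapted k s0 sm)).
Qed.

Lemma deviates_after_prob :
  Ex P \1_(A `&` deviates_after) <= Ex P (fun w => \1_A w * other_weight k (vstate s w)).
Proof.
have sm m : s <= s + m%:R by rewrite lerDl.
pose Am m := A `&` deviates k s (s + m%:R).
have mAm m : measurable (Am m).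
  apply: measurableI; first exact: (Fm s0).
  exact: (Fm (le_trans s0 (sm m)) (deviates_adapted k s0 (sm m))).
have AE : A `&` deviates_after = \bigcup_m Am m by rewrite setI_bigcupr.
have mU : measurable (\bigcup_m Am m) by exact: bigcup_measurable.
have ndA : nondecreasing_seq Am.
  move=> m1 m2 m12; apply/subsetPset => w [Aw [i [j [n [ij h1 h2 h3]]]]]; split=> //.
  exists i, j, n; split=> //; apply: (leq_trans h2).
  by apply: (clocks_nondecreasing clocks) => //; rewrite ?addr_ge0// lerD2l ler_nat.
have cvgP := nondecreasing_cvg_mu (mu := P) mAm mU ndA.
rewrite -lee_fin AE -probEFin// -(cvg_lim _ cvgP)//.
apply: lime_le; first by apply/cvg_ex; eexists; exact: cvgP.
apply: nearW => m; rewrite /= (probEFin P (mAm m)) lee_fin.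
exact: deviates_prob.
Qed.

End from_event.

Definition unsettled (s : R) : set T := [set w | forall k, deviates_after s k w].

Lemma unsettled_measurable s : 0 <= s -> measurable (unsettled s).
Proof.
move=> s0; have -> : unsettled s = \big[setI/setT]_(k : 'I_sigma) deviates_after s k.
  rewrite -bigcap_seq/=; apply/seteqP; split=> w /= => [h k _|h k]; first exact: h.
  by apply: h; rewrite /= mem_index_enum.
by apply: bigsetI_measurable => k _; exact: deviates_after_measurable.
Qed.

(** If song [k] is close at time [s], being unsettled forces a deviation from [k], and
    [deviates_after_prob] applies with the event that [k] is close as the conditioning event. If no
    song is close, the product in [psi] is 1. *)
Lemma unsettled_prob s : 0 <= s ->
  Ex P \1_(unsettled s) <= Ex P (fun w => psi eta (vstate s w)).
Proof.
move=> s0; have /andP[e0 e1] := heta.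
have vv w : valid (vstate s w) by exact: vstate_valid.
pose A k := [set w | 1 <= close k (vstate s w)].
have FA k : F s (A k).
  apply: (adapted_ge (sF s0)).
  exact: (functional_adapted (@state_measurable_close R I sigma k)).
have cE k w : close k (vstate s w) = \1_(A k) w.
  rewrite indicE; have -> // : (w \in A k) = (N - total ((vstate s w)^~ k) <= 1 / 2).
  by apply/idP/idP; rewrite inE /A /= /close; case: (N - _ <= _) => //=; rewrite ler10.
have bi C : measurable C -> bounded_rv (\1_C : T -> R) by exact: bounded_rv_indic.
have mA k := Fm s0 (FA k).
have mD k := deviates_after_measurable k s0.
have bw k : bounded_rv (fun w => other_weight k (vstate s w)).
  apply: (functional_bounded (state_measurable_other_weight k) s0).
  exists (N / eta) => x vx; have /andP[h0 h1] := other_weight_itv k vx.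
  by rewrite ger0_norm.
have bprod : bounded_rv (fun w => \prod_k (1 - close k (vstate s w))).
  split.
    have mc k : measurable_fun setT (fun w => close k (vstate s w)).
      under eq_fun do rewrite cE; exact: (bi _ (mA k)).1.
    by apply: measurable_prod => k _; exact: measurable_funB.
  exists 1 => w; have c01 k : 0 <= 1 - close k (vstate s w) <= 1.
    by have /andP[? ?] := close_itv k (vstate s w); rewrite subr_ge0 gerBl; apply/andP.
  by rewrite ger0_norm ?prodr_ile1// prodr_ge0// => k _; case/andP: (c01 k).
have bAD k : bounded_rv (\1_(A k `&` deviates_after s k) : T -> R).
  by apply: bi; exact: measurableI.
apply: (le_trans (y := Ex P (fun w => \sum_k \1_(A k `&` deviates_after s k) w
    + \prod_k (1 - close k (vstate s w))))).
  apply: le_Ex => [||w].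
  - by apply: bi; exact: unsettled_measurable.
  - by apply: bounded_rvD => //; apply: bounded_rv_sum.
  have p0 : 0 <= \prod_k (1 - close k (vstate s w)).
    by apply: prodr_ge0 => k _; have /andP[? ?] := close_itv k (vstate s w); rewrite subr_ge0.
  have s0' : 0 <= \sum_k \1_(A k `&` deviates_after s k) w :> R.
    by apply: sumr_ge0 => k _; rewrite indicE.
  rewrite indicE; have [|_] := boolP (w \in unsettled s); last exact: addr_ge0.
  rewrite inE => uw.
  have [[k Ak]|nA] := pselect (exists k, A k w).
    apply: ler_wpDr => //; rewrite (bigD1 k)//=; apply: ler_wpDr.
      by apply: sumr_ge0 => l _; rewrite indicE.
    by rewrite indicE mem_set//; split=> //; exact: uw.
  apply: ler_wpDl => //; rewrite big1// => k _.
  by rewrite cE indicE memNset ?subr0// => Ak; apply: nA; exists k.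
have -> : (fun w => psi eta (vstate s w)) = (fun w => \sum_k \1_(A k) w * other_weight k (vstate s w)
    + \prod_k (1 - close k (vstate s w))).
  by apply/funext => w; rewrite /psi; congr (_ + _); apply: eq_bigr => k _; rewrite cE.
have bAw k : bounded_rv (fun w => \1_(A k) w * other_weight k (vstate s w)).
  by apply: bounded_rvM => //; exact: bi.
rewrite !ExD//; [|exact: bounded_rv_sum..].
rewrite lerD2r !Ex_sum//; apply: ler_sum => k _.
exact: deviates_after_prob.
Qed.

(** * The fixation time *)

(** Needed so that the song that wins is really played infinitely often and [fixation_time] is not
    +oo by default. The probability of no meeting in ]q, q + m] is [expR (- (N * m))], which tends
    to 0. *)
Lemma ae_meetings : (0 < #|I|)%N -> {ae P, forall w, forall q : nat,
  exists i j n, [/\ i != j, (M i j q%:R w <= n)%N & finite_meeting i j n w]}.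
Proof.
move=> I0; apply: ae_foralln => q.
pose B := \bigcap_m none M q%:R (q + m)%:R.
have q0 : 0 <= (q%:R : R) by exact: ler0n.
have qm m : (q%:R : R) <= (q + m)%:R by rewrite ler_nat leq_addr.
have mn m : measurable (none M q%:R (q + m)%:R).
  exact: (Fm (le_trans q0 (qm m)) (incr_is_adapted filt clocks _ q0 (qm m))).
have mB : measurable B by exact: bigcap_measurable.
have bi C : measurable C -> bounded_rv (\1_C : T -> R) by exact: bounded_rv_indic.
have EB : Ex P \1_B <= 0.
  apply: (@le_of_le_div _ _ _ 1) => m; rewrite add0r.
  apply: (le_trans (y := Ex P \1_(none M q%:R (q + m.+1)%:R))).
    apply: le_Ex => [||w]; [exact: bi|exact: bi|].
    rewrite !indicE; have [|_] := boolP (w \in B); last by [].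
    by rewrite inE => Bw; rewrite mem_set//; exact: Bw.
  have := none_indep rates clocks q0 (qm m.+1) (sigma_setT (sF q0)).
  rewrite setTI (probEFin P (mn m.+1)) (probEFin P (@measurableT _ T)) indicT Ex_cst mul1e.
  move=> [->]; rewrite natrD addrAC subrr add0r expRN div1r.
  have N1 : 1 <= N by rewrite ler1n.
  have m1 : 0 < m.+1%:R :> R by rewrite ltr0n.
  have Nm : m.+1%:R <= N * m.+1%:R by rewrite ler_peMl// ltW.
  rewrite lef_pV2 ?posrE ?expR_gt0//.
  by apply: (le_trans Nm); apply: le_trans (expR_ge1Dx _); rewrite lerDr.
have nB : P.-negligible B.
  apply/negligibleP => //; transitivity ((Ex P \1_B)%:E); first exact: probEFin.
  by congr (_%:E); apply/eqP; rewrite eq_le EB Ex_indic_ge0.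
apply: negligibleS nB => w /= nw m _ i j ij; apply/eqP; rewrite subn_eq0.
rewrite leqNgt; apply/negP => lt; apply: nw; exists i, j, (M i j q%:R w); split=> //.
by apply/(meeting_time_lty clocks _ _ ij); exists (q + m)%N.
Qed.

Lemma finite_plays (t : R) w : 0 <= t -> finite_set [set tau : R | exists i j n,
  [/\ i != j, meeting_time M i j n w = tau%:E & tau <= t]].
Proof.
move=> t0; pose L := (\sum_i \sum_j M i j t w).+1.
apply: (@sub_finite_set _ _ ((fun p : I * I * 'I_L =>
  fine (meeting_time M p.1.1 p.1.2 p.2 w)) @` setT)); last first.
  exact/finite_image/finite_finset.
move=> tau /= [i [j [n [ij tauE taut]]]].
have nt : (n < M i j t w)%N.
  by apply/(meeting_time_le clocks n w ij t0); rewrite tauE lee_fin.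
have nL : (n < L)%N.
  rewrite /L ltnS (leq_trans (ltnW nt))// (bigD1 i)//= (bigD1 j)//=.
  by rewrite -addnA leq_addr.
by exists (i, j, Ordinal nL) => //=; rewrite tauE.
Qed.

(** Some song [k] is the only one played after [t]. The other songs are then played finitely often,
    since finitely many meetings precede [t], while [k] is played at arbitrarily late meetings. *)
Lemma fixation_time_le w (t : R) :
  (forall q : nat, exists i j n,
    [/\ i != j, (M i j q%:R w <= n)%N & finite_meeting i j n w]) ->
  0 <= t -> ~ unsettled t w -> (fixation_time M song w <= t%:E)%E.
Proof.
move=> meet t0 nu_t.
have [k nk] : exists k, ~ deviates_after t k w.
  by apply: contrapT => h; apply: nu_t => k; apply: contrapT => nk; apply: h; exists k.
have after i j n : i != j -> (M i j t w <= n)%N -> finite_meeting i j n w ->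
    song i j n w = (k, k).
  move=> ij tn /(meeting_time_lty clocks _ _ ij)[m nm].
  apply: contrapT => sk; apply: nk; exists m => //; exists i, j, n; split=> //.
  apply: (leq_trans nm); apply: (clocks_nondecreasing clocks) => //.
  by rewrite lerDr.
have before i j n l tau : i != j -> meeting_time M i j n w = tau%:E ->
    ((song i j n w).1 = l \/ (song i j n w).2 = l) -> l != k -> tau <= t.
  move=> ij tauE sl lk; rewrite -lee_fin -tauE leNgt; apply/negP.
  move/(meeting_time_gt clocks n w ij t0) => tn.
  have := after i j n ij tn; rewrite /finite_meeting /= tauE ltry => /(_ isT) sE.
  by move: sl; rewrite sE /= => -[] kl; rewrite kl eqxx in lk.
have Hk l : infinite_set (play_times M song w l) <-> l = k.
  split=> [inf|->].
    apply: contrapT => /eqP lk; apply: inf.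
    apply: sub_finite_set (finite_plays w t0) => tau [i [j [n [ij tauE sl]]]].
    by exists i, j, n; split=> //; exact: before sl lk.
  move=> /finite_seqP[s sE].
  (* This exceeds every listed play time of [k], and [t] as well; a meeting after [q > b] plays [k]
     at a time that is not listed. *)
  pose b := \sum_(x <- s) `|x| + t.
  have b0 : 0 <= b by rewrite addr_ge0// sumr_ge0.
  have /andP[_ bq] := truncn_itv b0; set q := (Num.truncn b).+1 in bq.
  have [i [j [n [ij qn fin]]]] := meet q.
  have q0 : 0 <= (q%:R : R) by exact: ler0n.
  have tq : t <= q%:R.
    by apply: le_trans (ltW bq); rewrite /b lerDr sumr_ge0.
  have sE' : song i j n w = (k, k).
    apply: after => //; apply: leq_trans qn; exact: (clocks_nondecreasing clocks).
  have [tau tau0 tauE] := meeting_time_real clocks ij fin.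
  have qtau : q%:R < tau.
    by rewrite -lte_fin -tauE; apply/(meeting_time_gt clocks n w ij q0).
  have : play_times M song w k tau by exists i, j, n; split=> //; left; rewrite sE'.
  rewrite sE /= => taus.
  have : tau <= b.
    rewrite /b (big_rem tau)//= -addrA ler_wpDr ?addr_ge0 ?sumr_ge0//.
    exact: ler_norm.
  by rewrite leNgt (lt_trans bq qtau).
rewrite /fixation_time; case: pickP => [k' /asboolP Hk'|/(_ k)/asboolP//].
have -> : k' = k by apply/Hk/Hk'.
apply: ge_ereal_sup => _ [tau [->|[l lk [i [j [n [ij tauE sl]]]]]] <-]; rewrite lee_fin//.
exact: before sl lk.
Qed.

Lemma fixation_time_ge0 w : (0 <= fixation_time M song w)%E.
Proof.
rewrite /fixation_time; case: pickP => [k _|_]; last by rewrite leey.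
by apply: ereal_sup_ubound; exists 0 => //; left.
Qed.

(** A Riemann sum in which each grid point stands for the interval to its right, so that it bounds
    the fixation time, truncated at [n%:R * dl], from above. *)
Definition unsettled_time (dl : R) (n : nat) (w : T) : R :=
  \sum_(m < n) dl * \1_(unsettled (m%:R * dl)) w.

Lemma unsettled_time_ge dl n a w : 0 <= dl ->
  (forall t, 0 <= t -> ~ unsettled t w -> (fixation_time M song w <= t%:E)%E) ->
  0 <= a -> (a%:E <= fixation_time M song w)%E ->
  Num.min a (n%:R * dl) <= unsettled_time dl n w.
Proof.
move=> dl0 hfix a0 afix.
have un m : m%:R * dl < a -> unsettled (m%:R * dl) w.
  move=> ma; apply: contrapT => nun.
  have := le_trans afix (hfix _ (mulr_ge0 (ler0n _ m) dl0) nun).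
  by rewrite lee_fin leNgt ma.
elim: n => [|n IH]; first by rewrite mul0r /unsettled_time big_ord0 ge_min lexx orbT.
rewrite /unsettled_time big_ord_recr/= -/(unsettled_time dl n w).
have [na|an] := ltP (n%:R * dl) a.
  rewrite indicE (mem_set (un n na)) mulr1 ge_min; apply/orP; right.
  by rewrite -natr1 mulrDl mul1r lerD2r; move: IH; rewrite min_r// ltW.
rewrite ge_min; apply/orP; left; apply: ler_wpDr; first by rewrite mulr_ge0// indicE.
by move: IH; rewrite min_l.
Qed.

Lemma unsettled_time_bounded dl n : 0 <= dl -> bounded_rv (unsettled_time dl n).
Proof.
move=> dl0; apply: bounded_rv_sum => m _; apply: bounded_rvZ; apply: bounded_rv_indic.
by apply: (unsettled_measurable); rewrite mulr_ge0.
Qed.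

(** The fixation time is almost surely at most the lower limit of measurable Riemann sums, to which
    Fatou's lemma applies. Starting the sequence at [J] makes the error at most [|c| / J.+1], and
    [J] is arbitrary. *)
Lemma fixation_time_expectation (B c : R) : (0 < #|I|)%N ->
  (forall dl n, 0 <= dl -> Ex P (unsettled_time dl n) <= B + n%:R * (c * dl ^+ 2)) ->
  (\int[P]_w fixation_time M song w <= B%:E)%E.
Proof.
move=> I0 EB.
(* With step [j.+1 ^- 2] and [j.+1 ^ 3] steps, the horizon [j.+1] tends to infinity while the
   accumulated error [c / j.+1] tends to 0. *)
pose dl (j : nat) : R := (j.+1%:R ^+ 2)^-1.
pose n (j : nat) := (j.+1 ^ 3)%N.
have j0 (j : nat) : 0 < j.+1%:R :> R by rewrite ltr0n.
have dl0 j : 0 <= dl j by rewrite invr_ge0 sqr_ge0.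
have horizon j : (n j)%:R * dl j = j.+1%:R.
  by rewrite /n /dl natrX; have := j0 j; set x := j.+1%:R => xp; field; rewrite gt_eqF.
have err j : (n j)%:R * (c * dl j ^+ 2) = c / j.+1%:R.
  by rewrite /n /dl natrX; have := j0 j; set x := j.+1%:R => xp; field; rewrite gt_eqF.
pose W j (w : T) : R := unsettled_time (dl j) (n j) w.
have bW j : bounded_rv (W j) by exact: unsettled_time_bounded.
have W0 j w : 0 <= W j w by apply: sumr_ge0 => m _; rewrite mulr_ge0// indicE.
have bound J : (\int[P]_w fixation_time M song w <= (B + `|c| / J.+1%:R)%:E)%E.
  apply: (@le_trans _ _ (\int[P]_w limn_einf (fun j => (W (j + J)%N w)%:E))%E).
    apply: ge0_le_integral_ae.
    - exact: fixation_time_ge0.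
    - by move=> w; apply: (@limn_einf_ge _ _ _ 0%N) => j _; rewrite lee_fin.
    - have mW j : measurable_fun setT (fun w => (W (j + J)%N w)%:E).
        by apply/measurable_EFinP; case: (bW (j + J)%N).
      apply: (emeasurable_fun_cvg _ _ (measurable_fun_einfs mW)) => w _.
      by rewrite limn_einf_lim; exact: is_cvg_einfs.
    apply: filterS (ae_meetings I0) => w meet.
    have hfix t : 0 <= t -> ~ unsettled t w -> (fixation_time M song w <= t%:E)%E.
      exact: fixation_time_le.
    have lower a : 0 <= a -> (a%:E <= fixation_time M song w)%E ->
        (a%:E <= limn_einf (fun j => (W (j + J)%N w)%:E))%E.
      move=> a0 afix; apply: (@limn_einf_ge _ _ _ (Num.truncn a)) => j aj.
      have := unsettled_time_ge (n (j + J)%N) (dl0 (j + J)%N) hfix a0 afix.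
      rewrite horizon lee_fin min_l//.
      have /andP[_ /ltW] := truncn_itv a0; move/le_trans; apply.
      by rewrite ler_nat ltnS (leq_trans aj)// leq_addr.
    have := fixation_time_ge0 w; case E : (fixation_time M song w) => [x| |]//.
      by rewrite lee_fin => xp; apply: lower => //; rewrite E.
    move=> _; rewrite leye_eq; apply/eqP/eqyP => A A0.
    by apply: lower; [exact: ltW|rewrite E leey].
  apply: (le_trans (fatou P measurableT _ _)).
  - by move=> j; apply/measurable_EFinP; case: (bW (j + J)%N).
  - by move=> j w _; rewrite lee_fin.
  apply: limn_einf_le => j; rewrite Ex_EFin// lee_fin.
  apply: (le_trans (EB _ _ (dl0 _))); rewrite err lerD2l.
  apply: (le_trans (y := `|c| / (j + J).+1%:R)).
    by rewrite ler_wpM2r ?invr_ge0// ler_norm.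
  by rewrite ler_wpM2l// lef_pV2 ?posrE// ler_nat ltnS leq_addl.
have fin : (\int[P]_w fixation_time M song w)%E \is a fin_num.
  rewrite ge0_fin_numE; last by apply: integral_ge0 => w _; exact: fixation_time_ge0.
  exact: le_lt_trans (bound 0%N) (ltry _).
rewrite -(fineK fin) lee_fin; apply: (@le_of_le_div _ _ _ `|c|) => J.
by rewrite -lee_fin fineK.
Qed.

End process.

Theorem theorem1p1 (R : realType) (eta : R) (heta : 0 < eta < 1) :
  exists C : R,
  forall (I : finType) (nu : I -> I -> R) (sigma : nat)
    (x0 : I -> 'I_sigma -> R)
    (d : measure_display) (T : measurableType d) (P : probability T R)
    (F : R -> set (set T)) (M : I -> I -> R -> T -> nat)
    (song : I -> I -> nat -> T -> 'I_sigma * 'I_sigma)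
    (X : R -> I -> 'I_sigma -> T -> R),
  (2 <= #|I|)%N ->
  meeting_rates nu ->
  0 < spectral_gap nu ->
  (1 <= sigma)%N ->
  (forall i, probability_vector (x0 i)) ->
  ipod_process nu eta x0 P F M song X ->
  (\int[P]_w fixation_time M song w <=
   (C * ln sigma%:R * (#|I|%:R / spectral_gap nu))%:E)%E.
Proof.
exists (fixation_const eta).
move=> I nu sigma x0 d T P F M song X I2 rates gap0 sg vx0 ipod.
have /andP[e0 e1] := heta.
have I0 : (0 < #|I|)%N by exact: leq_trans I2.
(* For one song the right side is 0, and the additive terms of the potential could not be absorbed;
   here no meeting can deviate from the only song, so nothing is ever unsettled. *)
have [sg1|sg2] := leqP sigma 1.
  have sE : sigma = 1%N by apply/eqP; rewrite eqn_leq sg1.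
  have -> : ln (sigma%:R : R) = 0 by rewrite sE ln1.
  rewrite mulr0 mul0r.
  apply: (fixation_time_expectation rates ipod I0 (B := 0) (c := 0)) => dl n dl0.
  rewrite mul0r mulr0 addr0.
  have -> : unsettled_time M song dl n = fun=> 0.
    apply/funext => w; apply: big1 => m _; rewrite indicE memNset ?mulr0//.
    move=> /(_ (Ordinal sg)) [q _ [i [j [p [_ _ _]]]]]; apply.
    by case: (song i j p w) => a b; congr (_, _); apply: val_inj => /=;
      [case: a|case: b] => a' /=; rewrite sE; case: a'.
  by rewrite Ex_cst.
pose B := fixation_const eta * ln sigma%:R * (#|I|%:R / spectral_gap nu).
(* Chosen so that multiplying the bound of [pot_sum] by [10 / eta] returns exactly [B] as its
   leading term. *)
pose K := B / (10 / eta).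
have t0 : 0 < 10 / eta by rewrite divr_gt0.
have potK (x : I -> 'I_sigma -> R) : valid x -> pot eta nu x <= K.
  by move=> vx; rewrite ler_pdivlMr// mulrC; exact: pot_le_const.
apply: (fixation_time_expectation rates ipod I0 (B := B)
  (c := step_const R I sigma * K * (10 / eta))) => dl n dl0.
have us m : 0 <= m%:R * dl by rewrite mulr_ge0.
have bu m : bounded_rv (\1_(unsettled M song (m%:R * dl)) : T -> R).
  by apply: bounded_rv_indic; exact: (unsettled_measurable ipod).
rewrite /unsettled_time Ex_sum; last by move=> m _; exact: bounded_rvZ.
have := pot_sum heta rates vx0 ipod I2 gap0 sg potK n dl0.
move=> /(ler_wpM2l (ltW t0)).
have -> : 10 / eta * (K + n%:R * (step_const R I sigma * K * dl ^+ 2))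
  = B + n%:R * (step_const R I sigma * K * (10 / eta) * dl ^+ 2).
  by rewrite /K; field; rewrite gt_eqF.
apply: le_trans.
rewrite !mulrA (_ : 10 / eta * dl * eta / 10 = dl); last by field; rewrite gt_eqF.
rewrite mulr_sumr; apply: ler_sum => m _; rewrite ExZ//.
apply: ler_wpM2l => //.
exact: (unsettled_prob heta rates vx0 ipod (us m)).
Qed.
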